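(* Let $H$ be a graph, let $\mathcal{H}=(h,W,\mathcal{P},M,f)$ be a decomposition of $H$, and for each $P\in\mathcal{P}$ let $\ell_P$ be the associated parameter. If $G$ is a connected $H$-minor-free graph, then $$c(G)\leq \mathbf{1}_{\ell}+\sum_{P\in \mathcal{P}}\left\lceil\frac{\ell_P}{3}\right\rceil,$$ where $\mathbf{1}_{\ell}\in\{0,1\}$ is equal to $1$ if and only if there is some $P\in\mathcal{P}$ with $\ell_P\notin\{0,1,2,4\}$.
   Context: All graphs are finite and simple. A graph $G$ is $H$-minor-free if no graph isomorphic to $H$ can be obtained from $G$ by deleting vertices, deleting edges and contracting edges. Cop number: in the game of cops and robbers on $G$, one player places $m$ cops on (not necessarily distinct) vertices, then the other player places the robber on a vertex. Then, starting with the cops, the players alternate turns; on a turn, a player may move any of their pieces to an adjacent vertex (each piece moves at most once, and any piece may stay put). The cops win if at some point some cop occupies the same vertex as the robber; the robber wins by evading capture forever. The cop number $c(G)$ is the minimum $m$ such that the cops have a winning strategy. Paths and cycles: the length of a path or cycle is its number of edges $|E(P)|$; cycles have length at least 3. A rooted cycle is a cycle with a distinguished vertex (its root); the end vertices of a path are its first and last vertices, and both end vertices of a rooted cycle are its root. The interior of a path or rooted cycle is its set of vertices other than its end vertices. Members of a collection are pairwise internally vertex-disjoint if no interior vertex of one is a vertex of another. Decomposition: given a graph $H$, a decomposition of $H$ is a tuple $(h,W,\mathcal{P},M,f)$ where (a) $h\in V(H)$, and $H-h$ has no isolated vertex; (b) $\emptyset\neq W\subseteq V(H-h)$; (c) $\mathcal{P}$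 is a collection of distinct, pairwise internally vertex-disjoint (non-empty) paths and rooted cycles in $H-h$ with end vertices in $W$ such that every edge of $H-h$ is contained in some $P\in\mathcal{P}$; (d) $M\subseteq\mathcal{P}$ is a (possibly empty) collection of paths of length 1 which forms a matching of $H-h$ (i.e. these edges pairwise share no vertices); (e) $f:W\to\mathcal{P}\setminus M$ is a function such that $u$ is an end vertex of $f(u)$ for every $u\in W$. Parameter: for each $P\in\mathcal{P}$, $$\ell_P=\begin{cases}0 & \text{if } P\in M,\\ \max\left(|E(P)|-1+|f^{-1}(P)|,\,1\right) & \text{if } P\notin M,\end{cases}$$ where $f^{-1}(P)=\{w\in W: f(w)=P\}$. *)

(* Defs.v *)
From mathcomp Require Import all_boot.
From mathcomp Require Import boolp.

Set Implicit Arguments.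
Unset Strict Implicit.
Unset Printing Implicit Defensive.

Record sgraph := SGraph {
  vertex :> finType;
  adj : rel vertex;
  adj_sym : symmetric adj;
  adj_irr : irreflexive adj }.

Definition connected (G : sgraph) : Prop :=
  0 < #|G| /\ forall x y : G, connect (@adj G) x y.

Definition isomorphic (G H : sgraph) : Prop :=
  exists2 phi : G -> H, bijective phi & forall x y, adj (phi x) (phi y) = adj x y.

(** * Minors *)

Definition del_vertex_adj (G : sgraph) (v : G) : rel {x : G | x != v} :=
  fun x y => adj (val x) (val y).

Lemma del_vertex_sym (G : sgraph) (v : G) : symmetric (@del_vertex_adj G v).
Proof. by move=> x y; apply: adj_sym. Qed.

Lemma del_vertex_irr (G : sgraph) (v : G) : irreflexive (@del_vertex_adj G v).
Proof. by move=> x; apply: adj_irr. Qed.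

Definition del_vertex (G : sgraph) (v : G) : sgraph :=
  SGraph (@del_vertex_sym G v) (@del_vertex_irr G v).

Definition del_edge_adj (G : sgraph) (u v : G) : rel G :=
  fun x y => adj x y && ([set x; y] != [set u; v]).

Lemma del_edge_sym (G : sgraph) (u v : G) : symmetric (@del_edge_adj G u v).
Proof. by move=> x y; rewrite /del_edge_adj adj_sym setUC. Qed.

Lemma del_edge_irr (G : sgraph) (u v : G) : irreflexive (@del_edge_adj G u v).
Proof. by move=> x; rewrite /del_edge_adj adj_irr. Qed.

Definition del_edge (G : sgraph) (u v : G) : sgraph :=
  SGraph (@del_edge_sym G u v) (@del_edge_irr G u v).

(** The vertex resulting from the contraction of [uv] is represented by [u]. *)
Definition contract_adj (G : sgraph) (u v : G) : rel {x : G | x != v} :=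
  fun x y => (x != y) &&
    [|| adj (val x) (val y),
        (val x == u) && adj v (val y) |
        (val y == u) && adj (val x) v].

Lemma contract_sym (G : sgraph) (u v : G) : symmetric (@contract_adj G u v).
Proof.
move=> x y; rewrite /contract_adj eq_sym (adj_sym (val x)) (adj_sym v).
by rewrite (adj_sym (val x) v) [in X in _ && (_ || X)]orbC.
Qed.

Lemma contract_irr (G : sgraph) (u v : G) : irreflexive (@contract_adj G u v).
Proof. by move=> x; rewrite /contract_adj eqxx. Qed.

Definition contract (G : sgraph) (u v : G) : sgraph :=
  SGraph (@contract_sym G u v) (@contract_irr G u v).

Inductive obtainable (G : sgraph) : sgraph -> Prop :=
| obtainable_refl : obtainable G G
| obtainable_del_vertex (K : sgraph) (v : K) :
    obtainable G K -> obtainable G (del_vertex v)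
| obtainable_del_edge (K : sgraph) (u v : K) :
    adj u v -> obtainable G K -> obtainable G (del_edge u v)
| obtainable_contract (K : sgraph) (u v : K) :
    adj u v -> obtainable G K -> obtainable G (contract u v).

Definition minor_free (H G : sgraph) : Prop :=
  ~ exists2 K, obtainable G K & isomorphic K H.

(** * Cops and robbers *)

Definition step (G : sgraph) (x y : G) : bool := (x == y) || adj x y.

(** [r t] is the position of the robber after her [t]-th move, [r 0] being her
    initial placement. *)
Definition robber_play (G : sgraph) (r : nat -> G) : Prop :=
  forall t, step (r t) (r t.+1).

(** A strategy for [m] cops sends the list of the robber's positions so far to
    the positions of the cops after their reply; in particular [s [::]] is
    their initial placement, chosen before the robber's.  Along a play [r], the
    cops are at [s (mkseq r t)] when the robber reaches [r t], and then move to
    [s (mkseq r t.+1)].  Plays are continued after a capture, which affects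
    neither side as all pieces may stay put. *)
Definition winning_strategy (G : sgraph) m (s : seq G -> 'I_m -> G) : Prop :=
  forall r : nat -> G, robber_play r ->
    (forall t i, step (s (mkseq r t) i) (s (mkseq r t.+1) i)) /\
    (exists t i, s (mkseq r t) i = r t \/ s (mkseq r t.+1) i = r t).

Definition cops_win (G : sgraph) (m : nat) : Prop :=
  exists s : seq G -> 'I_m -> G, winning_strategy s.

Lemma cops_win_card (G : sgraph) : exists m, `[< cops_win G m >].
Proof.
exists #|G|; apply/asboolP; exists (fun _ => enum_val) => r _; split.
  by move=> t i; rewrite /step eqxx.
by exists 0, (enum_rank (r 0)); left; rewrite enum_rankK.
Qed.

Definition cop_number (G : sgraph) : nat := ex_minn (cops_win_card G).

(** * Paths and rooted cycles *)

(** A path with at least one edge, or a rooted cycle, is encoded by the set of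
    its edges (as unordered pairs) and the set of its end vertices, so that a
    path and its reversal are the same object. *)
Definition segment (G : sgraph) : finType := ({set {set G}} * {set G})%type.

Definition edges (G : sgraph) (P : segment G) : {set {set G}} := P.1.
Definition ends (G : sgraph) (P : segment G) : {set G} := P.2.
Definition vertices (G : sgraph) (P : segment G) : {set G} := cover (edges P).
Definition interior (G : sgraph) (P : segment G) : {set G} := vertices P :\: ends P.

Definition walk_edges (G : sgraph) (x : G) (p : seq G) : {set {set G}} :=
  [set:: pairmap (fun y z => [set y; z]) x p].

Definition is_path (G : sgraph) (P : segment G) : Prop :=
  exists x p, [/\ path (@adj G) x p, uniq (x :: p), 0 < size p,
    edges P = walk_edges x p & ends P = [set x; last x p]].

Definition is_rooted_cycle (G : sgraph) (P : segment G) : Prop :=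
  exists x p, [/\ cycle (@adj G) (x :: p), uniq (x :: p), 3 <= size (x :: p),
    edges P = walk_edges x (rcons p x) & ends P = [set x]].

Definition internally_disjoint (G : sgraph) (PP : {set segment G}) : Prop :=
  {in PP &, forall P Q, P != Q -> [disjoint interior P & vertices Q]}.

Definition vertex_disjoint (G : sgraph) (PP : {set segment G}) : Prop :=
  {in PP &, forall P Q, P != Q -> [disjoint vertices P & vertices Q]}.

(** * Decompositions *)

(** [dec_f] is only meaningful on [dec_W]. *)
Record decomposition (H : sgraph) := Decomposition {
  dec_h : H;
  dec_W : {set del_vertex dec_h};
  dec_P : {set segment (del_vertex dec_h)};
  dec_M : {set segment (del_vertex dec_h)};
  dec_f : del_vertex dec_h -> segment (del_vertex dec_h);
  dec_no_isolated : forall x : del_vertex dec_h, exists y, adj x y;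
  dec_W_neq0 : dec_W != set0;
  dec_P_segment : {in dec_P, forall P, is_path P \/ is_rooted_cycle P};
  dec_P_disjoint : internally_disjoint dec_P;
  dec_P_ends : {in dec_P, forall P, ends P \subset dec_W};
  dec_P_cover : forall x y : del_vertex dec_h, adj x y ->
    exists2 P, P \in dec_P & [set x; y] \in edges P;
  dec_M_sub : dec_M \subset dec_P;
  dec_M_path : {in dec_M, forall P, is_path P /\ #|edges P| = 1};
  dec_M_matching : vertex_disjoint dec_M;
  dec_f_in : {in dec_W, forall u, dec_f u \in dec_P :\: dec_M};
  dec_f_end : {in dec_W, forall u, u \in ends (dec_f u)} }.

Definition dec_fiber (H : sgraph) (D : decomposition H)
    (P : segment (del_vertex (dec_h D))) :
    {set del_vertex (dec_h D)} :=
  [set w in dec_W D | dec_f w == P].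

Definition ell (H : sgraph) (D : decomposition H)
    (P : segment (del_vertex (dec_h D))) : nat :=
  if P \in dec_M D then 0 else maxn (#|edges P| - 1 + #|dec_fiber P|) 1.

Definition ell_indicator (H : sgraph) (D : decomposition H) : bool :=
  [exists P in dec_P D, ell P \notin [:: 0; 1; 2; 4]].

Definition ceil_div (m d : nat) : nat := (m + d.-1) %/ d.

(* Main.v *)
Require Import Defs.
From mathcomp Require Import all_boot.
From mathcomp Require Import boolp zify.

(** The robber is confined to a connected territory [R] whose boundary is guarded
    by the cops, while a partial model of [H] is kept outside [R], in which [R]
    stands for [h]. Each [w] in [W] has a connected core and each path or cycle
    [P] outside [M] has a chain of vertices joining the cores of its ends; each
    boundary vertex either is the unique contact of a core [w], and is then
    guarded by the cops of [f w], or lies on the chain of some [P], and is then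
    guarded by the cops of [P]. Each [P] owns [ceil (l_P / 3)] cops, each
    of which follows the shadow of the robber on a path which is geodesic through
    the territory.

    As long as some [P] guards fewer than [l_P] boundary vertices, one of its cops
    takes over a new geodesic through [R], so that the territory shrinks: if all
    cops of [P] were in charge of at least three vertices, then [P] would have
    [l_P] of them. The geodesic is inserted into the chain of [P] between two
    consecutive contacts. A cop in charge of a single vertex walks to this vertex
    and then catches up with the shadow along the new geodesic, which starts
    there, without ever leaving the vertex unprotected; only a cop in charge of
    two vertices has to be replaced by a spare one, and this never happens if
    [l_P] is 1, 2 or 4. A core which has lost its contacts grows along one of its
    chains, or is dropped and started anew in [R], next to the core of its partner
    in the matching [M]; this is why [M] needs no cop.

    If no such move is possible, then each chain can be cut into sufficiently many
    pieces with a neighbour in [R], and [H] is a minor of [G]. *)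

(** Why three: a shadow on a geodesic between two consecutive contacts protects both ends as well as
    the new vertices, so a cop in charge of at most two consecutive contacts still has them after
    being moved to a geodesic; a third one would be lost. The costly case of two occurs only if each
    of the [ceil (l_P / 3)] cops of [P] has at least two contacts while [P] has fewer than [l_P], so
    that [2 * ceil (l_P / 3) < l_P]. This fails exactly for 0, 1, 2 and 4, hence the indicator. One
    spare cop serves all segments, as the replaced cop becomes the spare. Origin of [l_P]: in the
    final model each of the [|E(P)| - 1] interior vertices of [P] needs a piece of chain with its
    own contact, and each [w] with [f w = P] needs its anchor. The maximum with 1 provides a cop to
    lay the chain of a single edge that pays for no anchor. Obstacle: when the territory shrinks, a
    core may lose its only contact, and repairing this need not gain territory. Termination is
    therefore lexicographic: first the size of [R], then the total length of the chains plus the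
    number of living cores. *)

Set Implicit Arguments.
Unset Strict Implicit.
Unset Printing Implicit Defensive.

(** * Models and minors *)

(** Connectedness stated by cuts rather than by paths, as this transfers directly
    along deletions, contractions and unions. *)
Definition cut_connected (G : sgraph) (S : pred G) : Prop :=
  forall (X : pred G) x y, S x -> S y -> X x -> ~~ X y ->
  exists x' y', [/\ S x', S y', X x', ~~ X y' & adj x' y'].

(** Labelling vertices by branch sets makes the branch sets disjoint for free. *)
Definition model (H G : sgraph) (phi : G -> option H) : Prop :=
  [/\ forall h, exists x, phi x = Some h,
      forall h, cut_connected (fun x => phi x == Some h) &
      forall h h', adj h h' ->
        exists x y, [/\ phi x = Some h, phi y = Some h' & adj x y]].

Lemma model_del_vertex (H G : sgraph) (phi : G -> option H) (v : G) :
  model phi -> phi v = None -> model (fun x : del_vertex v => phi (val x)).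
Proof.
move=> [ph1 ph2 ph3] pv.
have nv x h : phi x = Some h -> x != v.
  by move=> px; apply/eqP => xv; rewrite xv pv in px.
split.
- move=> h; have [x px] := ph1 h; by exists (Sub x (nv _ _ px)); rewrite SubK.
- move=> h X x y Sx Sy Xx Xy.
  pose X' z := if insub z is Some u then X u else false.
  have XE (z : del_vertex v) : X' (val z) = X z by rewrite /X' valK.
  have [||x' [y' [Sx' Sy' Xx' Xy' e]]] := ph2 h X' (val x) (val y) Sx Sy.
  - by rewrite XE.
  - by rewrite XE.
  exists (Sub x' (nv _ _ (eqP Sx'))), (Sub y' (nv _ _ (eqP Sy'))).
  by split; rewrite ?SubK // -XE ?SubK // /adj /= /del_vertex_adj !SubK.
- move=> h h' hh; have [x [y [px py e]]] := ph3 _ _ hh.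
  exists (Sub x (nv _ _ px)), (Sub y (nv _ _ py)).
  by rewrite !SubK; split => //; rewrite /adj /= /del_vertex_adj !SubK.
Qed.

Lemma model_contract (H G : sgraph) (phi : G -> option H) (u v : G) :
  model phi -> adj u v -> phi u = phi v ->
  model (fun x : contract u v => phi (val x)).
Proof.
move=> [ph1 ph2 ph3] uv puv.
have nuv : u != v by apply/eqP => E; rewrite E adj_irr in uv.
(* The quotient map: the default value [u] of [insubd] is taken at [v] only. *)
pose pr (x : G) : contract u v := insubd (Sub u nuv : {x | x != v}) x.
have prv : val (pr v) = u by rewrite /pr /insubd insubN ?eqxx.
have prE x : x != v -> val (pr x) = x by move=> xv; rewrite /pr insubdK.
have phE x : phi (val (pr x)) = phi x.
  by have [->|xv] := eqVneq x v; rewrite ?prv // prE.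
have prK (x : contract u v) : pr (val x) = x.
  by apply: val_inj; rewrite prE // (valP x).
have adjE x y : adj x y -> pr x != pr y -> adj (pr x) (pr y).
  move=> e ne; rewrite /adj /= /contract_adj ne /=.
  have [xv|xv] := eqVneq x v; have [yv|yv] := eqVneq y v.
  - by rewrite xv yv adj_irr in e.
  - by rewrite xv prv (prE y) // eqxx -xv e orbT.
  - by rewrite yv prv (prE x) // eqxx -yv e !orbT.
  - by rewrite !prE // e.
split.
- by move=> h; have [x px] := ph1 h; exists (pr x); rewrite phE.
- move=> h X x y Sx Sy Xx Xy.
  have [||x' [y' [Sx' Sy' Xx' Xy' e]]] := ph2 h (fun z => X (pr z)) (val x) (val y) Sx Sy.
  - by rewrite prK.
  - by rewrite prK.
  exists (pr x'), (pr y'); rewrite !phE; split => //.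
  by apply: adjE => //; apply/eqP => E; rewrite E (negPf Xy') in Xx'.
- move=> h h' hh; have [x [y [px py e]]] := ph3 _ _ hh.
  exists (pr x), (pr y); rewrite !phE; split => //; apply: adjE => //.
  apply/eqP => E; have := phE x; rewrite E phE px py => -[E'].
  by rewrite E' adj_irr in hh.
Qed.

(** The edge joins two branch sets whose vertices are not adjacent in [H], so it serves neither
    connectedness nor a required adjacency. *)
Lemma model_del_edge (H G : sgraph) (phi : G -> option H) (u v : G) (h h' : H) :
  model phi -> phi u = Some h -> phi v = Some h' -> h != h' -> ~~ adj h h' ->
  @model H (del_edge u v) phi.
Proof.
move=> [ph1 ph2 ph3] pu pv ne nhh; split => //.
- move=> k X x y Sx Sy Xx Xy.
  have [x' [y' [Sx' Sy' Xx' Xy' e]]] := ph2 k X x y Sx Sy Xx Xy.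
  exists x', y'; split => //; rewrite /adj /= /del_edge_adj e /=.
  apply/eqP => /setP E; have := E u; have := E v; rewrite !inE !eqxx ?orbT.
  move=> /orP vE /orP uE.
  have q z : (z == x') \/ (z == y') -> phi z = Some k.
    by case=> /eqP->; apply/eqP.
  by move: ne; have := q _ uE; have := q _ vE; rewrite pu pv => -[->] [->]; rewrite eqxx.
- move=> k k' kk; have [x [y [px py e]]] := ph3 _ _ kk.
  exists x, y; split => //; rewrite /adj /= /del_edge_adj e /=.
  apply/eqP => /setP E; have := E x; have := E y; rewrite !inE !eqxx ?orbT /=.
  move=> /esym/orP yE /esym/orP xE.
  have kk0 : k != k' by apply/eqP => E'; rewrite E' adj_irr in kk.
  case: xE yE => /eqP xE [] /eqP yE; move: px py; rewrite xE yE ?pu ?pv => -[h1] [h2].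
  - by rewrite -h1 -h2 eqxx in kk0.
  - by rewrite h1 h2 kk in nhh.
  - by rewrite h1 h2 adj_sym kk in nhh.
  - by rewrite -h1 -h2 eqxx in kk0.
Qed.

(** Unlabelled vertices are deleted and edges inside a branch set contracted until all branch sets
    are singletons; surplus edges are then deleted. The outer induction bounds the vertices, the
    inner one the ordered pairs of adjacent vertices. *)
Lemma model_minor (H G : sgraph) (phi : G -> option H) :
  model phi -> exists2 K, obtainable G K & isomorphic K H.
Proof.
move=> M0.
suff main n : forall m (K : sgraph) (psi : K -> option H),
    #|K| <= n -> #|[set p : K * K | adj p.1 p.2]| <= m -> obtainable G K ->
    model psi -> exists2 K, obtainable G K & isomorphic K H.
  exact: main (leqnn _) (leqnn _) (obtainable_refl _) M0.
elim: n => [|n IHn].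
  move=> m K psi K0 _ oK [p1 _ p3]; exists K => //.
  have Ke : K -> False by move=> x; move: K0; rewrite leqn0 => /eqP/card0_eq/(_ x).
  exists (fun x => False_rect H (Ke x)); last by move=> x; case: (Ke x).
  exists (fun h => False_rect K (match p1 h with ex_intro x _ => Ke x end)).
    by move=> x; case: (Ke x).
  by move=> h; case: (p1 h) => x; case: (Ke x).
have cardS (K : sgraph) (v : K) : #|K| <= n.+1 -> #|{: {x : K | x != v}}| <= n.
  by rewrite card_sig (cardD1 v) inE /= add1n ltnS => /(leq_trans _); apply; apply: subset_leq_card; apply/subsetP => x; rewrite !inE andbT.
elim=> [|m IHm] K psi Kn Em oK M.
all: have [[v pv]|noN] := pselect (exists v, psi v = None);
  first by exact: (IHn _ (del_vertex v) _ (cardS K v Kn) (leqnn _) (obtainable_del_vertex v oK)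
                         (model_del_vertex M pv)).
all: have [[u [v [uv puv]]]|inj] := pselect (exists u v, adj u v /\ psi u = psi v);
  first by exact: (IHn _ (contract u v) _ (cardS K v Kn) (leqnn _) (obtainable_contract uv oK)
                         (model_contract M uv puv)).
all: have /choice[phi0 phi0E] : forall x, exists h, psi x = Some h
  by move=> x; case E : (psi x) => [h|]; [exists h | case: noN; exists x].
all: have [p1 p2 p3] := M.
(* If [x] and [y] shared a branch set, the cut [{x}] would exhibit an edge still to be
   contracted. *)
all: have inj0 : injective phi0 by
  (move=> x y xy; apply/eqP; apply: contraT => ne;
   have [||||x' [y' [/eqP Sx' /eqP Sy' _ _ e]]] := p2 (phi0 x) (fun z => z == x) x y;
     rewrite ?phi0E ?xy ?eqxx // 1?eq_sym //;
   by case: inj; exists x', y'; rewrite Sx' Sy').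
all: have sur0 : bijective phi0 by
  (apply: inj_card_bij => //; have /choice[g gE] := p1;
   apply: (@leq_card _ _ g); move=> a b ab; have := gE a; rewrite ab gE => -[]).
all: have adjP x y : adj (phi0 x) (phi0 y) -> adj x y by
  (move=> /p3[a [b [pa pb e]]]; move: pa pb; rewrite !phi0E => -[/inj0 <-] [/inj0 <-]).
- exists K => //; exists phi0 => // x y; apply/idP/idP; first exact: adjP.
  move=> e; move: Em; rewrite leqn0 => /eqP/cards0_eq/setP/(_ (x, y)).
  by rewrite !inE /= e.
- have [[x [y [e ne]]]|al] := pselect (exists x y, adj x y /\ ~~ adj (phi0 x) (phi0 y)).
    apply: (IHm (del_edge x y) psi) => //.
    + rewrite -ltnS; apply: leq_trans Em; apply: proper_card; apply/properP; split.
        by apply/subsetP => p; rewrite !inE /= => /andP[].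
      by exists (x, y); rewrite !inE //= /del_edge_adj eqxx andbF.
    + exact: obtainable_del_edge.
    + apply: (@model_del_edge _ _ psi x y (phi0 x) (phi0 y)) => //.
      by apply/eqP => /inj0 E; rewrite E adj_irr in e.
  exists K => //; exists phi0 => // x y; apply/idP/idP; first exact: adjP.
  by move=> e; apply: contraT => ne; case: al; exists x, y.
Qed.

(** * Shadows of the robber *)

Lemma step_refl (G : sgraph) (x : G) : step x x.
Proof. by rewrite /step eqxx. Qed.

Lemma step_sym (G : sgraph) (x y : G) : step x y = step y x.
Proof. by rewrite /step eq_sym adj_sym. Qed.

Lemma adj_step (G : sgraph) (x y : G) : adj x y -> step x y.
Proof. by rewrite /step orbC => ->. Qed.

Lemma stepP (G : sgraph) (x y : G) : step x y -> x = y \/ adj x y.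
Proof. by case/orP => [/eqP|]; [left|right]. Qed.

(** * Forcing positions and moving cops between shadows *)

Section Game.
Variables (G : sgraph) (m : nat).
Implicit Types (c : 'I_m -> G) (r : G) (R : {set G}).

(** The robber is to move, and [c'] answers her move [r']. Being inductive, [force] asserts that [S]
    or a capture occurs after finitely many rounds. *)
Inductive force (S : ('I_m -> G) -> G -> Prop) c r : Prop :=
| force_now of S c r
| force_capture i of c i = r
| force_move (c' : G -> 'I_m -> G) of
    (forall r', step r r' -> forall i, step (c i) (c' r' i)) &
    (forall r', step r r' -> force S (c' r') r').

Lemma force_bind (S T : ('I_m -> G) -> G -> Prop) c r :
  (forall c r, S c r -> force T c r) -> force S c r -> force T c r.
Proof.
move=> ST; elim=> {c r} [c r /ST //|c r i E|c r c' st _ IH].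
  exact: force_capture E.
exact: force_move st IH.
Qed.

Lemma force_turn (S : ('I_m -> G) -> G -> Prop) c r :
  (forall r', step r r' -> exists2 c', forall i, step (c i) (c' i) & force S c' r') ->
  force S c r.
Proof.
move=> h.
have /choice[c' c'P] : forall r', exists c', step r r' ->
    (forall i, step (c i) (c' i)) /\ force S c' r'.
  by move=> r'; case rr': (step r r'); [have [c' ? ?] := h _ rr'; exists c'|exists c].
by apply: (@force_move _ _ _ c') => r' /c'P[].
Qed.

Lemma cops_win_force c0 : (forall r, force (fun _ _ => False) c0 r) -> cops_win G m.
Proof.
move=> F.
have strat c r : force (fun _ _ => False) c r ->
    exists s : seq G -> 'I_m -> G, s [::] = c /\
      forall rho : nat -> G, step r (rho 0) -> robber_play rho ->
        (forall t i, step (s (mkseq rho t) i) (s (mkseq rho t.+1) i)) /\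
        ((exists i, c i = r) \/
         exists t i, s (mkseq rho t) i = rho t \/ s (mkseq rho t.+1) i = rho t).
  elim=> {c r} [//|c r i E|c r c' st _ IH].
    exists (fun _ => c); split=> // rho _ _; split; last by left; exists i.
    by move=> t j; exact: step_refl.
  have /choice[s sP] : forall r', exists s : seq G -> 'I_m -> G, step r r' ->
      s [::] = c' r' /\ forall rho : nat -> G, step r' (rho 0) -> robber_play rho ->
        (forall t i, step (s (mkseq rho t) i) (s (mkseq rho t.+1) i)) /\
        ((exists i, c' r' i = r') \/
         exists t i, s (mkseq rho t) i = rho t \/ s (mkseq rho t.+1) i = rho t).
    move=> r'; case rr': (step r r'); first by have [s ?] := IH _ rr'; exists s.
    by exists (fun _ => c).
  exists (fun h => if h is x :: h' then s x h' else c); split=> // rho r0 play.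
  have [s0 sE] := sP _ r0.
  have mkS t : mkseq rho t.+1 = rho 0 :: mkseq (fun n => rho n.+1) t.
    by rewrite /mkseq /= -[1]/(1 + 0) iotaDl -map_comp.
  have [st1 cap] := sE (fun n => rho n.+1) (play 0) (fun t => play t.+1).
  split.
    by case=> [|t] i; rewrite !mkS /= ?s0 ?st.
  right; case: cap => [[i ci]|[t [i ci]]].
    by exists 0, i; right; rewrite mkS /= s0.
  by exists t.+1, i; rewrite !mkS /=.
have /choice[s sP] := fun r => strat c0 r (F r).
(* The cops pass their first turn after the robber's placement: [s x [::]] is again [c0]. This leads
   to a position with the robber to move, as [force] expects. *)
exists (fun h => if h is x :: h' then s x h' else c0) => rho play.
have [s0 sE] := sP (rho 0).
have mkS t : mkseq rho t.+1 = rho 0 :: mkseq (fun n => rho n.+1) t.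
  by rewrite /mkseq /= -[1]/(1 + 0) iotaDl -map_comp.
have [st1 cap] := sE (fun n => rho n.+1) (play 0) (fun t => play t.+1).
split.
  by case=> [|t] i; rewrite !mkS /= ?s0 ?step_refl.
case: cap => [[i ci]|[t [i ci]]].
  by exists 0, i; left.
by exists t.+1, i; rewrite !mkS /=.
Qed.

Definition boundary R : {set G} := [set z | (z \notin R) && [exists r in R, adj r z]].

Lemma boundaryP R z :
  reflect (z \notin R /\ exists2 r, r \in R & adj r z) (z \in boundary R).
Proof.
rewrite inE; apply: (iffP andP) => -[zR].
  by move=> /exists_inP[r]; split => //; exists r.
by move=> [r rR rz]; split => //; apply/exists_inP; exists r.
Qed.

(** A cop following the shadow [phi r] of the robber [r] in the territory [R]
    captures it as soon as it moves to a protected vertex. *)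
Definition shadow R (phi : {ffun G -> G}) : Prop :=
  {in R &, forall r r', adj r r' -> step (phi r) (phi r')}.

Definition protects R (phi : {ffun G -> G}) (z : G) : Prop :=
  {in R, forall r, adj r z -> step (phi r) z}.

(** Only the existence of distinct cops on the shadows is recorded, not their names, so that another
    cop may take over a shadow. *)
Definition covered c r (gs : seq {ffun G -> G}) : Prop :=
  exists s : seq 'I_m, uniq s /\ [seq c j | j <- s] = [seq (phi : {ffun _}) r | phi <- gs].

Lemma covered_cons c r phi gs : covered c r (phi :: gs) <->
  exists j s, [/\ uniq (j :: s), c j = phi r & [seq c j | j <- s] = [seq (psi : {ffun _}) r | psi <- gs]].
Proof.
split; first by case=> -[|j s] [us] //= [? ?]; exists j, s.
by case=> j [s [us jE sE]]; exists (j :: s) => /=; rewrite jE sE.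
Qed.

Lemma covered_behead c r phi gs : covered c r (phi :: gs) -> covered c r gs.
Proof. by move/covered_cons => [j [s [/= /andP[_ us] _ sE]]]; exists s. Qed.

Lemma covered_rot c r phi gs1 gs2 :
  covered c r (gs1 ++ phi :: gs2) <-> covered c r (phi :: gs1 ++ gs2).
Proof.
split=> -[s [us sE]].
  have szs : size gs1 < size s.
    by rewrite -(size_map c) sE size_map size_cat /= addnS ltnS leq_addr.
  have [s1 [j [s2 [E s1E]]]] : exists s1 j s2, s = s1 ++ j :: s2 /\ size s1 = size gs1.
    case: s szs {us sE} => // j0 s' szs.
    exists (take (size gs1) (j0 :: s')), (nth j0 (j0 :: s') (size gs1)),
      (drop (size gs1).+1 (j0 :: s')).
    by rewrite -drop_nth // cat_take_drop size_takel // ltnW.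
  move: sE us; rewrite {}E !map_cat /= => /eqP.
  rewrite eqseq_cat ?size_map // => /andP[/eqP E1 /eqP[Ej E2]] us.
  exists (j :: s1 ++ s2); split; last by rewrite /= map_cat E1 Ej E2 map_cat.
  by rewrite -(perm_uniq (permEl (perm_catCA s1 [:: j] s2))).
case: s us sE => // j s us /= [Ej]; rewrite map_cat => E.
have E1 : [seq c j | j <- take (size gs1) s] = [seq (psi : {ffun _}) r | psi <- gs1].
  by rewrite map_take E take_size_cat // size_map.
have E2 : [seq c j | j <- drop (size gs1) s] = [seq (psi : {ffun _}) r | psi <- gs2].
  by rewrite map_drop E drop_size_cat // size_map.
exists (take (size gs1) s ++ j :: drop (size gs1) s); split.
  rewrite (perm_uniq (permEl (perm_catCA _ [:: j] _))) /=.
  by move: us; rewrite /= cat_take_drop.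
by rewrite !map_cat /= E1 E2 Ej.
Qed.

(** One cop, the runner, heads for the shadow [psi] while the others follow [gs]. [T n p r] means
    that the runner at [p] needs at most [n] more turns, and [X] holds at the boundary vertices that
    it has to protect on the way. A robber who leaves [R] meanwhile is captured at once. *)
Lemma runner_force R (gs : seq {ffun G -> G}) (psi : {ffun G -> G}) (X : G -> Prop)
    (T : nat -> G -> G -> Prop) :
  {in gs, forall phi, shadow R phi} ->
  {in boundary R, forall z, (exists2 phi, phi \in gs & protects R phi z) \/ X z} ->
  (forall n p r z, T n p r -> r \in R -> adj r z -> X z -> step p z) ->
  (forall p r, T 0 p r -> r \in R -> p = psi r) ->
  (forall n p r r', T n.+1 p r -> r \in R -> r' \in R -> step r r' ->
     exists2 p', step p p' & T n p' r') ->
  forall n c r s j, r \in R -> uniq (j :: s) ->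
    [seq c j | j <- s] = [seq (phi : {ffun _}) r | phi <- gs] -> T n (c j) r ->
    force (fun c r => r \in R /\ covered c r (psi :: gs)) c r.
Proof.
move=> gsS gsP TX T0 TS; elim=> [|n IHn] c r s j rR us sE Tj.
  apply: force_now; split => //; apply/covered_cons; exists j, s; split => //.
  exact: T0 Tj rR.
have szs : size s = size gs by rewrite -(size_map c) sE size_map.
apply: force_turn => r' rr'; case r'R : (r' \in R).
  have [p' pp' Tp'] := TS _ _ _ _ Tj rR r'R rr'.
  pose c' k := if k == j then p' else
    if k \in s then nth psi gs (index k s) r' else c k.
  exists c'.
    move=> k; rewrite /c'; have [->//|kj] := eqVneq k j.
    case ks : (k \in s); last exact: step_refl.
    have iks : index k s < size gs by rewrite -szs index_mem.
    have -> : c k = nth psi gs (index k s) r.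
      by rewrite -(nth_map psi (c j) (fun phi : {ffun _} => phi r)) // -sE (nth_map k) ?szs // nth_index.
    case/stepP: rr' => [->|]; first exact: step_refl.
    by apply: gsS => //; exact: mem_nth.
  apply: (IHn _ _ s j) => //; last by rewrite /c' eqxx.
  apply: (@eq_from_nth _ (c j)); rewrite !size_map // => a al.
  rewrite (nth_map j) // (nth_map psi) -?szs // /c' mem_nth // index_uniq //; last by case/andP: us.
  by case: eqP us => // <-; rewrite /= mem_nth.
have r'b : r' \in boundary R.
  apply/boundaryP; rewrite r'R; split => //; exists r => //.
  by case/stepP: rr' => // E; rewrite -E rR in r'R.
case/stepP: rr' => [E|rr']; first by rewrite -E rR in r'R.
suff [k kr'] : exists k, step (c k) r'.
  exists (fun i => if i == k then r' else c i).
    by move=> i; case: eqP => [->|] //; rewrite step_refl.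
  by apply: (@force_capture _ _ _ k); rewrite eqxx.
have [[phi phis pr]|Xr'] := gsP _ r'b; last by exists j; exact: TX Tj rR rr' Xr'.
have iphi : index phi gs < size s by rewrite szs index_mem.
exists (nth j s (index phi gs)).
have -> : c (nth j s (index phi gs)) = phi r.
  rewrite -(nth_map j (c j) c) // sE (nth_map psi) ?nth_index //; by rewrite -szs.
exact: pr.
Qed.

(** In [launch R s psi] a cop starting at [s] can catch up with the shadow [psi]
    while protecting [s]: the shadow runs on the walk [p] starting at [s], and
    its index is at most the distance [d] from the robber to [s]. *)
Definition launch R (s : G) (psi : {ffun G -> G}) : Prop :=
  exists (p : seq G) (d : G -> nat),
  [/\ path (@adj G) s p,
      {in R &, forall r r', adj r r' -> d r' <= (d r).+1},
      {in R, forall r, adj r s -> d r <= 1} &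
      {in R, forall r, psi r = nth s (s :: p) (minn (d r) (size p))}].

Lemma step_nth_path (s : G) (p : seq G) a b : path (@adj G) s p ->
  a <= size p -> b <= size p -> a <= b.+1 -> b <= a.+1 ->
  step (nth s (s :: p) a) (nth s (s :: p) b).
Proof.
move=> /(pathP s) sp; wlog ab : a b / a <= b.
  by move=> W ap bp ab ba; case/orP: (leq_total a b) => h; [|rewrite step_sym]; exact: W.
move=> ap bp _ ba; have [->|ne] := eqVneq a b; first exact: step_refl.
have -> : b = a.+1 by lia.
by apply: adj_step; apply: sp; lia.
Qed.

Lemma launch_shadow R s psi : launch R s psi -> shadow R psi.
Proof.
move=> [p [d [sp dL _ psiE]]] r r' rR r'R rr'; rewrite !psiE //.
have h1 := dL _ _ rR r'R rr'; have := dL _ _ r'R rR; rewrite adj_sym => /(_ rr') h2.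
by apply: step_nth_path => //; rewrite ?geq_minr //; lia.
Qed.

(** The index [a] of the runner on the walk never exceeds that of the shadow and grows by one each
    turn until they meet, after which they stay equal. A robber next to [s] has [d r <= 1], so the
    runner is then within one step of [s]. *)
Lemma launch_force R gs psi s c r :
  {in gs, forall phi, shadow R phi} ->
  {in boundary R, forall z, (exists2 phi, phi \in gs & protects R phi z) \/ z = s} ->
  launch R s psi -> r \in R -> covered c r ([ffun => s] :: gs) ->
  force (fun c r => r \in R /\ covered c r (psi :: gs)) c r.
Proof.
move=> gsS gsP [p [d [sp dL d1 psiE]]] rR /covered_cons[j [t [ut jE tE]]].
pose T n x r := exists a, [/\ a <= minn (d r) (size p), x = nth s (s :: p) a &
  (a = minn (d r) (size p)) \/ size p - a <= n].
apply: (@runner_force R gs psi (fun z => z = s) T gsS gsP _ _ _ (size p) c r t j) => //.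
- move=> n x r0 z [a [al -> _]] rR0 rz zs; rewrite zs in rz *.
  change (step (nth s (s :: p) a) (nth s (s :: p) 0)).
  by have := d1 _ rR0 rz; move=> ?; apply: step_nth_path => //; lia.
- move=> x r0 [a [al -> aE]] r0R; rewrite psiE //; congr nth.
  by case: aE => //; lia.
- move=> n x r0 r1 [a [al -> aE]] r0R r1R r01.
  have L1 : d r1 <= (d r0).+1.
    by case/stepP: r01 => [->|e]; [exact: leqnSn|exact: dL].
  have L2 : d r0 <= (d r1).+1.
    by case/stepP: r01 => [->|e]; [exact: leqnSn|apply: dL => //; rewrite adj_sym].
  pose a' := minn a.+1 (minn (d r1) (size p)).
  exists (nth s (s :: p) a').
    by apply: step_nth_path => //; rewrite /a'; lia.
  by exists a'; split => //; rewrite /a'; lia.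
- exists 0; rewrite jE ffunE; split=> //; right; lia.
Qed.

Definition steps_within (n : nat) (x y : G) : Prop :=
  exists p, [/\ path (@adj G) x p, last x p = y & size p <= n].

Lemma step_walk (phi : G -> G) R r q : {in R &, forall r r', adj r r' -> step (phi r) (phi r')} ->
  path (@adj G) r q -> {subset r :: q <= R} -> steps_within (size q) (phi r) (phi (last r q)).
Proof.
move=> sh; elim: q r => [|r' q IH] r /=; first by move=> _ _; exists [::].
move=> /andP[rr' pq] sub.
have [|p [pp pl ps]] := IH r' pq; first by move=> x xq; apply: sub; rewrite inE xq orbT.
have : step (phi r) (phi r') by apply: sh => //; apply: sub; rewrite !inE eqxx ?orbT.
case/stepP=> [->|e]; first by exists p; split => //; exact: leqW.
by exists (phi r' :: p); rewrite /= e pp pl.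
Qed.

Hypothesis G_connected : connected G.

(** If [X] holds, the cop starts on a shadow protecting [s]. The shadow of any route of the robber
    through [R] to [s] is a walk no longer than the route, so the cop is at least as close to [s] as
    she is, and walking to [s] by shortest walks keeps it so. A false [X] describes a cop with
    nothing to protect. *)
Lemma approach_force R gs s c r j t (X : Prop) :
  {in gs, forall phi, shadow R phi} ->
  {in boundary R, forall z, (exists2 phi, phi \in gs & protects R phi z) \/ (X /\ z = s)} ->
  (X -> exists2 phi, shadow R phi /\ protects R phi s & c j = phi r) ->
  r \in R -> uniq (j :: t) ->
  [seq c j | j <- t] = [seq (phi : {ffun _}) r | phi <- gs] ->
  force (fun c r => r \in R /\ covered c r ([ffun => s] :: gs)) c r.
Proof.
move=> gsS gsP XP rR ut tE.
pose T n p r := steps_within n p s /\ (X -> forall q, path (@adj G) r q ->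
   {subset r :: q <= R} -> adj (last r q) s -> steps_within (size q).+1 p s).
have [p cp ls] : exists2 p, path (@adj G) (c j) p & last (c j) p = s.
  by have /connectP[p pp ->] := G_connected.2 (c j) s; exists p.
apply: (@runner_force R gs _ (fun z => X /\ z = s) T gsS gsP _ _ _ (size p) c r t j) => //.
- move=> n x r0 z [_ Tx] r0R rz [HX zs]; rewrite zs in rz *.
  have [|p0 [px lp]] := Tx HX [::] isT _ rz; first by move=> y; rewrite inE => /eqP->.
  move=> sp; rewrite -lp; case: p0 px sp {lp} => [|y [|//]] /=; first by rewrite step_refl.
  by rewrite andbT => /adj_step.
- move=> x r0 [[p0 [px lp sp]] _] _; rewrite ffunE.
  by case: p0 px lp sp.
- move=> n x r0 r1 [Tn Tx] r0R r1R r01.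
  have exD : exists D, `[< steps_within D x s >] by exists n.+1; apply/asboolP.
  case: (ex_minnP exD) => D /asboolP[p0 [px lp sp]] Dmin.
  have [p0E|p0N] := eqVneq p0 [::].
    have xs : x = s by rewrite -lp p0E.
    exists x; first exact: step_refl.
    by split; [exists [::]|move=> _ q *; exists [::]].
  case: p0 px lp sp p0N => // y p0 /= /andP[xy py] lp sp _.
  exists y; first exact: adj_step.
  split; first by exists p0; split => //; move: sp (Dmin n.+1 (introT (asboolP _) Tn)); clear; lia.
  move=> HX q pq qR lq; exists p0; split => //.
  suff : D <= (size q).+2 by move: sp; clear; lia.
  apply: Dmin; apply/asboolP.
  case/stepP: r01 => [E|e]; last first.
    apply: (Tx HX (r1 :: q)); rewrite /= ?e //.
    by move=> z; rewrite inE => /predU1P[->//|]; exact: qR.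
  have [p1 [? ? sz]] := Tx HX q ltac:(by rewrite E) ltac:(by rewrite E) ltac:(by rewrite E).
  by exists p1; split => //; apply: leq_trans sz _.
- split; first by exists p.
  move=> HX q rq qR lq; have [phi [ps pp] ->] := XP HX.
  have [p0 [px lp sp]] := step_walk ps rq qR.
  have := pp _ (qR _ (mem_last _ _)) lq.
  case/stepP=> [E|e]; first by exists p0; rewrite -E; split => //; exact: leqW.
  by exists (rcons p0 s); rewrite rcons_path last_rcons size_rcons px lp e.
Qed.

(** With a spare cop, [phi] is followed until the newcomer has caught up with [psi]. Without one,
    the cop of [phi] moves itself, which is safe if [s] is the only boundary vertex that depends on
    it. In both cases the moving cop first goes to [s], where [launch] begins. *)
Lemma replace_shadow R gs phi psi s c r :
  {in phi :: gs, forall phi, shadow R phi} ->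
  {in boundary R, forall z, exists2 phi', phi' \in phi :: gs & protects R phi' z} ->
  size gs < m.-1 \/
    {in boundary R, forall z, (exists2 phi, phi \in gs & protects R phi z) \/
      z = s /\ protects R phi s} ->
  launch R s psi -> r \in R -> covered c r (phi :: gs) ->
  force (fun c r => r \in R /\ covered c r (psi :: gs)) c r.
Proof.
move=> gsS gsP H L rR cov.
have gsS' : {in gs, forall phi, shadow R phi}.
  by move=> g gg; apply: gsS; rewrite inE gg orbT.
case: H => [szm|gsP'].
  have [s0 [us sE]] := cov.
  have szs : size s0 = (size gs).+1 by rewrite -(size_map c) sE size_map.
  have [j js] : exists j, j \notin s0.
    apply: contrapT => /forallNP al.
    have := @uniq_leq_size _ (enum 'I_m) s0 (enum_uniq _); rewrite size_enum_ord.
    have sub : {subset enum 'I_m <= s0} by move=> j _; have /negP := al j; rewrite negbK.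
    by move=> /(_ sub) h; have {h} : m <= size s0 := h; lia.
  have gsP1 : {in boundary R, forall z,
     (exists2 phi0, phi0 \in phi :: gs & protects R phi0 z) \/ z = s}.
    by move=> z /gsP; left.
  apply: (@force_bind (fun c r => r \in R /\ covered c r ([ffun => s] :: phi :: gs))).
    move=> c1 r1 [r1R cov1].
    apply: (@force_bind (fun c r => r \in R /\ covered c r (psi :: phi :: gs))); last first.
      exact: launch_force gsP1 L r1R cov1.
    move=> c2 r2 [r2R cov2]; apply: force_now; split => //.
    apply: (@covered_behead _ _ phi).
    exact: (proj1 (covered_rot c2 r2 phi [:: psi] gs) cov2).
  apply: (@approach_force _ _ _ _ _ j s0 False) => //; last by rewrite /= js.
  by move=> z /gsP; left.
have /covered_cons[j [t [ut jE tE]]] := cov.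
apply: (@force_bind (fun c r => r \in R /\ covered c r ([ffun => s] :: gs))).
  move=> c1 r1 [r1R cov1]; apply: launch_force L r1R cov1 => //.
  by move=> z /gsP'[|[->]]; [left|right].
apply: (@approach_force _ _ _ _ _ j t (protects R phi s)) => //.
  by move=> z /gsP'[|[-> ?]]; [left|right].
by move=> ps; exists phi => //; split => //; apply: gsS; rewrite mem_head.
Qed.

End Game.

(** * Geodesics through the territory *)

Section Geodesic.
Variable G : sgraph.
Implicit Types (R : {set G}).

(** This is the distance from [s] along walks that stay in [R] after [s], which may itself be a
    boundary vertex. Outside [R] the values of [d] mean nothing. *)
Lemma territory_distance R (s : G) :
  cut_connected (mem R) -> s \in R \/ s \in boundary R ->
  exists d : G -> nat, {in R, forall r,
    (exists p, [/\ path (@adj G) s p, {subset p <= R}, last s p = r & size p = d r]) /\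
    forall p, path (@adj G) s p -> {subset p <= R} -> last s p = r -> d r <= size p}.
Proof.
move=> Rc sR.
pose reach r n := exists p, [/\ path (@adj G) s p, {subset p <= R}, last s p = r & size p = n].
have ex r : r \in R -> exists n, `[< reach r n >].
  move=> rR; apply: contrapT => /forallNP nr.
  have [r0 r0R Xr0] : exists2 r0, r0 \in R & exists n, `[< reach r0 n >].
    case: sR => [sR|/boundaryP[_ [r0 r0R e]]].
      by exists s => //; exists 0; apply/asboolP; exists [::].
    exists r0 => //; exists 1; apply/asboolP; exists [:: r0]; split => //=.
      by rewrite adj_sym e.
    by move=> x; rewrite inE => /eqP->.
  (* The cut is the set of vertices reachable from [s]; an edge leaving it would extend a walk. *)
  have [||||x [y [xR yR]]] := Rc (fun r => `[< exists n, `[< reach r n >] >]) r0 r => //.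
  - exact/asboolP.
  - by apply/asboolP => -[n]; exact: nr.
  move=> /asboolP[n /asboolP[p [sp pR lp _]]] /asboolP ny e; apply: ny.
  exists (size p).+1; apply/asboolP; exists (rcons p y).
  rewrite rcons_path sp lp e last_rcons size_rcons; split => // z.
  by rewrite mem_rcons inE => /predU1P[->|/pR].
have /choice[d dP] : forall r, exists n, r \in R ->
   (reach r n) /\ forall k, reach r k -> n <= k.
  move=> r; case rR : (r \in R); last by exists 0.
  have [n /asboolP nr nmin] := ex_minnP (ex r rR).
  by exists n => _; split => // k kr; apply: nmin; apply/asboolP.
exists d => r /dP[rd rmin]; split => // p sp pR lp.
by apply: rmin; exists p.
Qed.

(** The walk goes to a point of [L] nearest to [s], whence the last clause. When [L] consists of the
    neighbours in [R] of a boundary vertex, that clause is what will protect this vertex. *)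
Lemma territory_geodesic R (s : G) (L : {set G}) :
  cut_connected (mem R) -> s \in R \/ s \in boundary R -> L \subset R -> L != set0 ->
  exists (q : seq G) (d : G -> nat),
  [/\ [/\ path (@adj G) s q, {subset q <= R}, uniq (s :: q) & last s q \in L],
      {in R &, forall r r', adj r r' -> d r' <= (d r).+1},
      {in R, forall r, adj r s -> d r <= 1},
      forall a, a <= size q -> nth s (s :: q) a \in R -> d (nth s (s :: q) a) = a &
      {in L, forall l, size q <= d l}].
Proof.
move=> Rc sR LR /set0Pn[l0 l0L].
have [d dP] := territory_distance Rc sR.
have subR p z : {subset p <= R} -> z \in R -> {subset rcons p z <= R}.
  by move=> pR zR x; rewrite mem_rcons inE => /predU1P[->|/pR].
have [l lL lmin] := arg_minnP d l0L.
have lR := subsetP LR _ lL.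
have [[q [sq qR lq szq]] qmin] := dP _ lR.
have dL : {in R &, forall r r', adj r r' -> d r' <= (d r).+1}.
  move=> r r' rR r'R e; have [[p [sp pR lp <-]] _] := dP _ rR.
  have := (dP _ r'R).2 (rcons p r'); rewrite rcons_path sp lp e last_rcons size_rcons.
  by apply => //; exact: subR.
have dq a : a <= size q -> nth s (s :: q) a \in R -> d (nth s (s :: q) a) = a.
  move=> aq aR; apply/eqP; rewrite eqn_leq.
  have tE : last s (take a q) = nth s (s :: q) a.
    by case: a aq {aR} => [|a] aq; rewrite ?take0 // (last_nth s) size_takel //= nth_take.
  have tp : path (@adj G) s (take a q) by move: sq; rewrite -{1}(cat_take_drop a q) cat_path => /andP[].
  have dp : path (@adj G) (nth s (s :: q) a) (drop a q).
    by move: sq; rewrite -{1}(cat_take_drop a q) cat_path tE => /andP[].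
  apply/andP; split.
    have := (dP _ aR).2 _ tp; rewrite size_takel //; apply => //.
    by move=> x /mem_take; exact: qR.
  have [[p [sp pR lp szp]] _] := dP _ aR.
  (* A shortcut to a vertex of [q] would give a shortcut to [l]. *)
  have : d l <= size (p ++ drop a q).
    apply: (dP _ lR).2; first by rewrite cat_path sp lp.
      by move=> x; rewrite mem_cat => /orP[/pR|/mem_drop/qR].
    by rewrite last_cat lp -tE -last_cat cat_take_drop.
  by move: aq; rewrite size_cat size_drop szp -szq; clear; lia.
exists q, d; split => //; first split => //.
- apply/(uniqPn s) => -[a [b [ab bq]]] /=; move: bq => /=; rewrite ltnS => bq E.
  have bR : nth s (s :: q) b \in R.
    by case: b ab bq {E} => // b _ bq; apply: qR; exact: mem_nth.
  have db := dq b bq bR; have da : d (nth s (s :: q) a) = a by apply: dq; [move: ab bq; clear; lia|rewrite E].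
  by move: ab; rewrite -da E db ltnn.
- by rewrite lq.
- move=> r rR e; apply: ((dP _ rR).2 [:: r]) => //=; first by rewrite adj_sym e.
  by move=> x; rewrite inE => /eqP->.
- by move=> r rL; rewrite szq; exact: lmin.
Qed.

Lemma geodesic_shadow R (s : G) (p : seq G) (d : G -> nat) :
  path (@adj G) s p ->
  {in R &, forall r r', adj r r' -> d r' <= (d r).+1} ->
  {in R, forall r, adj r s -> d r <= 1} ->
  exists2 psi : {ffun G -> G}, launch R s psi &
    {in R, forall r, psi r = nth s (s :: p) (minn (d r) (size p))}.
Proof.
move=> sp dL d1; exists [ffun r => nth s (s :: p) (minn (d r) (size p))].
  by exists p, d; split => // r _; rewrite ffunE.
by move=> r _; rewrite ffunE.
Qed.

(** The shadow of [r] is the vertex of [q] with index [minn (d r) (size q)]. Since [d] changes by at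
    most one along an edge, a vertex of [q] adjacent to [r] has an index within one of it. *)
Lemma geodesic_guard R (s : G) (L : {set G}) :
  cut_connected (mem R) -> s \in R \/ s \in boundary R -> L \subset R -> L != set0 ->
  exists (q : seq G) (psi : {ffun G -> G}),
  [/\ [/\ path (@adj G) s q, {subset q <= R}, uniq (s :: q) & last s q \in L],
      launch R s psi, {in s :: q, forall z, protects R psi z} &
      {in R, forall r, r \in s :: q -> psi r = r}].
Proof.
move=> Rc sR LR L0.
have [q [d [[sq qR uq lq] dL d1 dq dl]]] := territory_geodesic Rc sR LR L0.
have [psi psiL psiE] := geodesic_shadow sq dL d1.
exists q, psi; split => //.
- move=> z /(nthP s)[a aq0 <-] r rR e; have {aq0} aq : a <= size q := aq0; rewrite psiE //.
  have bnd : a <= (d r).+1 /\ minn (d r) (size q) <= a.+1.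
    case: a aq e => [|a] aq e; first by move: (d1 _ rR e); clear; lia.
    have aR : nth s (s :: q) a.+1 \in R by apply: qR; exact: mem_nth.
    have := dL _ _ rR aR e; rewrite adj_sym in e; have := dL _ _ aR rR e.
    by rewrite dq //; move: aq; clear; lia.
  by apply: step_nth_path; rewrite ?geq_minr //; move: bnd aq; clear; lia.
- move=> r rR /(nthP s)[a aq0 E]; have {aq0} aq : a <= size q := aq0.
  by rewrite psiE // -{1}E dq ?E // (minn_idPl aq).
Qed.

(** The end [z] lies outside [R], where [d] is meaningless. The geodesic leads to a nearest
    neighbour of [z] in [R], so a robber adjacent to [z] has [d r >= size q] and her shadow is
    within one step of [z]. The ends [s] and [z] may coincide, as happens for rooted cycles. *)
Lemma geodesic_guard_between R (s z : G) :
  cut_connected (mem R) -> s \in boundary R -> z \in boundary R ->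
  exists (q : seq G) (psi : {ffun G -> G}),
  [/\ [/\ path (@adj G) s (rcons q z), {subset q <= R}, uniq q & q != [::]],
      launch R s psi, {in s :: rcons q z, forall z, protects R psi z} &
      {in R, forall r, r \in q -> psi r = r}].
Proof.
move=> Rc sB zB.
have [zR [r0 r0R r0z]] := boundaryP _ _ zB.
pose L := [set r in R | adj r z].
have [||q [d [[sq qR uq lq] dL d1 dq dl]]] := @territory_geodesic R s L Rc (or_intror sB).
- by apply/subsetP => r; rewrite inE => /andP[].
- by apply/set0Pn; exists r0; rewrite inE r0R.
have sp : path (@adj G) s (rcons q z).
  by rewrite rcons_path sq; move: lq; rewrite inE => /andP[].
have [psi psiL psiE] := geodesic_shadow sp dL d1.
have nthq a : a <= size q -> nth s (s :: rcons q z) a = nth s (s :: q) a.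
  by case: a => //= a aq; rewrite nth_rcons aq.
exists q, psi; split => //.
- split => //; first by case/andP: uq.
  case: q lq {sq qR uq dq dl sp nthq psiE} => //=; rewrite inE => /andP[].
  by case/boundaryP: sB => /negP.
- move=> x /(nthP s)[a aq0 <-] r rR e; have {aq0} aq : a <= (size q).+1 by move: aq0; rewrite /= size_rcons.
  rewrite psiE //.
  have bnd : a <= (d r).+1 /\ minn (d r) (size q).+1 <= a.+1.
    case: a aq e => [|a] aq e; first by move: (d1 _ rR e); clear; lia.
    have [aq'|aq'] := leqP a.+1 (size q).
      rewrite nthq // in e.
      have aR : nth s (s :: q) a.+1 \in R by apply: qR; exact: mem_nth.
      have := dL _ _ rR aR e; rewrite adj_sym in e; have := dL _ _ aR rR e.
      by rewrite dq //; move: aq'; clear; lia.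
    have aE : a = size q by move: aq aq'; clear; lia.
    move: e; rewrite aE /= nth_rcons ltnn eqxx => e.
    have := dl r; rewrite inE rR e => /(_ isT); clear; lia.
  by apply: step_nth_path; rewrite // size_rcons ?geq_minr //; move: bnd aq; clear; lia.
- move=> r rR rq; have /(nthP s)[a aq0 E] : r \in s :: q by rewrite inE rq orbT.
  have {aq0} aq : a <= size q := aq0.
  rewrite psiE // size_rcons -{1}E dq ?E // (minn_idPl _) ?nthq //; exact: leqW.
Qed.

End Geodesic.

(** * Partial models *)

Lemma cut_connected_eq (G : sgraph) (S S' : pred G) :
  S =1 S' -> cut_connected S -> cut_connected S'.
Proof.
by move=> E C X x y; rewrite -!E => Sx Sy Xx Xy; have [x' [y' h]] := C X x y Sx Sy Xx Xy;
   exists x', y'; rewrite -!E.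
Qed.

Lemma cut_connected1 (G : sgraph) (S : pred G) z :
  (forall x, S x -> x = z) -> cut_connected S.
Proof. by move=> Sz X x y /Sz-> /Sz-> ->. Qed.

Lemma cut_connected_add (G : sgraph) (S : pred G) s z :
  cut_connected S -> S s -> adj s z -> cut_connected (fun x => (x == z) || S x).
Proof.
move=> C Ss sz X x y Sx Sy Xx Xy.
have [[[x1 Sx1 Xx1] [y1 Sy1 Xy1]]|nh] :=
  pselect ((exists2 x, S x & X x) /\ (exists2 y, S y & ~~ X y)).
  have [x' [y' [Sx' Sy' Xx' Xy' e]]] := C X x1 y1 Sx1 Sy1 Xx1 Xy1.
  by exists x', y'; rewrite Sx' Sy' !orbT.
case Xs : (X s).
  case/orP: Sy => [/eqP yz|Sy]; last by case: nh; split; [exists s|exists y].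
  by exists s, z; rewrite Ss Xs sz -yz eqxx Xy orbT.
case/orP: Sx => [/eqP xz|Sx]; last by case: nh; split; [exists x|exists s; rewrite ?Xs].
by exists z, s; rewrite Ss Xs adj_sym sz -xz eqxx Xx orbT.
Qed.

Lemma path_splice (T : eqType) (e : rel T) (x y b : T) (q l : seq T) :
  path e x (rcons q (head b l)) -> path e y (rcons l b) -> path e x (q ++ rcons l b).
Proof.
case: l => [|z l] /=; first by rewrite cats1.
by rewrite rcons_path cat_path /= => /andP[-> ->] /andP[].
Qed.

Section State.
Variables (G : sgraph) (V I : finType).
Variables (W : {set V}) (J : {set I}) (mt : rel V).
Implicit Types (R : {set G}).

(** The core of [w] is the set of the vertices labelled [inl w], and [chain i]
    enumerates the vertices labelled [inr i]. *)
Record state := State {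
  label : G -> option (V + I);
  anchor : V -> G;
  chain : I -> seq G;
  linked : pred I }.
Implicit Types (sg : state).

Definition alive sg (w : V) : bool := label sg (anchor sg w) == Some (inl w).

Definition same sg (x y : G) : bool :=
  (x == y) || [exists w, (label sg x == Some (inl w)) && (label sg y == Some (inl w))].

(** A chain is attached to a core at some vertex, not necessarily the anchor. Comparing vertices up
    to moves inside a core lets anchors move and cores grow without touching the chains. *)
Definition conn sg (x y : G) : bool :=
  [exists x', [exists y', [&& same sg x x', same sg y y' & step x' y']]].

Record valid (ea eb : I -> V) R sg : Prop := Valid {
  v_territory : {in R, forall x, label sg x = None};
  v_chain : forall i x, (x \in chain sg i) = (label sg x == Some (inr i));
  v_uniq : forall i, uniq (chain sg i);
  v_core : forall w, cut_connected (fun x => label sg x == Some (inl w));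
  v_alive : forall w x, label sg x = Some (inl w) -> alive sg w /\ w \in W;
  v_anchor : forall w x, label sg x = Some (inl w) -> x \in boundary R -> x = anchor sg w;
  v_mates : forall u v, mt u v -> alive sg u -> alive sg v ->
    exists x y, [/\ label sg x = Some (inl u), label sg y = Some (inl v) & adj x y];
  v_linked : forall i, linked sg i ->
    [/\ i \in J, alive sg (ea i), alive sg (eb i) &
        path (conn sg) (anchor sg (ea i)) (rcons (chain sg i) (anchor sg (eb i)))];
  v_unlinked : forall i, ~~ linked sg i -> chain sg i = [::];
  v_boundary : {in boundary R, forall x, label sg x != None} }.

Lemma same_coreP sg x y :
  reflect (x = y \/ exists w, label sg x = Some (inl w) /\ label sg y = Some (inl w)) (same sg x y).
Proof.
apply: (iffP orP) => -[/eqP|].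
- by left.
- by move=> /existsP[w /andP[/eqP ? /eqP ?]]; right; exists w.
- by left.
- by move=> [w [-> ->]]; right; apply/existsP; exists w; rewrite eqxx.
Qed.

Lemma same_refl sg x : same sg x x.
Proof. by rewrite /same eqxx. Qed.

Lemma same_core sg w x y : label sg x = Some (inl w) -> label sg y = Some (inl w) -> same sg x y.
Proof. by move=> xw yw; apply/same_coreP; right; exists w. Qed.

Lemma same_sym sg : symmetric (same sg).
Proof. by move=> x y; apply/same_coreP/same_coreP; case=> [->|[w [? ?]]]; by [left|right; exists w]. Qed.

Lemma same_trans sg : transitive (same sg).
Proof.
move=> y x z /same_coreP[->//|[w [xw yw]]] /same_coreP[<-|[w' [yw' zw']]].
  exact: same_core xw yw.
by move: yw'; rewrite yw => -[E]; rewrite -E in zw'; exact: same_core xw zw'.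
Qed.

Lemma connP sg x y :
  reflect (exists x' y', [/\ same sg x x', same sg y y' & step x' y']) (conn sg x y).
Proof.
apply: (iffP existsP) => [[x' /existsP[y' /and3P[? ? ?]]]|[x' [y' [? ? ?]]]].
  by exists x', y'.
by exists x'; apply/existsP; exists y'; apply/and3P.
Qed.

Lemma conn_sym sg : symmetric (conn sg).
Proof. by move=> x y; apply/connP/connP => -[x' [y' [? ? ?]]]; exists y', x'; rewrite step_sym. Qed.

Lemma step_conn sg x y : step x y -> conn sg x y.
Proof. by move=> e; apply/connP; exists x, y; rewrite !same_refl. Qed.

Lemma conn_same sg x y x' y' : same sg x x' -> same sg y y' -> conn sg x y -> conn sg x' y'.
Proof.
move=> sx sy /connP[x1 [y1 [s1 s2 st]]]; apply/connP; exists x1, y1; split => //.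
  by apply: same_trans s1; rewrite same_sym.
by apply: same_trans s2; rewrite same_sym.
Qed.

Lemma path_conn_same sg x p y x' y' : same sg x x' -> same sg y y' ->
  path (conn sg) x (rcons p y) -> path (conn sg) x' (rcons p y').
Proof.
move=> sx sy; case/lastP: p => [|p z] /=.
  by rewrite !andbT; exact: conn_same.
rewrite !(rcons_path _ _ (rcons _ _)) !last_rcons => /andP[pz zy].
rewrite (conn_same (same_refl sg z) sy zy) andbT.
case: p pz => /= [|a p]; first by rewrite !andbT; apply: conn_same (same_refl _ _).
by case/andP=> xa ->; rewrite (conn_same sx (same_refl _ _) xa).
Qed.

Lemma same_mono sg sg' : (forall w x, label sg x = Some (inl w) -> label sg' x = Some (inl w)) ->
  subrel (same sg) (same sg').
Proof.
move=> M x y /same_coreP[->|[w [xw yw]]]; first exact: same_refl.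
by apply: (@same_core _ w); exact: M.
Qed.

Lemma conn_mono sg sg' : (forall w x, label sg x = Some (inl w) -> label sg' x = Some (inl w)) ->
  subrel (conn sg) (conn sg').
Proof.
move=> M x y /connP[x' [y' [sx sy st]]]; apply/connP; exists x', y'.
by split => //; apply: same_mono M _ _ _.
Qed.

(** * Moves on partial models: reversal, absorption, dropping, rerouting, seeding *)

Definition flip sg := State (label sg) (anchor sg) (fun i => rev (chain sg i)) (linked sg).

Lemma flip_valid ea eb R sg : valid ea eb R sg -> valid eb ea R (flip sg).
Proof.
case=> [h1 h2 h3 h4 h5 h6 h7 h8 h9 h10].
split => //=.
- by move=> i x; rewrite mem_rev h2.
- by move=> i; rewrite rev_uniq.
- move=> i /h8[iJ ea_al eb_al pa]; split => //.
  have := rev_path (conn sg) (anchor sg (ea i)) (rcons (chain sg i) (anchor sg (eb i))).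
  rewrite last_rcons belast_rcons rev_cons => ->.
  by rewrite (eq_path (e' := conn sg)) // => x y; exact: conn_sym.
- by move=> i /h9->.
Qed.

(** Here [l] is the rest of the chain. The anchor moves only if [x] is a contact; it is then the
    unique one, since absorption is applied when the old anchor has left the boundary. *)
Definition absorb R sg (w : V) (i : I) (x : G) (l : seq G) : state :=
  State (fun z => if z == x then Some (inl w) else label sg z)
    (fun u => if (u == w) && (x \in boundary R) then x else anchor sg u)
    (fun j => if j == i then l else chain sg j) (linked sg).


Lemma cut_absorb sg w i x l ea eb R : valid ea eb R sg -> linked sg i -> ea i = w ->
  chain sg i = x :: l ->
  cut_connected (fun z => (if z == x then Some (inl w) else label sg z) == Some (inl w)).
Proof.
case=> h1 h2 h3 h4 h5 h6 h7 h8 h9 h10 li eaw ci.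
have lx : label sg x = Some (inr i) by apply/eqP; rewrite -h2 ci mem_head.
have [iJ al _] := h8 _ li; rewrite ci eaw /= in al * => /andP[/connP[x' [y' [sx sy st]]] _].
have y'x : y' = x by case/same_coreP: sy => [//|[u []]]; rewrite lx.
have x'w : label sg x' = Some (inl w).
  case/same_coreP: sx => [<-|[u [+ ->]]]; first exact/eqP.
  by rewrite (eqP al) => -[->].
apply: (@cut_connected_eq _ (fun z => (z == x) || (label sg z == Some (inl w)))).
  by move=> z; case: (z == x); rewrite //= eqxx.
apply: (@cut_connected_add _ _ x' _ (h4 w)); first by rewrite x'w.
rewrite y'x in st; case/stepP: st => // E.
by rewrite E lx in x'w.
Qed.

Lemma absorb_head_valid ea eb R sg w i x l : valid ea eb R sg -> linked sg i -> ea i = w ->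
  chain sg i = x :: l -> anchor sg w \notin boundary R ->
  valid ea eb R (absorb R sg w i x l).
Proof.
move=> va li eaw ci aw; have cut := cut_absorb va li eaw ci.
case: va => h1 h2 h3 h4 h5 h6 h7 h8 h9 h10.
have lx : label sg x = Some (inr i) by apply/eqP; rewrite -h2 ci mem_head.
have [iJ al _ pa] := h8 _ li; rewrite eaw in al pa.
have M u z : label sg z = Some (inl u) -> label (absorb R sg w i x l) z = Some (inl u).
  by move=> zu /=; case: eqP => // zx; rewrite zx lx in zu.
have AE u : label sg (anchor sg u) = Some (inl u) -> same (absorb R sg w i x l) (anchor sg u) (anchor (absorb R sg w i x l) u).
  move=> au; apply: (@same_core _ u); first exact: M.
  rewrite {2}/absorb /=; have [->|_] /= := eqVneq u w; last exact: M.
  by case: (x \in boundary R); [rewrite eqxx|exact: (M w _ (eqP al))].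
have alE u : alive (absorb R sg w i x l) u = alive sg u.
  apply/idP/idP => [|/eqP au]; last first.
    by apply/eqP; have /same_coreP[<-|[v [E1 E2]]] := AE u au; [exact: M|rewrite E2 -E1 (M _ _ au)].
  rewrite /alive /=; have [->|uw] /= := eqVneq u w; first by rewrite (eqP al).
  by case: (anchor sg u =P x) => [_|//] /eqP[E]; rewrite E eqxx in uw.
split.
- by move=> z zR /=; rewrite h1 //; case: eqP => // zx; rewrite -zx h1 in lx.
- move=> j z /=; have := h3 i; rewrite ci /= => /andP[xl _].
  have [->|zx] := eqVneq z x; have [->|ji] := eqVneq j i.
  + by rewrite (negPf xl).
  + by rewrite h2 lx; apply/eqP => -[E]; rewrite E eqxx in ji.
  + by rewrite -h2 ci inE (negPf zx).
  + by rewrite h2.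
- by move=> j /=; case: eqP => // _; have := h3 i; rewrite ci => /andP[].
- move=> u /=; have [->|uw] := eqVneq u w; first exact: cut.
  apply: (@cut_connected_eq _ (fun z => label sg z == Some (inl u))) (h4 u) => z.
  case: (z =P x) => [->|//]; rewrite lx; apply/esym/negbTE; apply/eqP => -[E]; by rewrite E eqxx in uw.
- move=> u z /=; rewrite alE; case: (z =P x) => [_ [<-]|_ zu]; last exact: h5 zu.
  by split => //; have [] := h5 w (anchor sg w) (eqP al).
- move=> u z /=; case: (z =P x) => [->{z} [<-] xb|zx zu zb]; first by rewrite eqxx xb.
  have zE := h6 _ _ zu zb; case: eqVneq => //= uw.
  by rewrite zE uw (negPf aw) in zb.
- move=> u v uv; rewrite !alE => au av; have [y [z [yu zv e]]] := h7 _ _ uv au av.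
  by exists y, z; split => //; exact: M.
- move=> j; rewrite /= => lj; have [jJ aa ab pj] := h8 _ lj; rewrite !alE; split => //.
  case: (j =P i) => [ji|_].
    apply: (path_conn_same (same_refl _ _) (AE _ (eqP ab))).
    move: pa; rewrite -ji; have -> : chain sg j = x :: l by rewrite ji.
    rewrite /= => /andP[_ pl].
    have {}pl := sub_path (conn_mono M) pl.
    apply: path_conn_same (same_refl _ _) pl.
    rewrite ji eaw; have := AE w (eqP al); rewrite /=.
    apply: same_trans; apply: (@same_core _ w) => /=; first by rewrite eqxx.
    exact: (M w (anchor sg w) (eqP al)).
  apply: (path_conn_same (AE _ (eqP aa)) (AE _ (eqP ab))).
  exact: sub_path (conn_mono M) _ _ pj.
- by move=> j; rewrite /= => nl; case: eqP => [ji|_]; [rewrite ji li in nl|exact: h9].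
- by move=> z zb /=; case: (z =P x) => // _; exact: h10.
Qed.

(** Reversing the chains exchanges [ea] and [eb] and reduces this to absorption at the head. *)
Lemma absorb_last_valid ea eb R sg w i x l : valid ea eb R sg -> linked sg i -> eb i = w ->
  chain sg i = rcons l x -> anchor sg w \notin boundary R ->
  valid ea eb R (absorb R sg w i x l).
Proof.
move=> va li ebw ci aw.
have ci' : chain (flip sg) i = x :: rev l by rewrite /= ci rev_rcons.
have := flip_valid (absorb_head_valid (flip_valid va) (li : linked (flip sg) i) ebw ci' aw).
congr valid; rewrite /flip /absorb /=; congr State; apply/funext => j.
by case: eqP => _; rewrite revK.
Qed.


Lemma shrink_valid ea eb R R' sg : valid ea eb R sg ->
  R' \subset R -> boundary R' \subset boundary R -> valid ea eb R' sg.
Proof.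
case=> h1 h2 h3 h4 h5 h6 h7 h8 h9 h10 /subsetP RR /subsetP BB; split => //.
- by move=> x /RR; exact: h1.
- by move=> w x xw /BB; exact: h6.
- by move=> x /BB; exact: h10.
Qed.

Definition kill (ea eb : I -> V) sg (w : V) : state :=
  State (fun z => if label sg z == Some (inl w) then None else label sg z)
    (anchor sg) (chain sg) (fun i => [&& linked sg i, ea i != w & eb i != w]).

Lemma kill_alive ea eb sg w u : alive (kill ea eb sg w) u = (u != w) && alive sg u.
Proof.
rewrite /alive /=; have [->|uw] /= := eqVneq u w; first by case: ifP => // ->.
by case: (label sg (anchor sg u) =P Some (inl w)) => // ->; apply/esym/eqP => -[E]; rewrite E eqxx in uw.
Qed.

(** The vertices of the core may lose their labels, since none of them is on the boundary: only the
    anchor could be. The chains at [w] become unlinked, and [v_unlinked] then demands that they be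
    empty. *)
Lemma kill_valid ea eb R sg w : valid ea eb R sg -> anchor sg w \notin boundary R ->
  (forall i, linked sg i -> ea i = w \/ eb i = w -> chain sg i = [::]) ->
  valid ea eb R (kill ea eb sg w).
Proof.
case=> h1 h2 h3 h4 h5 h6 h7 h8 h9 h10 aw cw.
have LE z v : label (kill ea eb sg w) z = Some v -> label sg z = Some v /\ v != inl w.
  rewrite /=; case: (label sg z =P Some (inl w)) => // ne E; split => //.
  by apply/eqP => vw; rewrite -vw in ne.
have LE' z v : label sg z = Some v -> v != inl w -> label (kill ea eb sg w) z = Some v.
  by move=> /= -> vw; case: eqP => // -[E]; rewrite E eqxx in vw.
split.
- by move=> x xR /=; rewrite h1.
- by move=> i x /=; rewrite h2; case: (label sg x =P Some (inl w)) => // ->.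
- exact: h3.
- move=> u; apply: (@cut_connected_eq _ (fun x => (u != w) && (label sg x == Some (inl u)))).
    move=> x; apply/andP/eqP => [[uw /eqP]|]; first by move/LE'; apply; apply/eqP => -[E]; rewrite E eqxx in uw.
    by case/LE => -> uw; rewrite eqxx; split => //; apply: contraNneq uw => ->.
  have [uw|uw] := eqVneq u w; last exact: h4.
  by move=> X x y.
- move=> u x /LE[xu uw]; have [al uW] := h5 _ _ xu; rewrite kill_alive al andbT; split => //.
- by move=> u x /LE[xu _]; exact: h6.
- move=> u v uv; rewrite !kill_alive => /andP[uw au] /andP[vw av].
  have [x [y [xu yv e]]] := h7 _ _ uv au av; exists x, y; split => //; exact: LE'.
- move=> i /and3P[/h8[iJ aa ab pa] naw nbw]; rewrite !kill_alive naw nbw /=; split => //.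
  apply: (@sub_in_path _ (fun z => label sg z != Some (inl w)) _ _ _ _ _ _ pa).
    move=> x y xw yw /connP[x' [y' [sx sy st]]]; apply/connP; exists x', y'; split => //.
      case/same_coreP: sx => [<-|[u [xu x'u]]]; first exact: same_refl.
      have uw : inl u != inl w :> V + I by apply: contraTneq xw => <-; rewrite -topredE /= xu eqxx.
      by apply: (@same_core _ u); exact: LE'.
    case/same_coreP: sy => [<-|[u [yu y'u]]]; first exact: same_refl.
    have uw : inl u != inl w :> V + I by apply: contraTneq yw => <-; rewrite -topredE /= yu eqxx.
    by apply: (@same_core _ u); exact: LE'.
  have aw' u : alive sg u -> u != w -> label sg (anchor sg u) != Some (inl w).
    by move=> /eqP-> uw; apply: contraNneq uw => -[->].
  rewrite /= all_rcons !aw' //=; apply/allP => z; rewrite h2 => /eqP zi.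
  by rewrite zi.
- move=> i; have [li|/h9//] := boolP (linked sg i); rewrite /= li /=.
  by rewrite negb_and !negbK => /orP[] /eqP E; apply: cw => //; [left|right].
- move=> x xb /=; case: (label sg x =P Some (inl w)) => [xw|_]; last exact: h10.
  by rewrite -(h6 _ _ xw xb) xb in aw.
Qed.

Definition reroute sg (i : I) (c : seq G) : state :=
  State (fun z => if z \in c then Some (inr i) else
           if label sg z == Some (inr i) then None else label sg z)
    (anchor sg) (fun j => if j == i then c else chain sg j) (fun j => linked sg j || (j == i)).

Lemma boundary_setD R (q : seq G) x : x \in boundary (R :\: [set x in q]) -> x \in q \/ x \in boundary R.
Proof.
case/boundaryP; rewrite !inE negb_and negbK => xq [r]; rewrite !inE => /andP[_ rR] rx.
case/orP: xq => [|xR]; first by left.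
by right; rewrite xR; apply/exists_inP; exists r.
Qed.

(** The part [s] contains no boundary vertex, so it may lose its label; [q], cut out of the
    territory, replaces it. A segment that is not yet linked receives [q] as its entire chain, which
    explains the alternative on [l1] and [l2]. *)
Lemma reroute_valid ea eb R sg i l1 s l2 q : valid ea eb R sg ->
  i \in J -> alive sg (ea i) -> alive sg (eb i) -> chain sg i = l1 ++ s ++ l2 ->
  linked sg i \/ l1 = [::] /\ l2 = [::] ->
  {in s, forall x, x \notin boundary R} -> {subset q <= R} -> uniq q ->
  path (@adj G) (last (anchor sg (ea i)) l1) (rcons q (head (anchor sg (eb i)) l2)) ->
  valid ea eb (R :\: [set x in q]) (reroute sg i (l1 ++ q ++ l2)).
Proof.
case=> h1 h2 h3 h4 h5 h6 h7 h8 h9 h10 iJ aa ab ci li sb qR uq pq.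
set c := l1 ++ q ++ l2; set sg' := reroute sg i c.
have cP z : z \in c -> label sg z = None \/ label sg z = Some (inr i).
  have lz : z \in chain sg i -> label sg z = Some (inr i) by rewrite h2 => /eqP.
  rewrite !mem_cat => /or3P[zl|/qR/h1|zl]; [right|by left|right];
    by apply: lz; rewrite ci !mem_cat zl ?orbT.
have LE u z : label sg' z = Some (inl u) <-> label sg z = Some (inl u).
  rewrite /=; case: ifP => [/cP[]->//|_].
  by case: (label sg z =P Some (inr i)) => [->|].
have alE u : alive sg' u = alive sg u by apply/eqP/eqP; rewrite LE.
have M u z := proj2 (LE u z).
have S := sub_path (conn_mono M).
have nql x : x \in q -> x \notin chain sg i.
  by move=> /qR/h1 xN; rewrite h2 xN.
split.
- move=> x; rewrite inE => /andP[]; rewrite inE => xq xR /=.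
  rewrite h1 //= ; case: ifP => // xc; move: xc; rewrite /c !mem_cat (negPf xq) /=.
  have : x \notin chain sg i by rewrite h2 h1.
  by rewrite ci !mem_cat => /norP[/negPf-> /norP[_ /negPf->]].
- move=> j x /=; have [->|ji] := eqVneq j i.
    by case xc : (x \in c); rewrite ?eqxx //; case: (label sg x =P Some (inr i)) => // /eqP/negPf.
  case xc : (x \in c).
    rewrite h2; have [->|->] := cP _ xc; apply/esym; first by apply/eqP => -[E]; rewrite E eqxx in ji.
    by [].
  rewrite h2; case: (label sg x =P Some (inr i)) => // ->.
  by apply/eqP => -[E]; rewrite E eqxx in ji.
- move=> j /=; case: eqP => // _.
  have := h3 i; rewrite ci !cat_uniq => /and3P[u1 n1 /and3P[us ns u2]].
  rewrite u1 uq u2 /= andbT has_cat negb_or.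
  move: n1; rewrite has_cat negb_or => /andP[_ ->]; rewrite andbT.
  apply/andP; split; apply/hasPn => x.
    by move=> /nql; rewrite ci mem_cat => /norP[].
  move=> xl2; apply/negP => /nql; by rewrite ci !mem_cat xl2 !orbT.
- by move=> u; apply: cut_connected_eq (h4 u) => x; apply/eqP/eqP; rewrite LE.
- by move=> u x /LE/h5; rewrite alE.
- move=> u x /LE xu /boundary_setD[/qR/h1|]; first by rewrite xu.
  exact: h6.
- move=> u v uv; rewrite !alE => /h7 K1 /K1 -/(_ uv)[x [y [xu yv e]]].
  by exists x, y; split => //; apply/LE.
- move=> j /=; have [->|ji] := eqVneq j i; last first.
    by rewrite orbF => /h8[? ? ? paj]; rewrite !alE; split => //; exact: S.
  move=> _; rewrite !alE; split => //.
  have pq' : path (conn sg') (last (anchor sg (ea i)) l1) (rcons q (head (anchor sg (eb i)) l2)).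
    by apply: sub_path pq => x y e; apply: step_conn; exact: adj_step.
  have [lk1|[E1 E2]] := li; last by rewrite /c E1 E2 cats0 in pq' *.
  have [_ _ _ /S] := h8 _ lk1.
  rewrite ci /c !rcons_cat !cat_path => /and3P[-> _] /=; rewrite -cat_path -rcons_cat.
  by rewrite rcons_cat => p2; exact: path_splice pq' p2.
- move=> j /=; rewrite negb_or => /andP[nj /negPf->]; exact: h9.
- move=> x /boundary_setD[xq|xb] /=; first by rewrite /c !mem_cat xq orbT.
  case: ifP => // xc; case: (label sg x =P Some (inr i)) => [xi|_]; last exact: h10.
  have : x \in chain sg i by rewrite h2 xi.
  move: xc; rewrite ci /c !mem_cat => /negbT; rewrite !negb_or => /and3P[/negPf-> _ /negPf->].
  by rewrite /= orbF => /sb; rewrite xb.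
Qed.

Definition seed sg (w : V) (y : G) : state :=
  State (fun z => if z == y then Some (inl w) else label sg z)
    (fun u => if u == w then y else anchor sg u) (chain sg) (linked sg).

Lemma seed_alive ea eb R sg w y u : valid ea eb R sg -> y \in R ->
  alive (seed sg w y) u = (u == w) || alive sg u.
Proof.
move=> va yR; rewrite /alive /=; have [->|uw] /= := eqVneq u w; first by rewrite eqxx eqxx.
case: (anchor sg u =P y) => // ->; rewrite (v_territory va yR).
by apply/eqP => -[E]; rewrite E eqxx in uw.
Qed.

(** The new core is [{y}]. Its adjacency to the core of a living mate is secured at birth, so that
    no chain has to realise a matching edge. *)
Lemma seed_valid ea eb R sg w y : symmetric mt -> irreflexive mt ->
  valid ea eb R sg -> w \in W -> ~~ alive sg w -> y \in R ->
  (forall v, mt w v -> alive sg v -> exists2 x, label sg x = Some (inl v) & adj y x) ->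
  valid ea eb (R :\ y) (seed sg w y).
Proof.
move=> mts mti va wW nw yR mw; have alE u := seed_alive w u va yR.
case: va => h1 h2 h3 h4 h5 h6 h7 h8 h9 h10.
have yN := h1 _ yR.
have M u z : label sg z = Some (inl u) -> label (seed sg w y) z = Some (inl u).
  by move=> zu /=; case: eqP => // zy; rewrite zy yN in zu.
have wN z : label sg z != Some (inl w).
  by apply/eqP => /h5[al]; rewrite al in nw.
have BD x : x \in boundary (R :\ y) -> x = y \/ x \in boundary R.
  have -> : R :\ y = R :\: [set x in [:: y]] by apply/setP => z; rewrite !inE.
  by case/boundary_setD; rewrite ?inE => h; [left; apply/eqP|right].
split.
- by move=> z; rewrite !inE => /andP[/negPf zy zR] /=; rewrite zy h1.
- move=> i z /=; rewrite h2; case: (z =P y) => // ->; by rewrite yN.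
- exact: h3.
- move=> u /=; have [->|uw] := eqVneq u w.
    apply: (@cut_connected1 _ _ y) => z; case: (z =P y) => // _.
    by rewrite (negPf (wN z)).
  apply: cut_connected_eq (h4 u) => z; case: (z =P y) => // ->; rewrite yN.
  by apply/esym/eqP => -[E]; rewrite E eqxx in uw.
- move=> u z /=; rewrite alE; case: (z =P y) => [_ [<-]|_]; first by rewrite eqxx.
  by move=> /h5[-> ->]; rewrite orbT.
- move=> u z /=; case: (z =P y) => [-> [<-]|zy zu /BD[//|zb]]; first by rewrite eqxx.
  have -> : (u == w) = false by apply/negP => /eqP uw; have := wN z; rewrite zu uw eqxx.
  exact: h6.
- have sd v : mt w v -> v != w -> alive sg v -> exists x, label sg x = Some (inl v) /\ adj y x.
    by move=> wv vw av; have [x xv e] := mw v wv av; exists x.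
  have ly : label (seed sg w y) y = Some (inl w) by rewrite /= eqxx.
  move=> u v; rewrite !alE; have [->|uw] /= := eqVneq u w; have [->|vw] /= := eqVneq v w.
  + by rewrite mti.
  + by move=> wv _ av; have [x [xv e]] := sd v wv vw av; exists y, x; split => //; exact: M.
  + rewrite mts => wu au _; have [x [xu e]] := sd u wu uw au.
    by exists x, y; split => //; [exact: M|rewrite adj_sym].
  + move=> uv au av; have [x [z [xu zv e]]] := h7 _ _ uv au av.
    by exists x, z; split => //; exact: M.
- move=> i; rewrite !alE => /h8[iJ aa ab pai]; rewrite aa ab !orbT; split => //.
  have wa u : alive sg u -> anchor (seed sg w y) u = anchor sg u.
    by move=> au /=; case: eqP => // uw; rewrite uw (negPf nw) in au.
  by rewrite !wa //; exact: sub_path (conn_mono M) _ _ pai.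
- exact: h9.
- move=> z /BD[->|zb] /=; first by rewrite eqxx.
  by case: (z =P y) => // _; exact: h10.
Qed.

End State.

(** * The strategy of the cops *)

Lemma mem_split (T : eqType) (x : T) (s : seq T) : x \in s -> exists s1 s2, s = s1 ++ x :: s2.
Proof. by case/splitPr => s1 s2; exists s1, s2. Qed.

Lemma filter_split (T : eqType) (P : pred T) (s K1 K2 : seq T) z :
  [seq x <- s | P x] = K1 ++ z :: K2 ->
  exists s1 s2, [/\ s = s1 ++ z :: s2, [seq x <- s1 | P x] = K1 & [seq x <- s2 | P x] = K2].
Proof.
elim: s K1 => [|x s IH] K1 /=; first by case: K1.
case Px : (P x); last first.
  by move=> /IH[s1 [s2 [-> E1 E2]]]; exists (x :: s1), s2; rewrite /= Px.
case: K1 => [|y K1] /= [<- E]; first by exists [::], s.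
have [s1 [s2 [-> E1 E2]]] := IH _ E; exists (x :: s1), s2; split => //=.
by rewrite Px E1.
Qed.

(** Finds the part of a chain between two consecutive contacts, when an anchor may precede and
    another may follow the chain. The defaults [a] and [b] of [last] and [head] are these
    anchors. *)
Lemma consecutive_split (T : eqType) (P : pred T) (p Q r K1 K3 : seq T) (a b z z' : T) :
  p = [::] \/ p = [:: a] -> r = [::] \/ r = [:: b] ->
  [seq x <- p ++ Q ++ r | P x] = K1 ++ z :: z' :: K3 ->
  exists l1 s l2, [/\ Q = l1 ++ s ++ l2, last a l1 = z, head b l2 = z', [seq x <- s | P x] = [::] &
    [seq x <- p ++ l1 | P x] = rcons K1 z /\ [seq x <- l2 ++ r | P x] = z' :: K3].
Proof.
move=> pE rE /[dup] KE /filter_split[F1 [F2 [E FE1 /(@filter_split _ _ _ [::])[S [F3 [F2E SE F3E]]]]]].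
have Pz : P z by have := mem_filter P z (p ++ Q ++ r); rewrite KE mem_cat mem_head orbT => /esym/andP[].
have Pz' : P z' by have := mem_filter P z' (p ++ Q ++ r); rewrite KE mem_cat !inE eqxx !orbT => /esym/andP[].
rewrite {}F2E in E.
have [l1 [Q1 l1z f1]] : exists l1, [/\ Q ++ r = l1 ++ S ++ z' :: F3, last a l1 = z &
    [seq x <- p ++ l1 | P x] = rcons K1 z].
  case: pE E => -> /= E.
    exists (rcons F1 z); rewrite cat_rcons last_rcons; split => //.
    by rewrite filter_rcons Pz FE1.
  case: F1 E FE1 => [|y F1] /= [az E] FE1.
    by exists [::]; split => //=; rewrite -FE1 az Pz.
  exists (rcons F1 z); rewrite cat_rcons last_rcons; split => //=.
  by rewrite filter_rcons Pz -FE1 az; case: ifP.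
exists l1, S; case: rE Q1 {E KE} => ->.
  rewrite cats0 => Q1; exists (z' :: F3); split => //; split => //.
  by rewrite cats0 /= Pz' F3E.
case/lastP: F3 F3E => [|F3 y] F3E.
  rewrite !cats1 -rcons_cat => /rcons_inj[Q1 ->]; exists [::]; rewrite cats0; split => //.
  by split => //=; rewrite Pz' -F3E.
rewrite cats1 -rcons_cons -!rcons_cat => /rcons_inj[Q1 yb]; exists (z' :: F3); split => //.
by split => //; rewrite cats1 yb /= Pz' F3E.
Qed.

Section Strategy.
Variables (G : sgraph) (V I : finType).
Variables (W : {set V}) (J : {set I}) (mt : rel V) (f : V -> I) (ea eb : I -> V).
Variables (ell : I -> nat) (m : nat).
Hypothesis G_connected : connected G.
Hypothesis mt_sym : symmetric mt.
Hypothesis mt_irr : irreflexive mt.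
Hypothesis mt_uniq : forall u v v', mt u v -> mt u v' -> v = v'.
Hypothesis f_J : {in W, forall w, f w \in J}.
Hypothesis f_end : {in W, forall w, w = ea (f w) \/ w = eb (f w)}.
Hypothesis ends_W : {in J, forall i, ea i \in W /\ eb i \in W}.
Hypothesis ell_gt0 : {in J, forall i, 0 < ell i}.

Let slots i := ceil_div (ell i) 3.
Let total := \sum_(i in J) slots i.
Hypothesis total_le : total <= m.
Hypothesis spare : total < m \/ {in J, forall i, ell i \in [:: 1; 2; 4]}.

Notation state := (state G V I).
Notation valid := (@valid G V I W J mt ea eb).
Implicit Types (R : {set G}) (sg : state) (c : 'I_m -> G).

(** The anchor of [w] is in charge of [f w] only; that of a rooted cycle is listed
    once, in front. *)
Definition pre sg i : seq G :=
  if (f (ea i) == i) && alive sg (ea i) then [:: anchor sg (ea i)] else [::].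
Definition post sg i : seq G :=
  if [&& f (eb i) == i, ea i != eb i & alive sg (eb i)] then [:: anchor sg (eb i)] else [::].

Definition contacts R sg i : seq G :=
  [seq z <- pre sg i ++ chain sg i ++ post sg i | z \in boundary R].

(** A guard is a cop paid for by the segment [t.1.1], following the shadow
    [t.1.2] and in charge of the contacts in the block [t.2]. *)
Definition guard := (I * {ffun G -> G} * seq G)%type.
Implicit Types (t : guard) (T : seq guard).

Definition blocks i T : seq G := flatten [seq t.2 | t <- T & t.1.1 == i].
Definition shadows T := [seq t.1.2 | t <- T].

(** The equality of lists in [i_blocks] makes each block a run of consecutive contacts along the
    segment; this is why a guard in charge of two contacts can move to a geodesic between them. By
    [i_unlinked], two contacts of a segment are always joined by its chain. *)
Record invariant R sg T : Prop := Invariant {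
  i_valid : valid R sg;
  i_connected : cut_connected (mem R);
  i_shadow : {in T, forall t, shadow R t.1.2};
  i_protects : {in T, forall t, {in t.2, forall z, protects R t.1.2 z}};
  i_blocks : {in J, forall i, blocks i T = contacts R sg i};
  i_count : forall i, count (fun t => t.1.1 == i) T = if i \in J then slots i else 0;
  i_unlinked : {in J, forall i, ~~ linked sg i -> size (contacts R sg i) <= 1} }.

(** * Bookkeeping of guards, blocks and contacts *)

Lemma blocks_cat i T1 T2 : blocks i (T1 ++ T2) = blocks i T1 ++ blocks i T2.
Proof. by rewrite /blocks filter_cat map_cat flatten_cat. Qed.

Lemma blocks_cons i t T : blocks i (t :: T) = (if t.1.1 == i then t.2 else [::]) ++ blocks i T.
Proof. by rewrite /blocks /=; case: ifP. Qed.

Lemma mem_blocks i T z : z \in blocks i T -> exists2 t, t \in T & t.1.1 = i /\ z \in t.2.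
Proof.
case/flattenP => b /mapP[t]; rewrite mem_filter => /andP[/eqP ti tT] -> zt.
by exists t.
Qed.

Lemma size_guards T : (forall i, count (fun t => t.1.1 == i) T = if i \in J then slots i else 0) ->
  size T = total.
Proof.
move=> cT.
have -> : size T = \sum_i count (fun t => t.1.1 == i) T.
  elim: T {cT} => [|t T IH] /=; first by rewrite big1.
  rewrite IH.
  rewrite big_split /= -add1n; congr (_ + _).
  by rewrite (bigD1 t.1.1) //= eqxx big1 // => i /negPf; rewrite eq_sym => ->.
by rewrite /total [RHS]big_mkcond; apply: eq_bigr => i _; rewrite cT.
Qed.

Lemma contacts_boundary R sg z : valid R sg -> z \in boundary R ->
  exists2 i, i \in J & z \in contacts R sg i.
Proof.
move=> va zb; have := v_boundary va zb; case E : (label sg z) => [[w|i]|] // _.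
  have [al wW] := v_alive va E; have zE := v_anchor va E zb.
  exists (f w); first exact: f_J.
  rewrite mem_filter zb /= !mem_cat zE /pre /post.
  case: (f_end wW) => wE; rewrite -!wE eqxx al; first by rewrite mem_head.
  have [->|_] := eqVneq (ea (f w)) w; first by rewrite eqxx al mem_head.
  by rewrite mem_head !orbT.
have zi : z \in chain sg i by rewrite (v_chain va) E.
have li : linked sg i by apply: contraT => /(v_unlinked va) ci; rewrite ci in zi.
have [iJ _ _ _] := v_linked va li; exists i => //.
by rewrite mem_filter zb !mem_cat zi orbT.
Qed.

Lemma guarded R sg T z : invariant R sg T -> z \in boundary R ->
  exists2 t, t \in T & z \in t.2.
Proof.
move=> iv zb; have [i iJ] := contacts_boundary (i_valid iv) zb.
by rewrite -(i_blocks iv) // => /mem_blocks[t tT [_ zt]]; exists t.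
Qed.

Definition advantage R c r := exists R' sg' T',
  [/\ invariant R' sg' T', r \in R', #|R'| < #|R| & covered c r (shadows T')].

(** The indicator enters through this alternative: either [total < m] leaves a spare cop, or the
    guard answers for nothing but the launch point [s]. *)
Lemma swap_guard R sg T1 T2 i phi psi b b' s c r :
  invariant R sg (T1 ++ (i, phi, b) :: T2) ->
  total < m \/ {subset b <= [:: s]} ->
  launch R s psi -> r \in R -> covered c r (shadows (T1 ++ (i, phi, b) :: T2)) ->
  force (fun c r => r \in R /\ covered c r (shadows (T1 ++ (i, psi, b') :: T2))) c r.
Proof.
move=> iv H L rR; rewrite /shadows !map_cat /= => /covered_rot cov.
apply: (@force_bind _ _ (fun c r => r \in R /\ covered c r (psi :: (shadows T1 ++ shadows T2)))).
  by move=> c1 r1 [r1R cov1]; apply: force_now; split => //; apply/covered_rot.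
apply: (@replace_shadow _ _ G_connected _ _ phi _ s) => //.
- move=> g; rewrite inE mem_cat => gg.
  suff /mapP[t tT ->] : g \in shadows (T1 ++ (i, phi, b) :: T2) by exact: (i_shadow iv).
  by rewrite /shadows map_cat /= mem_cat inE orbCA.
- move=> z /(guarded iv)[t tT zt]; exists t.1.2; last exact: (i_protects iv).
  have := map_f (fun t : guard => t.1.2) tT.
  by rewrite map_cat /= !(inE, mem_cat) orbCA.
- case: H => [tm|bs]; [left|right].
    have := size_guards (i_count iv); rewrite !size_cat /= !size_map; lia.
  move=> z /(guarded iv)[t tT zt].
  move: (tT); rewrite mem_cat inE orbCA => /predU1P[tE|tT'].
    rewrite tE /= in zt; have /bs := zt; rewrite inE => /eqP zs; right; split => //.
    by rewrite -zs; have := i_protects iv tT; rewrite tE; apply.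
  left; exists t.1.2; last exact: (i_protects iv).
  by rewrite -map_cat; apply/mapP; exists t; rewrite ?mem_cat.
Qed.

Lemma restrict_contacts R R' sg i : boundary R' \subset boundary R ->
  contacts R' sg i = [seq z <- contacts R sg i | z \in boundary R'].
Proof.
move=> /subsetP BB; rewrite /contacts -filter_predI; apply: eq_filter => z /=.
by case zb : (z \in boundary R') => //=; rewrite BB.
Qed.

Lemma blocks_map_filter i T (P : I -> pred G) :
  blocks i [seq (t.1, [seq z <- t.2 | P t.1.1 z]) | t <- T] = [seq z <- blocks i T | P i z].
Proof.
elim: T => //= t T IH; rewrite !blocks_cons filter_cat IH /=; congr (_ ++ _).
by case: eqP => // ->.
Qed.

(** Removing a path may disconnect the territory, so the component of the robber becomes the new
    one. Its boundary is contained in that of [R0], hence blocks and contacts only have to be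
    filtered. *)
Lemma finish R R0 sg T c r :
  valid R0 sg -> R0 \proper R ->
  {in T, forall t, shadow R0 t.1.2} ->
  {in T, forall t, {in t.2, forall z, protects R0 t.1.2 z}} ->
  {in J, forall i, contacts R0 sg i = [seq z <- blocks i T | z \in boundary R0]} ->
  (forall i, count (fun t => t.1.1 == i) T = if i \in J then slots i else 0) ->
  {in J, forall i, ~~ linked sg i -> size (contacts R0 sg i) <= 1} ->
  r \in R0 -> covered c r (shadows T) -> advantage R c r.
Proof.
move=> va R0R Tsh Tpr Tbl Tct Tul rR0 cov.
pose e : rel G := fun x y => [&& adj x y, x \in R0 & y \in R0].
pose R' := [set x | connect e r x].
have R'R0 : R' \subset R0.
  apply/subsetP => x; rewrite inE => /connectP[p ep ->].
  by case/lastP: p ep => // p y; rewrite rcons_path last_rcons => /and4P[].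
have BB : boundary R' \subset boundary R0.
  apply/subsetP => z /boundaryP[zR' [x xR' xz]]; apply/boundaryP.
  have xR0 := subsetP R'R0 _ xR'; split; last by exists x.
  apply: contra zR' => zR0; rewrite !inE in xR' *; apply: (connect_trans xR').
  by apply: connect1; rewrite /e xz xR0.
exists R', sg, [seq (t.1, [seq z <- t.2 | z \in boundary R']) | t <- T]; split.
- split.
  + exact: shrink_valid BB.
  + have R'E x : mem R' x = connect e r x by rewrite -[LHS]/(x \in R') inE.
    move=> X x y; rewrite !R'E => rx ry Xx Xy.
    have es : connect_sym e by apply: sym_connect_sym => a b; rewrite /e adj_sym [(a \in _) && _]andbC.
    have /connectP[p ep E] : connect e x y by apply: (connect_trans _ ry); rewrite es.
    elim: p x rx Xx ep E => [|x' p IH] x rx Xx /=; first by move=> _ E; rewrite E Xx in Xy.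
    move=> /andP[ex ep] E; have rx' : connect e r x' by apply: connect_trans rx (connect1 ex).
    case Xx' : (X x'); first exact: IH Xx' ep E.
    by exists x, x'; split; rewrite -?[is_true _]/(is_true (mem R' _)) ?R'E ?Xx' //; case/andP: ex.
  + move=> _ /mapP[t tT ->] a b aR bR; apply: (Tsh t tT); exact: (subsetP R'R0).
  + move=> _ /mapP[t tT ->] z /=; rewrite mem_filter => /andP[_ zt] a aR.
    by apply: (Tpr t tT z zt); exact: (subsetP R'R0).
  + move=> i iJ; rewrite (blocks_map_filter i T (fun _ z => z \in boundary R')).
    rewrite (restrict_contacts _ _ BB) Tbl // -filter_predI; apply: eq_filter => z /=.
    by case zb : (z \in boundary R') => //=; rewrite (subsetP BB _ zb).
  + by move=> i; rewrite count_map -Tct; apply: eq_count.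
  + move=> i iJ li; rewrite (restrict_contacts _ _ BB); apply: leq_trans (Tul i iJ li).
    by rewrite size_filter; apply: count_size.
- by rewrite inE.
- exact: leq_ltn_trans (subset_leq_card R'R0) (proper_card R0R).
- by rewrite /shadows -map_comp.
Qed.


Lemma full_label R sg i x : valid R sg -> x \in pre sg i ++ chain sg i ++ post sg i ->
  label sg x != None.
Proof.
move=> va; rewrite !mem_cat => /or3P[|xi|]; last 1 first.
- by rewrite /post; case: ifP => // /and3P[_ _ /eqP al]; rewrite inE => /eqP->; rewrite al.
- by rewrite /pre; case: ifP => // /andP[_ /eqP al]; rewrite inE => /eqP->; rewrite al.
- by move: xi; rewrite (v_chain va) => /eqP->.
Qed.

(** A boundary vertex that is new belongs to [q], which was unlabelled; a list of labelled vertices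
    therefore gains no contact. *)
Lemma filter_setD R sg (q l : seq G) : valid R sg -> {subset q <= R} ->
  {in l, forall x, label sg x != None} ->
  [seq x <- l | x \in boundary (R :\: [set x in q])] =
  [seq x <- [seq x <- l | x \in boundary R] | x \in boundary (R :\: [set x in q])].
Proof.
move=> va qR lN; rewrite -filter_predI; apply: eq_in_filter => x xl /=.
case xb : (x \in boundary _) => //=; case: (boundary_setD xb) => // xq.
by have := lN _ xl; rewrite (v_territory va (qR _ xq)).
Qed.

(** The cop has to be launched from the contact it already guards, which may be either end, whereas
    chains are oriented. A geodesic computed from [z'] is reversed. *)
Lemma geodesic_guard_between2 R (z z' s : G) :
  cut_connected (mem R) -> z \in boundary R -> z' \in boundary R -> s = z \/ s = z' ->
  exists (q : seq G) (psi : {ffun G -> G}),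
  [/\ [/\ path (@adj G) z (rcons q z'), {subset q <= R}, uniq q & q != [::]],
      launch R s psi, {in z :: rcons q z', forall x, protects R psi x} &
      {in R, forall r, r \in q -> psi r = r}].
Proof.
move=> Rc zb zb' [->|->]; first exact: geodesic_guard_between.
have [q [psi [[pq qR uq q0] L pr cap]]] := geodesic_guard_between Rc zb' zb.
exists (rev q), psi; split => //.
- split => //.
  + have := rev_path (@adj G) z' (rcons q z).
    rewrite last_rcons belast_rcons rev_cons => ->.
    by rewrite (eq_path (e' := @adj G)) // => x y; rewrite adj_sym.
  + by move=> x; rewrite mem_rev; exact: qR.
  + by rewrite rev_uniq.
  + by rewrite -size_eq0 size_rev size_eq0.
- by move=> x; rewrite inE mem_rcons inE mem_rev orbCA => xq; apply: pr; rewrite inE mem_rcons inE.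
- by move=> x xR; rewrite mem_rev; exact: cap.
Qed.

(** * Moves that shrink the territory *)

Lemma captured_by c r T t (S : ('I_m -> G) -> G -> Prop) :
  covered c r (shadows T) -> t \in T -> t.1.2 r = r -> force S c r.
Proof.
move=> [s [us sE]] tT tr; apply: contrapT => nf.
have : t.1.2 r \in [seq c j | j <- s].
  by rewrite sE /shadows -map_comp; apply/mapP; exists t.
by move=> /mapP[j _ jE]; apply: nf; apply: (@force_capture _ _ _ _ _ j); rewrite -jE.
Qed.

Lemma proper_setD R (q : seq G) x : {subset q <= R} -> x \in q -> R :\: [set x in q] \proper R.
Proof.
move=> qR xq; apply/properP; split; first exact: subsetDl.
by exists x; [exact: qR|rewrite !inE xq].
Qed.

(** Common form of the moves that lay a geodesic between two boundary vertices. The state [sg1] may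
    differ from [sg] by an absorption made at the same time, and [kp] then removes the absorbed
    vertex from the blocks of the other segments; otherwise [kp] is [predT]. *)
Lemma op_reroute R sg T1 T2 i phi b s sg1 (kp : pred G) l1 s2 l2 (b' : seq G -> seq G) c r :
  invariant R sg (T1 ++ (i, phi, b) :: T2) ->
  total < m \/ {subset b <= [:: s]} ->
  valid R sg1 -> i \in J -> alive sg1 (ea i) -> alive sg1 (eb i) ->
  chain sg1 i = l1 ++ s2 ++ l2 -> linked sg1 i \/ l1 = [::] /\ l2 = [::] ->
  {in s2, forall x, x \notin boundary R} ->
  last (anchor sg1 (ea i)) l1 \in boundary R -> head (anchor sg1 (eb i)) l2 \in boundary R ->
  s = last (anchor sg1 (ea i)) l1 \/ s = head (anchor sg1 (eb i)) l2 ->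
  (forall q, {subset b' q <= last (anchor sg1 (ea i)) l1 :: rcons q (head (anchor sg1 (eb i)) l2)}) ->
  (forall q, blocks i T1 ++ b' q ++ blocks i T2 =
     [seq x <- pre sg1 i ++ l1 | x \in boundary R] ++ q ++
     [seq x <- l2 ++ post sg1 i | x \in boundary R]) ->
  {in J, forall j, j != i -> contacts R sg1 j = [seq x <- blocks j (T1 ++ T2) | kp x]} ->
  {in J, forall j, j != i -> ~~ linked sg1 j -> size (contacts R sg1 j) <= 1} ->
  r \in R -> covered c r (shadows (T1 ++ (i, phi, b) :: T2)) ->
  force (advantage R) c r.
Proof.
move=> iv H va iJ aa ab ci li s2b zb zb' sz b'z b'E kpE ul rR cov.
have [q [psi [[pq qR uq q0] L pr cap]]] := geodesic_guard_between2 (i_connected iv) zb zb' sz.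
apply: (force_bind _ (swap_guard (b' q) iv H L rR cov)) => {c r rR cov} c r [rR cov].
have tT : (i, psi, b' q) \in T1 ++ (i, psi, b' q) :: T2 by rewrite mem_cat mem_head orbT.
case rq : (r \in q); first by apply: (captured_by _ cov tT); exact: cap.
apply: force_now.
set R0 := R :\: [set x in q]; set sg' := reroute sg1 i (l1 ++ q ++ l2).
have va' : valid R0 sg' by apply: reroute_valid va iJ aa ab ci li s2b qR uq pq.
have R0R : R0 \subset R by exact: subsetDl.
have BI x : x \in R0 -> x \in R by exact: (subsetP R0R).
have alE u : alive sg' u = alive sg1 u.
  rewrite /alive /=; case: ifP => [xc|_]; last first.
    by case: (label sg1 (anchor sg1 u) =P Some (inr i)) => // ->.
  transitivity false => //; apply: esym; apply/negbTE/eqP => E.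
  move: xc; rewrite !mem_cat => /or3P[xl|xq|xl].
  - have : anchor sg1 u \in chain sg1 i by rewrite ci mem_cat xl.
    by rewrite (v_chain va) E.
  - by have := v_territory va (qR _ xq); rewrite E.
  - have : anchor sg1 u \in chain sg1 i by rewrite ci !mem_cat xl !orbT.
    by rewrite (v_chain va) E.
have preE j : pre sg' j = pre sg1 j by rewrite /pre alE.
have postE j : post sg' j = post sg1 j by rewrite /post alE.
have conE j : j \in J -> j != i ->
    contacts R0 sg' j = [seq x <- contacts R sg1 j | x \in boundary R0].
  move=> jJ ji; rewrite /contacts preE postE /= (negPf ji); apply: (filter_setD va qR) => x.
  exact: (full_label va).
pose g t : guard := if t.1.1 == i then t else (t.1, [seq x <- t.2 | kp x]).
have g1 t : (g t).1 = t.1 by rewrite /g; case: ifP.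
pose T' := [seq g t | t <- T1 ++ (i, psi, b' q) :: T2].
have shE : shadows T' = shadows (T1 ++ (i, psi, b' q) :: T2).
  by rewrite /shadows -map_comp; apply: eq_map => t /=; rewrite g1.
have blE j : blocks j T' = if j == i then blocks j (T1 ++ (i, psi, b' q) :: T2) else
    [seq x <- blocks j (T1 ++ T2) | kp x].
  have gE T0 : blocks j (map g T0) = if j == i then blocks j T0 else [seq x <- blocks j T0 | kp x].
    elim: T0 => [|t T0 IH] /=; first by case: ifP.
    rewrite !blocks_cons IH g1 /g; have [->|ji] := eqVneq j i; first by case: (t.1.1 == i).
    rewrite filter_cat; congr (_ ++ _); case: (t.1.1 =P j) => // ->.
    by rewrite (negPf ji).
  rewrite gE !blocks_cat !blocks_cons /= [i == j]eq_sym.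
  by case: eqP.
have old t : t \in T1 ++ T2 -> t \in T1 ++ (i, phi, b) :: T2.
  by rewrite !mem_cat inE => /orP[->|->]; rewrite ?orbT.
have memT' t' : t' \in T' -> (t' = (i, psi, b' q)) \/
    exists2 t, t \in T1 ++ T2 & t'.1 = t.1 /\ {subset t'.2 <= t.2}.
  move=> /mapP[t]; rewrite mem_cat inE orbCA => /predU1P[-> ->|tT' ->].
    by left; rewrite /g /= eqxx.
  right; exists t; first by rewrite mem_cat.
  rewrite /g; case: ifP => //= _; split => // x; by rewrite mem_filter => /andP[].
have [q1 q1q] : exists x, x \in q by case: (q) q0 => // x l _; exists x; rewrite mem_head.
apply: (@finish R R0 sg' T') => //.
- exact: proper_setD q1q.
- move=> t' /memT'[-> /=|[t tT0 [-> _]]] x y xR yR.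
    by apply: (launch_shadow L); exact: BI.
  by apply: (i_shadow iv (old _ tT0)); exact: BI.
- move=> t' /memT'[-> /=|[t tT0 [-> sub]]] z zt x xR.
    by apply: (pr _ (b'z _ _ zt)); exact: BI.
  by apply: (i_protects iv (old _ tT0) (sub _ zt)); exact: BI.
- move=> j jJ; rewrite blE; have [->|ji] := eqVneq j i; last by rewrite conE // kpE.
  rewrite !blocks_cat blocks_cons /= eqxx b'E /contacts preE postE /= eqxx.
  have -> : pre sg1 i ++ (l1 ++ q ++ l2) ++ post sg1 i = (pre sg1 i ++ l1) ++ q ++ (l2 ++ post sg1 i).
    by rewrite !catA.
  have lab x : x \in pre sg1 i ++ chain sg1 i ++ post sg1 i -> label sg1 x != None by exact: (full_label va).
  have cat3 X Y : {in X, forall x, label sg1 x != None} -> {in Y, forall x, label sg1 x != None} ->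
      [seq x <- X ++ q ++ Y | x \in boundary R0] =
      [seq x <- [seq x <- X | x \in boundary R] ++ q ++ [seq x <- Y | x \in boundary R] | x \in boundary R0].
    by move=> XN YN; rewrite !filter_cat -!(filter_setD va qR).
  by apply: cat3 => x xl; apply: lab; move: xl; rewrite ci !mem_cat => /orP[]->; rewrite ?orbT.
- move=> j; rewrite /T' count_map -(i_count iv) !count_cat /= g1; congr (_ + (_ + _)).
    by apply: eq_count => t /=; rewrite g1.
  by apply: eq_count => t /=; rewrite g1.
- move=> j jJ; rewrite /= negb_or => /andP[lj ji]; rewrite conE //.
  by apply: leq_trans (ul j jJ ji lj); rewrite size_filter count_size.
- by rewrite !inE rq.
- by rewrite shE.
Qed.


Lemma launch_const R x : launch R x [ffun => x].
Proof. by exists [::], (fun _ => 0); split => //= r _; rewrite ffunE. Qed.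

(** A guard with an empty block can leave its shadow without risk; it ends on a constant shadow at
    [x]. *)
Lemma op_fetch R sg T1 T2 i phi b' x c r :
  invariant R sg (T1 ++ (i, phi, [::]) :: T2) ->
  r \in R -> covered c r (shadows (T1 ++ (i, phi, [::]) :: T2)) ->
  force (fun c r => r \in R /\ covered c r (shadows (T1 ++ (i, [ffun => x], b') :: T2))) c r.
Proof. by move=> iv; apply: swap_guard iv _ (launch_const R x); right. Qed.

Lemma pre_cases sg i : pre sg i = [::] \/ pre sg i = [:: anchor sg (ea i)].
Proof. by rewrite /pre; case: ifP; [right|left]. Qed.

Lemma post_cases sg i : post sg i = [::] \/ post sg i = [:: anchor sg (eb i)].
Proof. by rewrite /post; case: ifP; [right|left]. Qed.

Lemma tag_guard R sg T i : invariant R sg T -> i \in J -> exists2 t, t \in T & t.1.1 = i.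
Proof.
move=> iv iJ; have : has (fun t => t.1.1 == i) T.
  rewrite has_count (i_count iv) iJ /slots /ceil_div; have := ell_gt0 iJ; lia.
by case/hasP => t tT /eqP; exists t.
Qed.

Lemma contacts_rest R sg T j : invariant R sg T -> j \in J ->
  contacts R sg j = [seq x <- blocks j T | predT x].
Proof. by move=> iv jJ; rewrite filter_predT (i_blocks iv). Qed.

Lemma blocks_drop j T1 T2 i phi b : j != i -> blocks j (T1 ++ (i, phi, b) :: T2) = blocks j (T1 ++ T2).
Proof. by move=> /negPf ji; rewrite !blocks_cat blocks_cons /= eq_sym ji. Qed.

(** Two contacts force the segment to be linked by [i_unlinked], and the contact-free part of the
    chain between [z] and [z'] gives way to the geodesic. *)
Lemma op_gap R sg T1 T2 i phi b K1 z z' K3 s (b' : seq G -> seq G) c r :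
  invariant R sg (T1 ++ (i, phi, b) :: T2) -> i \in J ->
  total < m \/ {subset b <= [:: s]} ->
  contacts R sg i = K1 ++ z :: z' :: K3 -> s = z \/ s = z' ->
  (forall q, {subset b' q <= z :: rcons q z'}) ->
  (forall q, blocks i T1 ++ b' q ++ blocks i T2 = K1 ++ z :: q ++ z' :: K3) ->
  r \in R -> covered c r (shadows (T1 ++ (i, phi, b) :: T2)) ->
  force (advantage R) c r.
Proof.
move=> iv iJ H K sz b'z b'E rR cov.
have li : linked sg i.
  apply: contraT => nl; have := i_unlinked iv iJ nl.
  by rewrite K size_cat /= addnC.
have [_ aa ab _] := v_linked (i_valid iv) li.
have [l1 [s2 [l2 [ci l1z l2z s2E [f1 f2]]]]] :=
  consecutive_split (pre_cases sg i) (post_cases sg i) K.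
have bz x : x \in contacts R sg i -> x \in boundary R by rewrite mem_filter => /andP[].
apply: (@op_reroute R sg T1 T2 i phi b s sg predT l1 s2 l2 b') => //.
- exact: i_valid iv.
- by left.
- by move=> x xs; apply/negP => xb; have : x \in [::] by rewrite -s2E mem_filter xb.
- by rewrite l1z bz // K mem_cat mem_head orbT.
- by rewrite l2z bz // K mem_cat !inE eqxx !orbT.
- by rewrite l1z l2z.
- by rewrite l1z l2z.
- by move=> q; rewrite b'E f1 f2 cat_rcons.
- by move=> j jJ ji; rewrite (contacts_rest iv jJ) blocks_drop.
- by move=> j jJ _; apply: (i_unlinked iv jJ).
Qed.

Lemma blocks_pop i T z K : blocks i T = z :: K ->
  exists T1 phi b T2, T = T1 ++ (i, phi, z :: b) :: T2 /\ blocks i T1 = [::].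
Proof.
elim: T => //= -[[j phi] b] T IH; rewrite blocks_cons /=.
have [->|ji] := eqVneq j i; last first.
  by move=> /IH[T1 [phi' [b' [T2 [-> E]]]]]; exists ((j, phi, b) :: T1), phi', b', T2;
     split => //; rewrite blocks_cons /= (negPf ji).
case: b => [|y b] /=.
  by move=> /IH[T1 [phi' [b' [T2 [-> E]]]]]; exists ((i, phi, [::]) :: T1), phi', b', T2;
     split => //; rewrite blocks_cons /= E if_same.
by case=> -> _; exists [::], phi, b, T.
Qed.

Lemma size_blocks_ge n i T : {in T, forall t, t.1.1 = i -> n <= size t.2} ->
  n * count (fun t => t.1.1 == i) T <= size (blocks i T).
Proof.
elim: T => [|t T IH] h /=; first by rewrite muln0.
rewrite blocks_cons size_cat mulnDr leq_add //; last first.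
  by apply: IH => t' t'T; apply: h; rewrite inE t'T orbT.
case: eqP => [ti|_]; last by rewrite muln0.
by rewrite muln1; apply: h; rewrite ?mem_head.
Qed.

(** The cases are the possible block sizes: a guard with one contact, with none, with two. If all
    guards of [i] had at least three, there would be [3 * slots i >= ell i] contacts. *)
Lemma op_insert R sg T i c r : invariant R sg T -> i \in J ->
  2 <= size (contacts R sg i) < ell i ->
  r \in R -> covered c r (shadows T) -> force (advantage R) c r.
Proof.
move=> iv iJ /andP[K2 Kl] rR cov.
have K0 := i_blocks iv iJ.
(* The geodesic joins [x] to the next contact, or to the previous one if [x] is the last; it is
   launched from [x], the whole block of the guard. *)
have single T1 T2 phi x c0 r0 : invariant R sg (T1 ++ (i, phi, [:: x]) :: T2) -> r0 \in R ->
    covered c0 r0 (shadows (T1 ++ (i, phi, [:: x]) :: T2)) -> force (advantage R) c0 r0.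
  move=> iv1 r0R cov1.
  have KE : contacts R sg i = blocks i T1 ++ x :: blocks i T2.
    by rewrite -(i_blocks iv1 iJ) blocks_cat blocks_cons /= eqxx.
  case B2 : (blocks i T2) => [|z' B2']; last first.
    rewrite B2 in KE.
    apply: (op_gap (s := x) (b' := fun q => x :: q) iv1 iJ _ KE) => //; first by right.
    + by left.
    + by move=> q y; rewrite !inE mem_rcons inE => /orP[]->; rewrite ?orbT.
    + by move=> q; rewrite B2.
  case/lastP B1 : (blocks i T1) => [|B1' z]; first by rewrite KE B1 B2 in K2.
  rewrite B1 B2 cat_rcons in KE.
  apply: (op_gap (s := x) (b' := fun q => rcons q x) iv1 iJ _ KE) => //; first by right.
  + by right.
  + by move=> q y; rewrite inE => ->; rewrite orbT.
  + by move=> q; rewrite B1 B2 cats0 cat_rcons cats1.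
have [[t tT [ti t1]]|nsingle] := pselect (exists2 t, t \in T & t.1.1 = i /\ size t.2 = 1).
  case: t ti t1 tT => -[j phi] [|x [|//]] //= -> _ /mem_split[T1 [T2 TE]].
  by rewrite TE in iv cov; exact: single iv rR cov.
have [[t tT [ti t0]]|nempty] := pselect (exists2 t, t \in T & t.1.1 = i /\ t.2 = [::]).
  case: t ti t0 tT => -[i0 phi] b /= -> -> /mem_split[T1 [T2 TE]].
  rewrite TE in iv cov K0.
  case KE : (contacts R sg i) K2 => [//|z K'] _.
  have rest : blocks i (T1 ++ T2) = z :: K'.
    by rewrite -KE -K0 !blocks_cat blocks_cons /= eqxx.
  have [U1 [phi1 [b1 [U2 [UE U1E]]]]] := blocks_pop rest.
  (* The idle guard takes the first contact [z] from its owner, which reduces this case to a block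
     of size one. *)
  apply: (force_bind _ (op_fetch [:: z] z iv rR cov)) => {c r rR cov} c r [rR cov].
  have iv1 : invariant R sg ([::] ++ (i, [ffun => z], [:: z]) :: U1 ++ (i, phi1, b1) :: U2).
    have old t : t \in T1 ++ T2 -> t \in T1 ++ (i, phi, [::]) :: T2.
      by rewrite !mem_cat inE => /orP[]->; rewrite ?orbT.
    have o1 : (i, phi1, z :: b1) \in T1 ++ T2 by rewrite UE mem_cat mem_head orbT.
    have mem1 t : t \in (i, [ffun => z], [:: z]) :: U1 ++ (i, phi1, b1) :: U2 ->
        t = (i, [ffun => z], [:: z]) \/ exists2 t', t' \in T1 ++ T2 &
          t.1 = t'.1 /\ {subset t.2 <= t'.2}.
      rewrite inE mem_cat inE => /predU1P[->|]; first by left.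
      rewrite orbCA => /predU1P[->|tU]; right.
        by exists (i, phi1, z :: b1) => //; split => //= y yb; rewrite inE yb orbT.
      by exists t; last split => //; rewrite UE mem_cat inE; case/orP: tU => ->; rewrite ?orbT.
    case: (iv) => h1 h2 h3 h4 h5 h6 h7; split => //.
    + by move=> t /mem1[->|[t' /old t'T [-> _]]]; [move=> u v _ _ _; rewrite /= !ffunE step_refl|exact: h3].
    + move=> t /mem1[->|[t' /old t'T [-> sub]]] y /=; last by move=> /sub; exact: h4.
      by rewrite inE => /eqP-> a _ _; rewrite /= ffunE step_refl.
    + move=> j jJ; rewrite -(h5 j jJ) blocks_cons /=.
      have [<-|ji] := eqVneq i j; last first.
        rewrite eq_sym in ji; rewrite [RHS]blocks_drop // UE; have -> : [::] ++ blocks j (U1 ++ (i, phi1, b1) :: U2) = blocks j (U1 ++ (i, phi1, b1) :: U2) by [].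
        by rewrite !blocks_drop.
      by rewrite K0 KE -rest UE !blocks_cat !blocks_cons /= eqxx U1E.
    + move=> j; have := congr1 (count (fun t => t.1.1 == j)) UE.
      by rewrite -h6 !count_cat /= !count_cat /=; lia.
  apply: single iv1 rR _.
  have shE : shadows (U1 ++ (i, phi1, b1) :: U2) = shadows (T1 ++ T2).
    by rewrite UE /shadows !map_cat.
  rewrite /shadows /= -/(shadows _) shE /shadows map_cat; apply/covered_rot.
  by move: cov; rewrite /shadows map_cat.
have all2 : {in T, forall t, t.1.1 = i -> 2 <= size t.2}.
  move=> t tT ti; case E : t.2 => [|x [|//]]; first by case: nempty; exists t.
  by case: nsingle; exists t; rewrite ?E.
have := size_blocks_ge all2; rewrite (i_count iv) iJ K0 => K2c.
have [[t tT [ti t2]]|ntwo] := pselect (exists2 t, t \in T & t.1.1 = i /\ size t.2 = 2).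
  case: t ti t2 tT => -[j phi] [|z [|z' [|//]]] //= -> _ /mem_split[T1 [T2 TE]].
  rewrite TE in iv cov K0; move: K0; rewrite blocks_cat blocks_cons /= eqxx => /esym KE.
  apply: (op_gap (s := z) (b' := fun q => z :: rcons q z') iv iJ _ KE) => //.
  (* Without a spare cop, [2 * slots i <= size (contacts R sg i) < ell i] would hold with [ell i]
     equal to 1, 2 or 4, where [slots i] is 1, 1 and 2. *)
  + left; case: spare => // /(_ i iJ) l124; move: K2c Kl l124; rewrite /slots /ceil_div !inE.
    by move=> K2c Kl /or3P[] /eqP lE; move: K2c Kl; rewrite lE /=; lia.
  + by left.
  + by move=> q y.
  + by move=> q /=; rewrite cat_rcons.
have all3 : {in T, forall t, t.1.1 = i -> 3 <= size t.2}.
  move=> t tT ti; have := all2 t tT ti; rewrite leq_eqVlt => /predU1P[E|//].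
  by case: ntwo; exists t.
have := size_blocks_ge all3; rewrite (i_count iv) iJ K0 /slots /ceil_div; lia.
Qed.


(** The anchors may be paid for by other segments, so they need not be contacts of [i]. The geodesic
    joins the two anchors, launched from the contact if this is one of them; if the contact lies on
    the chain, only the part after it is replaced. *)
Lemma op_connect R sg T i c r : invariant R sg T -> i \in J ->
  alive sg (ea i) -> alive sg (eb i) ->
  anchor sg (ea i) \in boundary R -> anchor sg (eb i) \in boundary R ->
  size (contacts R sg i) <= 1 ->
  r \in R -> covered c r (shadows T) -> force (advantage R) c r.
Proof.
move=> iv iJ aa ab bda bdb K1 rR cov.
have K0 := i_blocks iv iJ.
have va := i_valid iv.
have notin l : [seq x <- l | x \in boundary R] = [::] -> {in l, forall x, x \notin boundary R}.
  by move=> lE x xl; apply/negP => xb; have : x \in [::] by rewrite -lE mem_filter xb.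
pose fp := [seq x <- pre sg i | x \in boundary R].
pose fc := [seq x <- chain sg i | x \in boundary R].
pose fq := [seq x <- post sg i | x \in boundary R].
have KE : contacts R sg i = fp ++ fc ++ fq by rewrite /contacts !filter_cat.
case KE' : (contacts R sg i) K1 => [|z [|//]] _.
  have [t tT ti] := tag_guard iv iJ.
  case: t ti tT => -[i0 phi] b /= -> /mem_split[T1 [T2 TE]].
  rewrite TE in iv cov K0; rewrite KE' blocks_cat blocks_cons /= eqxx in K0.
  case B1 : (blocks i T1) K0 => //; case bE : b => //= B2.
  move: KE; rewrite KE'; case pE : fp => //; case cE : fc => //= qE.
  apply: (@op_reroute R sg T1 T2 i phi b (anchor sg (ea i)) sg predT [::] (chain sg i) [::] id) => //=.
  - by right; rewrite bE.
  - by rewrite cats0.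
  - by right.
  - exact: notin.
  - by left.
  - by move=> q y yq; rewrite inE mem_rcons inE yq !orbT.
  - by move=> q; rewrite B1 B2 !cats0 -/fp pE -/fq -qE cats0.
  - by move=> j jJ ji; rewrite (contacts_rest iv jJ) blocks_drop.
  - by move=> j jJ _; apply: (i_unlinked iv jJ).
have zK : z \in contacts R sg i by rewrite KE' mem_head.
have [[[i0 phi] b] tT /= [ti zb]] := mem_blocks (i := i) (T := T) (z := z) (eq_ind_r (fun s => z \in s) zK K0).
move: ti tT => /= -> /mem_split[T1 [T2 TE]].
rewrite TE in iv cov K0; rewrite KE' blocks_cat blocks_cons /= eqxx in K0.
have [B1 bE B2] : [/\ blocks i T1 = [::], b = [:: z] & blocks i T2 = [::]].
  case: (blocks i T1) K0 => [|y [|//]] /=; last by case: (b) zb.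
  by case: (b) zb => // y b' _ [-> /eqP]; rewrite -size_eq0 size_cat addn_eq0 !size_eq0 => /andP[/eqP-> /eqP->].
have H s : s = z -> total < m \/ {subset b <= [:: s]} by move=> ->; right; rewrite bE.
move: KE; rewrite KE' => KE.
have go := @op_reroute R sg T1 T2 i phi b z sg predT.
have goJ : {in J, forall j, j != i -> contacts R sg j = [seq x <- blocks j (T1 ++ T2) | predT x]}.
  by move=> j jJ ji; rewrite (contacts_rest iv jJ) blocks_drop.
have goU : {in J, forall j, j != i -> ~~ linked sg j -> size (contacts R sg j) <= 1}.
  by move=> j jJ _; apply: (i_unlinked iv jJ).
have fpE : fp = [:: z] -> z = anchor sg (ea i).
  move=> E; have : z \in fp by rewrite E mem_head.
  by rewrite mem_filter => /andP[_]; case: (pre_cases sg i) => ->; rewrite ?inE // => /eqP.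
have fqE : fq = [:: z] -> z = anchor sg (eb i).
  move=> E; have : z \in fq by rewrite E mem_head.
  by rewrite mem_filter => /andP[_]; case: (post_cases sg i) => ->; rewrite ?inE // => /eqP.
case pE : fp KE => [|y fp'] /=; last first.
  case=> yz; case: fp' pE => //= pE; case cE : fc => //= /esym qE.
  have zE : z = anchor sg (ea i) by apply: fpE; rewrite pE yz.
  apply: (go [::] (chain sg i) [::] (fun q => z :: q) c r iv (H _ erefl)) => //=.
  - by rewrite cats0.
  - by right.
  - exact: notin.
  - by left.
  - by rewrite zE => q x; rewrite !inE mem_rcons inE => /orP[->//|->]; rewrite !orbT.
  - by move=> q; rewrite B1 B2 !cats0 -/fp pE -/fq qE cats0 yz.
case cE : fc => [|y fc'] /=.
  move=> /esym qE; have zE := fqE qE.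
  apply: (go [::] (chain sg i) [::] (fun q => rcons q z) c r iv (H _ erefl)) => //=.
  - by rewrite cats0.
  - by right.
  - exact: notin.
  - by right.
  - by rewrite zE => q x; rewrite !inE => ->; rewrite orbT.
  - by move=> q; rewrite B1 B2 !cats0 -/fp pE -/fq qE cats1.
case=> yz; case: fc' cE => //= cE /esym qE; rewrite -yz in cE.
have [l1 [s2 [ci f1 f2]]] := @filter_split _ _ (chain sg i) [::] [::] z cE.
have li : linked sg i.
  by apply: contraT => /(v_unlinked va); rewrite ci; case: (l1).
have zbd : z \in boundary R by move: zK; rewrite mem_filter => /andP[].
apply: (go (rcons l1 z) s2 [::] (fun q => z :: q) c r iv (H _ erefl)) => //=.
- by rewrite cats0 cat_rcons.
- by left.
- exact: notin.
- by rewrite last_rcons.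
- by left; rewrite last_rcons.
- by rewrite last_rcons => q x; rewrite !inE mem_rcons inE => /orP[->//|->]; rewrite !orbT.
- by move=> q; rewrite B1 B2 !cats0 filter_cat -/fp pE filter_rcons zbd f1 -/fq qE cats0.
Qed.


Lemma finish_swap R R0 sg sg' T1 T2 i phi b psi b' c r :
  invariant R sg (T1 ++ (i, phi, b) :: T2) -> i \in J ->
  shadow R psi -> {in b', forall z, protects R psi z} ->
  valid R0 sg' -> R0 \proper R ->
  {in J, forall j, j != i -> contacts R0 sg' j = [seq x <- contacts R sg j | x \in boundary R0]} ->
  contacts R0 sg' i = [seq x <- blocks i T1 ++ b' ++ blocks i T2 | x \in boundary R0] ->
  (forall j, linked sg j -> linked sg' j) ->
  (~~ linked sg' i -> size (contacts R0 sg' i) <= 1) ->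
  r \in R0 -> covered c r (shadows (T1 ++ (i, psi, b') :: T2)) -> advantage R c r.
Proof.
move=> iv iJ sh pr va R0R cj ci lk ui rR0 cov.
have BI x : x \in R0 -> x \in R by exact: (subsetP (proper_sub R0R)).
have memT t : t \in T1 ++ (i, psi, b') :: T2 -> t = (i, psi, b') \/
    t \in T1 ++ (i, phi, b) :: T2.
  by rewrite !mem_cat !inE => /or3P[->|/eqP->|->]; [right|left|right]; rewrite ?orbT.
apply: (@finish R R0 sg' (T1 ++ (i, psi, b') :: T2)) => //.
- move=> t /memT[-> /=|tT] x y xR yR; first by apply: sh; exact: BI.
  by apply: (i_shadow iv tT); exact: BI.
- move=> t /memT[-> /=|tT] z zt x xR; first by apply: (pr _ zt); exact: BI.
  by apply: (i_protects iv tT zt); exact: BI.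
- move=> j jJ; have [->|ji] := eqVneq j i; first by rewrite ci blocks_cat blocks_cons /= eqxx.
  by rewrite cj // -(i_blocks iv) // !blocks_drop.
- by move=> j; rewrite -(i_count iv) !count_cat.
- move=> j jJ; have [-> //|ji] := eqVneq j i; move=> lj; rewrite cj //.
  apply: leq_trans (i_unlinked iv jJ _); first by rewrite size_filter count_size.
  by apply: contra lj; exact: lk.
Qed.

Lemma full_eq sg sg' w j : j != f w ->
  (forall u, u != w -> alive sg' u = alive sg u) ->
  (forall u, u != w -> anchor sg' u = anchor sg u) ->
  chain sg' j = chain sg j ->
  pre sg' j ++ chain sg' j ++ post sg' j = pre sg j ++ chain sg j ++ post sg j.
Proof.
move=> jw al an ->; congr (_ ++ (_ ++ _)); rewrite /pre /post.
  have [->|ew] := eqVneq (ea j) w; first by rewrite eq_sym (negPf jw).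
  by rewrite al // an.
have [->|ew] := eqVneq (eb j) w; first by rewrite eq_sym (negPf jw).
by rewrite al // an.
Qed.

(** A new core of [w] may start next to the anchor of its living mate, or anywhere in [R] if there
    is none. As mates are unique, one target set suffices. *)
Lemma seed_target R sg w : valid R sg -> R != set0 ->
  (forall v, alive sg v -> anchor sg v \in boundary R) ->
  exists L : {set G}, [/\ L \subset R, L != set0 &
    {in L, forall y v, mt w v -> alive sg v ->
      exists2 x, label sg x = Some (inl v) & adj y x}].
Proof.
move=> va R0 an.
have [[v [wv av]]|nv] := pselect (exists v, mt w v /\ alive sg v).
  exists [set y in R | adj y (anchor sg v)]; split.
  - by apply/subsetP => y; rewrite inE => /andP[].
  - have /boundaryP[_ [y yR e]] := an _ av.
    by apply/set0Pn; exists y; rewrite inE yR.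
  - move=> y; rewrite inE => /andP[_ e] v' wv' _; exists (anchor sg v) => //.
    by rewrite -(mt_uniq wv wv'); apply/eqP.
exists R; split => // y _ v wv av; by case: nv; exists v.
Qed.

(** The segment [f w] ends at the dead [w], so it is unlinked and its only possible contact is the
    anchor of its other end. If there is none, an idle guard is posted at the new core. Otherwise
    one guard must hold both, and the geodesic from that contact to the new core at once becomes the
    chain. *)
Lemma op_seed R sg T w c r : invariant R sg T -> w \in W -> ~~ alive sg w ->
  (forall v, alive sg v -> anchor sg v \in boundary R) ->
  r \in R -> covered c r (shadows T) -> force (advantage R) c r.
Proof.
move=> iv wW nw an rR cov; have va := i_valid iv.
have R0 : R != set0 by apply/set0Pn; exists r.
have [L [LR L0 Lw]] := seed_target w va R0 an.
have iJ := f_J wW; set i := f w in iJ.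
have fe := f_end wW.
have nl : ~~ linked sg i.
  apply/negP => /(v_linked va)[_ aa ab _]; move: nw.
  by case: fe => ->; rewrite ?aa ?ab.
have ch := v_unlinked va nl.
have K0 := i_blocks iv iJ.
have other u : alive sg u -> u != w by move=> au; apply: contraNneq nw => <-.
have seedE y u : y \in R -> u != w -> alive (seed sg w y) u = alive sg u.
  by move=> yR uw; rewrite (seed_alive _ _ va yR) (negPf uw).
have seedA y u : u != w -> anchor (seed sg w y) u = anchor sg u by move=> /= /negPf->.
have preN : pre sg i != [::] -> [/\ ea i != w, f (ea i) = i, alive sg (ea i) & pre sg i = [:: anchor sg (ea i)]].
  rewrite /pre; case: ifP => // /andP[/eqP fi ai] _; split => //; exact: other.
have postN : post sg i != [::] -> [/\ eb i != w, f (eb i) = i, alive sg (eb i), ea i != eb i & post sg i = [:: anchor sg (eb i)]].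
  rewrite /post; case: ifP => // /and3P[/eqP fi ? ai] _; split => //; exact: other.
have preK : {subset pre sg i <= contacts R sg i}.
  move=> x xp; rewrite mem_filter mem_cat xp /= andbT.
  have [|_ _ ai pE] := preN; first by case: (pre sg i) xp.
  by move: xp; rewrite pE inE => /eqP->; exact: an.
have postK : {subset post sg i <= contacts R sg i}.
  move=> x xp; rewrite mem_filter !mem_cat xp !orbT andbT.
  have [|_ _ ai _ pE] := postN; first by case: (post sg i) xp.
  by move: xp; rewrite pE inE => /eqP->; exact: an.
case KE : (contacts R sg i) (i_unlinked iv iJ nl) => [|z [|//]] _.
  have /set0Pn[y yL] := L0; have yR := subsetP LR _ yL.
  have [t tT ti] := tag_guard iv iJ.
  case: t ti tT => -[i0 phi] b /= -> /mem_split[T1 [T2 TE]].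
  rewrite TE in iv cov K0; rewrite KE blocks_cat blocks_cons /= eqxx in K0.
  case B1 : (blocks i T1) K0 => //; case bE : b => //= B2; rewrite bE in iv cov.
  apply: (force_bind _ (op_fetch [:: y] y iv rR cov)) => {c r rR cov} c r [rR cov].
  have tT : (i, [ffun => y], [:: y]) \in T1 ++ (i, [ffun => y], [:: y]) :: T2 by rewrite mem_cat mem_head orbT.
  have [ry|ry] := eqVneq r y; first by apply: (captured_by _ cov tT); rewrite ffunE.
  apply: force_now.
  have va' := seed_valid mt_sym mt_irr va wW nw yR (Lw _ yL).
  have pre0 : pre sg i = [::].
    by case E : (pre sg i) preK => [//|x l] /(_ x); rewrite KE mem_head => /(_ isT).
  have post0 : post sg i = [::].
    by case E : (post sg i) postK => [//|x l] /(_ x); rewrite KE mem_head => /(_ isT).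
  have fullE : pre (seed sg w y) i ++ chain (seed sg w y) i ++ post (seed sg w y) i = [:: y].
    rewrite /= ch; have [eaw|eaw] := eqVneq (ea i) w.
      rewrite {1}/pre eaw (seed_alive _ _ va yR) !eqxx /= eqxx /post.
      by have [ebw|ebw] := eqVneq (eb i) w; [rewrite eaw ebw eqxx andbF|
        move: post0; rewrite /post seedE // eaw seedA //; case: ifP].
    have ebw : eb i = w by case: fe => // E; rewrite -E eqxx in eaw.
    rewrite {1}/pre seedE // seedA // -/(pre sg i) pre0 /post ebw eaw (seed_alive _ _ va yR).
    by rewrite !eqxx /= eqxx.
  apply: (finish_swap (R0 := R :\ y) (sg' := seed sg w y) iv iJ _ _ va' _ _ _ _ _ _ cov) => //.
  - exact: launch_shadow (launch_const R y).
  - by move=> z; rewrite inE => /eqP-> x _ _; rewrite ffunE step_refl.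
  - by rewrite properD1.
  - move=> j jJ ji; rewrite /contacts.
    rewrite (@full_eq sg (seed sg w y) w j ji (fun u => @seedE y u yR) (seedA y) erefl).
    have -> : R :\ y = R :\: [set x in [:: y]] by apply/setP => x; rewrite !inE.
    apply: (filter_setD va); first by move=> x; rewrite inE => /eqP->.
    by move=> x; exact: (full_label va).
  - by rewrite /contacts fullE B1 B2 cats0.
  - move=> _; rewrite /contacts fullE /=; by case: ifP.
  - by rewrite !inE ry.

have zK : z \in contacts R sg i by rewrite KE mem_head.
have zb : z \in boundary R by move: zK; rewrite mem_filter => /andP[].
have fullz : [seq x <- pre sg i ++ post sg i | x \in boundary R] = [:: z].
  by rewrite -KE /contacts ch.
have [[[i0 phi] b] tT /= [ti zt]] := mem_blocks (i := i) (T := T) (z := z) (eq_ind_r (fun s => z \in s) zK K0).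
move: ti tT => /= -> /mem_split[T1 [T2 TE]].
rewrite TE in iv cov K0; rewrite KE blocks_cat blocks_cons /= eqxx in K0.
have [B1 bE B2] : [/\ blocks i T1 = [::], b = [:: z] & blocks i T2 = [::]].
  case: (blocks i T1) K0 => [|x [|//]] /=; last by case: (b) zt.
  by case: (b) zt => // x b' _ [-> /eqP]; rewrite -size_eq0 size_cat addn_eq0 !size_eq0 => /andP[/eqP-> /eqP->].
have [q [psi [[pq qR uq lq] La pr cap]]] := geodesic_guard (i_connected iv) (or_intror zb) LR L0.
case/lastP: q pq qR uq lq pr cap => [|q y] pq qR uq lq pr cap.
  by case/boundaryP: zb => /negP[]; exact: (subsetP LR).
rewrite last_rcons in lq; have yR := subsetP LR _ lq.
have va1 := seed_valid mt_sym mt_irr va wW nw yR (Lw _ lq).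
have qR' : {subset q <= R :\ y}.
  move=> x xq; rewrite !inE qR ?mem_rcons ?inE ?xq ?orbT // andbT.
  by apply: contraTneq uq => xy; rewrite /= rcons_uniq -xy xq !andbF.
have uq' : uniq q by move: uq; rewrite /= rcons_uniq => /and3P[].
pose sg1 := seed sg w y.
have al1 u : alive sg1 u = (u == w) || alive sg u by exact: (seed_alive _ _ va yR).
have an1 : anchor sg1 w = y by rewrite /= eqxx.
have zE u x : x \in [:: u] -> x \in contacts R sg i -> u = z.
  by rewrite KE !inE => /eqP-> /eqP.
(* The geodesic runs from [z] to [y] but a chain runs from [ea] to [eb]: it is reversed when [w] is
   [ea i]. *)
have [q' [q'q pq' aa ab]] : exists q', [/\ q' = q \/ q' = rev q,
    path (@adj G) (anchor sg1 (ea i)) (rcons q' (anchor sg1 (eb i))),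
    alive sg1 (ea i) & alive sg1 (eb i)].
  have [pE|/preN[eaw _ ai pE]] := eqVneq (pre sg i) [::].
    have [|ebw _ ai _ qE] := postN; first by apply/eqP => qE; move: fullz; rewrite pE qE.
    have eaw : ea i = w by case: fe => // E; rewrite -E eqxx in ebw.
    exists (rev q); split; [by right| |by rewrite al1 eaw eqxx|by rewrite al1 ai orbT].
    rewrite eaw an1 seedA // (zE (anchor sg (eb i)) (anchor sg (eb i))) ?mem_head //; last first.
      by apply: postK; rewrite qE mem_head.
    have := rev_path (@adj G) z (rcons q y); rewrite last_rcons belast_rcons rev_cons => ->.
    by rewrite (eq_path (e' := @adj G)) // => u v; rewrite adj_sym.
  have ebw : eb i = w by case: fe => // E; rewrite -E eqxx in eaw.
  exists q; split; [by left| |by rewrite al1 ai orbT|by rewrite al1 ebw eqxx].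
  rewrite ebw an1 seedA // (zE (anchor sg (ea i)) (anchor sg (ea i))) ?mem_head //.
  by apply: preK; rewrite pE mem_head.
have q'E : q' =i q by case: q'q => -> x; rewrite ?mem_rev.
have uq2 : uniq q' by case: q'q => ->; rewrite ?rev_uniq.
have qR2 : {subset q' <= R :\ y} by move=> x; rewrite q'E; exact: qR'.
have va2 := reroute_valid va1 iJ aa ab (ch : chain sg1 i = [::] ++ [::] ++ [::])
  (or_intror (conj erefl erefl)) (fun x (xn : x \in [::]) => False_ind _ (notF xn)) qR2 uq2 pq'.
set R1 := (R :\ y) :\: [set x in q'] in va2; rewrite /= cats0 in va2.
set sg2 := reroute sg1 i q' in va2.
have R1E : R1 = R :\: [set x in rcons q y].
  by apply/setP => x; rewrite !inE mem_rcons inE q'E negb_or andbCA andbA.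
have al2 u : alive sg2 u = alive sg1 u.
  rewrite /alive /=; case: ifP => [|_].
    rewrite q'E => uq0; have := qR' _ uq0; rewrite !inE => /andP[/negPf-> uR].
    by rewrite (v_territory va uR).
  by case: (_ =P Some (inr i)) => // ->.
have pre2 : pre sg2 i = pre sg1 i by rewrite /pre al2.
have post2 : post sg2 i = post sg1 i by rewrite /post al2.
have preS : {subset pre sg1 i <= z :: rcons q y}.
  move=> x; rewrite /pre; case: ifP => // /andP[fi ai]; rewrite inE => /eqP->.
  have [->|ew] := eqVneq (ea i) w; first by rewrite an1 inE mem_rcons mem_head orbT.
  rewrite seedA // (zE (anchor sg (ea i)) (anchor sg (ea i))) ?mem_head //.
  by apply: preK; rewrite /pre fi; move: ai; rewrite al1 (negPf ew) /= => ->; rewrite mem_head.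
have postS : {subset post sg1 i <= z :: rcons q y}.
  move=> x; rewrite /post; case: ifP => // /and3P[fi ne ai]; rewrite inE => /eqP->.
  have [->|ew] := eqVneq (eb i) w; first by rewrite an1 inE mem_rcons mem_head orbT.
  rewrite seedA // (zE (anchor sg (eb i)) (anchor sg (eb i))) ?mem_head //.
  by apply: postK; rewrite /post fi ne; move: ai; rewrite al1 (negPf ew) /= => ->; rewrite mem_head.
pose b' := pre sg1 i ++ q' ++ post sg1 i.
have H : total < m \/ {subset b <= [:: z]} by right; rewrite bE.
apply: (force_bind _ (swap_guard b' iv H La rR cov)) => {c r rR cov} c r [rR cov].
have tT : (i, psi, b') \in T1 ++ (i, psi, b') :: T2 by rewrite mem_cat mem_head orbT.
case rq : (r \in rcons q y); first by apply: (captured_by _ cov tT); apply: cap; rewrite ?inE ?rq ?orbT.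
apply: force_now.
apply: (finish_swap (R0 := R1) (sg' := sg2) iv iJ _ _ va2 _ _ _ _ _ _ cov) => //.
- exact: launch_shadow La.
- move=> x; rewrite !mem_cat q'E => /or3P[/preS|xq|/postS]; try exact: pr.
  by apply: pr; rewrite inE mem_rcons inE xq !orbT.
- by rewrite R1E; apply: (proper_setD (x := y)) => //; rewrite mem_rcons mem_head.
- move=> j jJ ji; rewrite /contacts.
  have al' u : u != w -> alive sg2 u = alive sg u by move=> uw; rewrite al2; exact: seedE.
  have ch' : chain sg2 j = chain sg j by rewrite /= (negPf ji).
  rewrite (full_eq ji al' (seedA y) ch') R1E; apply: (filter_setD va qR).
  by move=> x; exact: (full_label va).
- by rewrite /contacts pre2 post2 /= eqxx B1 B2 cats0.
- by move=> j lj /=; rewrite lj.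
- by rewrite /= eqxx orbT.
- by rewrite R1E !inE rq.
Qed.


(** * Cores that have lost their contact *)

Definition weight sg := \sum_i size (chain sg i) + #|[pred w | alive sg w]|.

Definition progress R sg c r := advantage R c r \/ exists sg' T',
  [/\ invariant R sg' T', weight sg' < weight sg, r \in R & covered c r (shadows T')].

Section Absorb.
Variables (R : {set G}) (sg : state) (T : seq guard) (w : V) (i : I) (x : G) (l : seq G).
Hypothesis iv : invariant R sg T.
Hypothesis aw : alive sg w.
Hypothesis nw : anchor sg w \notin boundary R.
Hypothesis li : linked sg i.
Hypothesis side : (ea i = w /\ chain sg i = x :: l) \/ [/\ eb i = w, ea i != w & chain sg i = rcons l x].

Let sg1 := absorb R sg w i x l.

Let va : valid R sg := i_valid iv.

Lemma absorb_valid : valid R sg1.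
Proof.
case: side => [[eaw ci]|[ebw _ ci]].
  exact: absorb_head_valid va li eaw ci nw.
exact: absorb_last_valid va li ebw ci nw.
Qed.

Lemma absorb_chain : perm_eq (chain sg i) (x :: l).
Proof. by case: side => [[_ ->]|[_ _ ->]] //; rewrite perm_rcons. Qed.

Lemma absorb_label : label sg x = Some (inr i).
Proof. by apply/eqP; rewrite -(v_chain va) (perm_mem absorb_chain) mem_head. Qed.

Lemma absorb_alive u : alive sg1 u = alive sg u.
Proof.
rewrite /alive /=; have [->|uw] /= := eqVneq u w.
  by rewrite (eqP aw); case: (x \in boundary R); rewrite ?eqxx //; case: ifP; rewrite ?eqxx // (eqP aw) eqxx.
case: (_ =P x) => // ->; rewrite absorb_label.
by apply/eqP => -[E]; rewrite E eqxx in uw.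
Qed.

Lemma absorb_anchor u : u != w -> anchor sg1 u = anchor sg u.
Proof. by move=> /= /negPf->. Qed.

Lemma absorb_weight : weight sg1 < weight sg.
Proof.
rewrite /weight; have -> : #|[pred w | alive sg1 w]| = #|[pred w | alive sg w]|.
  by apply: eq_card => u; rewrite !inE absorb_alive.
rewrite ltn_add2r (bigD1 i) //= [X in _ < X](bigD1 i) //= eqxx.
rewrite (perm_size absorb_chain) /= addSn ltnS leq_add2l leq_sum // => j /negPf->.
exact: leqnn.
Qed.

Lemma absorb_contacts_other j : j != f w ->
  contacts R sg1 j = [seq y <- contacts R sg j | y != x].
Proof.
move=> jw.
have eE u : f u = j -> u != w by move=> fu; apply: contraNneq jw => <-; rewrite fu.
have preE : pre sg1 j = pre sg j.
  by rewrite /pre absorb_alive; case: (f (ea j) =P j) => //= /eE uw; rewrite (negPf uw).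
have postE : post sg1 j = post sg j.
  by rewrite /post absorb_alive; case: (f (eb j) =P j) => //= /eE uw; rewrite (negPf uw).
rewrite /contacts preE postE.
have swap k : [seq y <- [seq y <- k | y \in boundary R] | y != x] =
    [seq y <- [seq y <- k | y != x] | y \in boundary R].
  by rewrite -!filter_predI; apply: eq_filter => y /=; rewrite andbC.
rewrite swap.
suff -> : [seq y <- pre sg j ++ chain sg j ++ post sg j | y != x] = pre sg j ++ chain sg1 j ++ post sg j by [].
rewrite !filter_cat.
have out k : {in k, forall y, label sg y != Some (inr i)} -> [seq y <- k | y != x] = k.
  by move=> kN; apply/all_filterP/allP => y /kN; apply: contraNneq => ->; rewrite absorb_label.
congr (_ ++ (_ ++ _)).
- apply: out => y; rewrite /pre; case: ifP => // /andP[_ /eqP al]; rewrite inE => /eqP->.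
  by rewrite al.
- rewrite /=; have [->|ji] := eqVneq j i; last first.
    apply: out => y; rewrite (v_chain va) => /eqP->; apply: contraNneq ji => -[->] //.
  have xl : x \notin l by have := v_uniq va i; rewrite (perm_uniq absorb_chain) => /andP[].
  have lE : [seq y <- l | y != x] = l by apply/all_filterP/allP => y yl; apply: contraNneq xl => <-.
  case: side => [[_ ->]|[_ _ ->]]; last by rewrite filter_rcons eqxx lE.
  by rewrite /= eqxx lE.
- apply: out => y; rewrite /post; case: ifP => // /and3P[_ _ /eqP al]; rewrite inE => /eqP->.
  by rewrite al.
Qed.

(** No cop moves: [x] is not a contact, or it turns from a vertex on the chain of [f w] into the
    anchor of [w], which keeps the same place in the contact list of the same segment. *)
Lemma absorb_quiet : x \notin boundary R \/ i = f w -> invariant R sg1 T.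
Proof.
move=> H.
have cE j : contacts R sg1 j = contacts R sg j.
  have [xb|xb] := boolP (x \in boundary R); last first.
    have anE u : anchor sg1 u = anchor sg u by rewrite /= (negPf xb) andbF.
    rewrite /contacts /pre /post !absorb_alive !anE !filter_cat; congr (_ ++ (_ ++ _)).
    rewrite /=; case: (j =P i) => // ->.
    by case: side => [[_ ->]|[_ _ ->]]; rewrite ?filter_rcons /= (negPf xb).
  case: H => [|iw]; first by rewrite xb.
  have [ji|ji] := eqVneq j (f w); last first.
    rewrite absorb_contacts_other //; apply/all_filterP/allP => y.
    rewrite mem_filter => /andP[_ yj]; apply: contraNneq ji => yx.
    move: yj; rewrite yx !mem_cat => /or3P[|xj|].
    - by rewrite /pre; case: ifP => // /andP[_ /eqP al]; rewrite inE => /eqP E; move: absorb_label; rewrite E al.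
    - by move: xj; rewrite (v_chain va) absorb_label iw => /eqP[->].
    - by rewrite /post; case: ifP => // /and3P[_ _ /eqP al]; rewrite inE => /eqP E; move: absorb_label; rewrite E al.
  rewrite {}ji -iw /contacts /pre /post !absorb_alive /= eqxx.
  case: side => [[eaw ci]|[ebw eaw ci]].
    rewrite eaw -iw aw ci !eqxx /= xb (negPf nw) xb; congr (_ :: _).
    rewrite !filter_cat; congr (_ ++ _).
    by have [->|] := eqVneq (eb i) w; rewrite ?eqxx ?andbF.
  rewrite ebw -iw aw eaw !eqxx /= xb (negPf eaw) ci !filter_cat filter_rcons xb /= xb (negPf nw).
  by rewrite cats0 cats1.
case: (iv) => h1 h2 h3 h4 h5 h6 h7; split => //.
- exact: absorb_valid.
- by move=> j jJ; rewrite cE h5.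
- by move=> j jJ lj; rewrite cE h7.
Qed.

(** The core of [w] absorbs a contact [x] of the chain of [i], which the cops of
    [f w] have to take over from those of [i]. If they already guard a contact [z],
    then this is achieved by rerouting the chain of [f w] from [z] to [x]. *)
Lemma op_anchor c r : x \in boundary R -> i != f w -> chain sg (f w) = [::] -> w \in W ->
  r \in R -> covered c r (shadows T) -> force (progress R sg) c r.
Proof.
move=> xb iw ch wW rR cov; set P := f w in iw ch.
have PJ : P \in J := f_J wW.
have K0 := i_blocks iv PJ.
have an1 : anchor sg1 w = x by rewrite /= eqxx xb.
have ch1 : chain sg1 P = [::] by rewrite /= eq_sym (negPf iw).
have KE : contacts R sg P = [seq y <- pre sg P | y \in boundary R] ++ [seq y <- post sg P | y \in boundary R].
  by rewrite /contacts ch filter_cat.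
have ul : {in J, forall j, j != P -> ~~ linked sg1 j -> size (contacts R sg1 j) <= 1}.
  move=> j jJ jP nlj; rewrite absorb_contacts_other // size_filter.
  exact: leq_trans (count_size _ _) (i_unlinked iv jJ nlj).
have preE : ea P != w -> pre sg1 P = pre sg P.
  by move=> ew; rewrite /pre absorb_alive absorb_anchor.
have postE : eb P != w -> post sg1 P = post sg P.
  by move=> ew; rewrite /post absorb_alive absorb_anchor.
have prew : ea P = w -> [seq y <- pre sg P | y \in boundary R] = [::].
  by move=> ew; case: (pre_cases sg P) => ->; rewrite //= ew (negPf nw).
have postw : eb P = w -> [seq y <- post sg P | y \in boundary R] = [::].
  by move=> ew; case: (post_cases sg P) => ->; rewrite //= ew (negPf nw).
have kpE j T1 T2 phi b : T = T1 ++ (P, phi, b) :: T2 -> j \in J -> j != P ->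
    contacts R sg1 j = [seq y <- blocks j (T1 ++ T2) | y != x].
  by move=> TE jJ jP; rewrite absorb_contacts_other // -(i_blocks iv) // TE blocks_drop.
have [t tT ti] := tag_guard iv PJ.
case KP : (contacts R sg P) => [|z K'].
  case: t ti tT => -[i0 phi] b /= -> /mem_split[T1 [T2 TE]].
  have {}kpE := kpE _ _ _ _ _ TE.
  rewrite TE in cov; have iv' := iv; rewrite TE in iv'.
  move: K0; rewrite KP TE blocks_cat blocks_cons /= eqxx.
  case B1 : (blocks P T1) => //; case bE : b => //= B2; rewrite bE in iv' cov.
  apply: (force_bind _ (op_fetch [:: x] x iv' rR cov)) => {c r rR cov} c r [rR cov].
  apply: force_now; right.
  (* As the new anchor of [w], the vertex [x] is now charged to [P] and leaves the blocks of all
     other segments. *)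
  pose g t : guard := if t.1.1 == P then t else (t.1, [seq y <- t.2 | y != x]).
  have g1 t : (g t).1 = t.1 by rewrite /g; case: ifP.
  pose T' := [seq g t | t <- T1 ++ (P, [ffun => x], [:: x]) :: T2].
  have shE : shadows T' = shadows (T1 ++ (P, [ffun => x], [:: x]) :: T2).
    by rewrite /shadows -map_comp; apply: eq_map => t /=; rewrite g1.
  exists sg1, T'; split => //; [|exact: absorb_weight|by rewrite shE].
  have old t : t \in T1 ++ T2 -> t \in T1 ++ (P, phi, [::]) :: T2.
    by rewrite !mem_cat inE => /orP[->|->]; rewrite ?orbT.
  have memT' t' : t' \in T' -> (t' = (P, [ffun => x], [:: x])) \/
      exists2 t, t \in T1 ++ T2 & t'.1 = t.1 /\ {subset t'.2 <= t.2}.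
    move=> /mapP[t]; rewrite mem_cat inE orbCA => /predU1P[-> ->|tT' ->].
      by left; rewrite /g /= eqxx.
    right; exists t; first by rewrite mem_cat.
    rewrite /g; case: ifP => //= _; split => // y; by rewrite mem_filter => /andP[].
  have cP : contacts R sg1 P = [:: x].
    move: KE; rewrite KP => /esym/eqP; rewrite -size_eq0 size_cat addn_eq0 !size_eq0 => /andP[/eqP pE /eqP qE].
    rewrite /contacts ch1 !filter_cat /=.
    have [eaw|eaw] := eqVneq (ea P) w.
      rewrite {1}/pre absorb_alive eaw -/P eqxx aw /= eqxx xb /= xb.
      have [ebw|ebw] := eqVneq (eb P) w; last by rewrite postE // qE.
      by rewrite /post eaw ebw eqxx andbF.
    have ebw : eb P = w by case: (f_end wW) => // E; rewrite -E eqxx in eaw.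
    rewrite preE // pE /post absorb_alive ebw -/P eqxx eaw aw /= eqxx xb /= xb.
    by [].
  split.
  - exact: absorb_valid.
  - exact: i_connected iv.
  - move=> t' /memT'[-> /=|[t0 tT0 [-> _]]]; first exact: launch_shadow (launch_const R x).
    exact: (i_shadow iv' (old _ tT0)).
  - move=> t' /memT'[-> /=|[t0 tT0 [-> sub]]] y; last by move=> /sub; exact: (i_protects iv' (old _ tT0)).
    by rewrite inE => /eqP-> a _ _; rewrite ffunE step_refl.
  - move=> j jJ.
    have gE T0 : blocks j (map g T0) = if j == P then blocks j T0 else [seq y <- blocks j T0 | y != x].
      elim: T0 => [|t0 T0 IH] /=; first by case: ifP.
      rewrite !blocks_cons IH g1 /g; have [->|ji] := eqVneq j P; first by case: (t0.1.1 == P).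
      rewrite filter_cat; congr (_ ++ _); case: (t0.1.1 =P j) => // ->.
      by rewrite (negPf ji).
    rewrite gE; have [->|jP] := eqVneq j P; last by rewrite blocks_drop // kpE.
    by rewrite cP blocks_cat blocks_cons /= eqxx B1 B2.
  - move=> j; rewrite /T' count_map -(i_count iv') !count_cat /= g1; congr (_ + (_ + _)).
      by apply: eq_count => t0 /=; rewrite g1.
    by apply: eq_count => t0 /=; rewrite g1.
  - move=> j jJ; have [->|jP] := eqVneq j P; [by rewrite cP|exact: ul].
(* The chain of [P] is empty and the anchor of [w] is off the boundary, so only the other anchor can
   be a contact. *)
have K'0 : K' = [::].
  move: KE; rewrite KP; have [eaw|eaw] := eqVneq (ea P) w.
    by rewrite prew //=; case: (post_cases sg P) => -> /=; last case: ifP => //= _ [].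
  have ebw : eb P = w by case: (f_end wW) => // E; rewrite -E eqxx in eaw.
  by rewrite postw // cats0; case: (pre_cases sg P) => -> /=; last case: ifP => //= _ [].
rewrite {}K'0 in KP.
have zK : z \in contacts R sg P by rewrite KP mem_head.
have zb : z \in boundary R by move: zK; rewrite mem_filter => /andP[].
have [[[i0 phi] b] tT' /= [ti' zt]] := mem_blocks (i := P) (T := T) (z := z) (eq_ind_r (fun s => z \in s) zK K0).
move: ti' tT' => /= -> /mem_split[T1 [T2 TE]].
have {}kpE := kpE _ _ _ _ _ TE.
rewrite TE in cov K0; have iv' := iv; rewrite TE in iv'.
rewrite KP blocks_cat blocks_cons /= eqxx in K0.
have [B1 bE B2] : [/\ blocks P T1 = [::], b = [:: z] & blocks P T2 = [::]].
  case: (blocks P T1) K0 => [|y [|//]] /=; last by case: (b) zt.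
  by case: (b) zt => // y b' _ [-> /eqP]; rewrite -size_eq0 size_cat addn_eq0 !size_eq0 => /andP[/eqP-> /eqP->].
have [bda bdb aa ab zs] : [/\ anchor sg1 (ea P) \in boundary R, anchor sg1 (eb P) \in boundary R,
    alive sg1 (ea P), alive sg1 (eb P) & z = anchor sg1 (ea P) \/ z = anchor sg1 (eb P)].
  move: zK; rewrite KE mem_cat => /orP[zp|zp].
    have eaw : ea P != w by apply: contraTneq zp => /prew->.
    have ebw : eb P = w by case: (f_end wW) => // E; rewrite -E eqxx in eaw.
    move: zp; rewrite mem_filter => /andP[_]; rewrite /pre; case: ifP => // /andP[_ aea].
    rewrite inE => /eqP zE; rewrite ebw an1 absorb_anchor // -zE !absorb_alive aea aw.
    by split => //; left.
  have ebw : eb P != w by apply: contraTneq zp => /postw->.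
  have eaw : ea P = w by case: (f_end wW) => // E; rewrite -E eqxx in ebw.
  move: zp; rewrite mem_filter => /andP[_]; rewrite /post; case: ifP => // /and3P[_ _ aeb].
  rewrite inE => /eqP zE; rewrite eaw an1 absorb_anchor // -zE !absorb_alive aeb aw.
  by split => //; right.
apply: (force_bind _ (@op_reroute R sg T1 T2 P phi b z sg1 (fun y => y != x) [::] [::] [::]
  (fun q => [seq y <- pre sg1 P | y \in boundary R] ++ q ++ [seq y <- post sg1 P | y \in boundary R])
  c r iv' _ absorb_valid PJ aa ab ch1 _ _ bda bdb zs _ _ kpE ul rR cov)) => //.
- by move=> c1 r1 adv; apply: force_now; left.
- by right; rewrite bE.
- by right.
- move=> q y; rewrite /= !mem_cat !mem_filter => /or3P[/andP[_]|yq|/andP[_]].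
  + by case: (pre_cases sg1 P) => ->; rewrite // inE => /eqP->; exact: mem_head.
  + by rewrite inE mem_rcons inE yq !orbT.
  + by case: (post_cases sg1 P) => ->; rewrite // inE => /eqP->; rewrite inE mem_rcons mem_head orbT.
- by move=> q; rewrite B1 B2 !cats0.
Qed.

End Absorb.

(** The anchor of [w] was no contact, so no block changes. A segment that becomes unlinked has an
    empty chain, and only its other anchor can be a contact. *)
Lemma kill_invariant R sg T w : invariant R sg T -> anchor sg w \notin boundary R ->
  (forall i, linked sg i -> ea i = w \/ eb i = w -> chain sg i = [::]) ->
  invariant R (kill ea eb sg w) T.
Proof.
move=> iv nw cw; have va := i_valid iv.
have fE (b1 b2 : bool) u :
    [seq z <- if [&& b1, b2 & alive (kill ea eb sg w) u] then [:: anchor sg u] else [::] | z \in boundary R] =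
    [seq z <- if [&& b1, b2 & alive sg u] then [:: anchor sg u] else [::] | z \in boundary R].
  rewrite kill_alive; have [->|//] := eqVneq u w.
  by rewrite /= !andbF; case: ifP => //= _; rewrite (negPf nw).
have cE j : contacts R (kill ea eb sg w) j = contacts R sg j.
  rewrite /contacts !filter_cat; congr (_ ++ (_ ++ _)).
    by have := fE (f (ea j) == j) true (ea j).
  exact: fE.
case: (iv) => h1 h2 h3 h4 h5 h6 h7; split => //.
- exact: kill_valid.
- by move=> j jJ; rewrite cE h5.
move=> j jJ nl; rewrite cE; have [lj|/h7->//] := boolP (linked sg j).
have ew : ea j = w \/ eb j = w.
  by move: nl; rewrite /= lj /= negb_and !negbK => /orP[]/eqP; [left|right].
rewrite /contacts (cw _ lj ew) filter_cat.
have pE : size (pre sg j) <= 1 by case: (pre_cases sg j) => ->.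
have qE : size (post sg j) <= 1 by case: (post_cases sg j) => ->.
case: ew => ew.
  have -> : [seq z <- pre sg j | z \in boundary R] = [::].
    by case: (pre_cases sg j) => -> //=; rewrite ew (negPf nw).
  by rewrite size_filter (leq_trans (count_size _ _)).
have -> : [seq z <- [::] ++ post sg j | z \in boundary R] = [::].
  by case: (post_cases sg j) => -> //=; rewrite ew (negPf nw).
by rewrite cats0 size_filter (leq_trans (count_size _ _)).
Qed.

Lemma kill_weight sg w : alive sg w -> weight (kill ea eb sg w) < weight sg.
Proof.
move=> aw; rewrite /weight /= ltn_add2l; apply: proper_card; apply/properP; split.
  by apply/subsetP => u; rewrite !inE kill_alive => /andP[].
by exists w; rewrite !inE ?kill_alive ?eqxx.
Qed.

(** The chain of [f w] is consumed first, since its contacts stay with the same cops. Hence [f w]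
    has an empty chain by the time it must take over a contact of another segment, and [w] is
    dropped only when all its chains are empty. *)
Lemma op_normalize R sg T w c r : invariant R sg T -> alive sg w ->
  anchor sg w \notin boundary R -> r \in R -> covered c r (shadows T) ->
  force (progress R sg) c r.
Proof.
move=> iv aw nw rR cov; have va := i_valid iv.
have [_ wW] := v_alive va (eqP aw).
have now sg' : invariant R sg' T -> weight sg' < weight sg -> force (progress R sg) c r.
  by move=> iv' lt; apply: force_now; right; exists sg', T.
have sideP i : linked sg i -> ea i = w \/ eb i = w -> chain sg i != [::] ->
    exists x l, (ea i = w /\ chain sg i = x :: l) \/ [/\ eb i = w, ea i != w & chain sg i = rcons l x].
  move=> li ew; have [eaw|eaw] := eqVneq (ea i) w.
    by case: (chain sg i) => // x l _; exists x, l; left.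
  case: ew => [E|ebw]; first by rewrite E eqxx in eaw.
  by case/lastP: (chain sg i) => // l x _; exists x, l; right.
have [[lf cf]|nf] := pselect (linked sg (f w) /\ chain sg (f w) != [::]).
  have ew : ea (f w) = w \/ eb (f w) = w by case: (f_end wW) => <-; [left|right].
  have [x [l side]] := sideP _ lf ew cf.
  apply: (now (absorb R sg w (f w) x l)); last exact: (absorb_weight iv aw side).
  by apply: absorb_quiet => //; right.
have chf : chain sg (f w) = [::].
  have [lf|/(v_unlinked va)//] := boolP (linked sg (f w)).
  by apply/eqP; apply: contraT => cf; case: nf.
have [[i [li ew ci]]|ni] := pselect (exists i, [/\ linked sg i, ea i = w \/ eb i = w & chain sg i != [::]]).
  have [x [l side]] := sideP _ li ew ci.
  have iw : i != f w by apply: contraNneq ci => ->; rewrite chf.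
  have [xb|xb] := boolP (x \in boundary R).
    exact: (op_anchor iv aw nw li side xb iw chf wW rR cov).
  apply: (now (absorb R sg w i x l)); last exact: (absorb_weight iv aw side).
  by apply: absorb_quiet => //; left.
apply: (now (kill ea eb sg w)); last exact: kill_weight.
apply: kill_invariant => // i li ew; apply/eqP; apply: contraT => ci.
by case: ni; exists i.
Qed.

(** * Descent to a capture when no complete state exists *)

Definition complete R sg := [/\ valid R sg, cut_connected (mem R), R != set0,
  {in W, forall w, alive sg w /\ anchor sg w \in boundary R} &
  {in J, forall i, linked sg i /\ ell i <= size (contacts R sg i)}].

Hypothesis incomplete : forall R sg, ~ complete R sg.

(** The order of the tests provides the hypotheses of the moves: seeding requires all living anchors
    on the boundary, connecting requires moreover that all cores live, and inserting is left with at
    least two contacts. *)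
Lemma op_step R sg T c r : invariant R sg T -> r \in R -> covered c r (shadows T) ->
  force (progress R sg) c r.
Proof.
move=> iv rR cov; have va := i_valid iv.
have adv : force (advantage R) c r -> force (progress R sg) c r.
  by apply: force_bind => c1 r1 h; apply: force_now; left.
have [[w [aw nw]]|an] := pselect (exists w, alive sg w /\ anchor sg w \notin boundary R).
  exact: op_normalize iv aw nw rR cov.
have {}an v : alive sg v -> anchor sg v \in boundary R.
  by move=> av; apply: contraT => nb; case: an; exists v.
apply: adv.
have [[w [wW nw]]|alW] := pselect (exists w, w \in W /\ ~~ alive sg w).
  exact: op_seed iv wW nw an rR cov.
have {}alW w : w \in W -> alive sg w.
  by move=> wW; apply: contraT => nw; case: alW; exists w.
have [[i [iJ di]]|nd] := pselect (exists i, i \in J /\ ~ (linked sg i /\ ell i <= size (contacts R sg i))).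
  have [eaW ebW] := ends_W iJ.
  have [K1|K2] := leqP (size (contacts R sg i)) 1.
    by apply: op_connect iv iJ _ _ _ _ K1 rR cov; rewrite ?an ?alW.
  apply: (op_insert iv iJ _ rR cov); rewrite K2 /= ltnNge; apply/negP => le.
  apply: di; split => //; apply: contraT => nl.
  by have := i_unlinked iv iJ nl; rewrite leqNgt K2.
case: (@incomplete R sg); split => //.
- exact: i_connected iv.
- by apply/set0Pn; exists r.
- by move=> w wW; rewrite an alW.
- by move=> i iJ; apply: contrapT => di; case: nd; exists i.
Qed.

Lemma invariant_win R sg T c r : invariant R sg T -> r \in R -> covered c r (shadows T) ->
  force (fun _ _ => False) c r.
Proof.
have [n] := ubnP #|R|; elim: n R sg T c r => // n IHn R sg T c r; rewrite ltnS => Rn.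
have [k] := ubnP (weight sg); elim: k sg T c r => // k IHk sg T c r; rewrite ltnS => wk iv rR cov.
apply: (force_bind _ (op_step iv rR cov)) => c1 r1 [[R' [sg' [T' [iv' rR' lt cov']]]]|[sg' [T' [iv' lt rR' cov']]]].
  by apply: IHn iv' rR' cov'; exact: leq_trans lt Rn.
by apply: IHk iv' rR' cov'; exact: leq_trans lt wk.
Qed.

Lemma incomplete_cops_win : cops_win G m.
Proof.
have [x0 _] : exists x0 : G, true.
  by have /card_gt0P[x0 _] := G_connected.1; exists x0.
pose sg0 : state := State (fun _ => None) (fun _ => x0) (fun _ => [::]) (fun _ => false).
(* All cops are paid for from the start, with empty blocks on a constant shadow; the territory is
   the whole graph, without boundary. *)
pose T0 : seq guard := flatten [seq nseq (slots i) (i, [ffun => x0], [::]) | i <- enum J].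
have memT0 t : t \in T0 -> t.1.2 = [ffun => x0] /\ t.2 = [::].
  by case/flattenP => s /mapP[i _ ->]; rewrite mem_nseq => /andP[_ /eqP->].
have bd0 : boundary [set: G] = set0 by apply/setP => z; rewrite !inE.
have cnt i : count (fun t => t.1.1 == i) T0 = if i \in J then slots i else 0.
  have -> : count (fun t => t.1.1 == i) T0 = \sum_(j <- enum J) (if j == i then slots i else 0).
    rewrite /T0; elim: (enum J) => [|j s IH] /=; first by rewrite big_nil.
    rewrite count_cat IH big_cons count_nseq /=; congr (_ + _).
    by case: (j =P i) => [->|]; rewrite ?mul1n.
  rewrite -big_mkcond /= big_enum_cond /= big_mkcondr /=.
  case: ifP => iJ; last first.
    by rewrite big1 // => j jJ; case: eqP => // ji; rewrite -ji jJ in iJ.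
  by rewrite (bigD1 i) //= eqxx big1 ?addn0 // => j /andP[_ /negPf->].
apply: (@cops_win_force _ _ (fun _ => x0)) => r.
apply: (@invariant_win [set: G] sg0 T0); last first.
- exists (take (size T0) (enum 'I_m)); split; first exact: take_uniq (enum_uniq _).
  have szT : size T0 <= m by rewrite (size_guards cnt).
  have -> : [seq (psi : {ffun _}) r | psi <- shadows T0] = nseq (size T0) x0.
    have : {in T0, forall t, t.1.2 r = x0} by move=> t /memT0[-> _]; rewrite ffunE.
    elim: (T0) => //= t T IH h; rewrite h ?mem_head // IH // => t' t'T.
    by apply: h; rewrite inE t'T orbT.
  have constE (s : seq 'I_m) : [seq x0 | _ <- s] = nseq (size s) x0 by elim: s => //= ? ? ->.
  by rewrite constE size_takel // size_enum_ord.
- by rewrite inE.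
split.
- by split => //= x; rewrite bd0 in_set0.
- move=> X x y _ _ Xx Xy.
  have /connectP[p xp E] := G_connected.2 x y.
  elim: p x Xx xp E => [|x' p IH] x Xx /=; first by move=> _ E; rewrite E Xx in Xy.
  case/andP=> e xp E; case Xx' : (X x'); first exact: IH Xx' xp E.
  by exists x, x'; split => //; rewrite Xx'.
- by move=> t /memT0[-> _] a b _ _ _; rewrite !ffunE step_refl.
- by move=> t /memT0[_ ->].
- move=> i iJ; rewrite /contacts /pre /post /= !andbF /=.
  by rewrite /blocks; elim: (T0) memT0 => //= t T IH h; case: ifP => /= _; rewrite ?(h t (mem_head _ _)).2 /=;
    apply: IH => t' t'T; apply: h; rewrite inE t'T orbT.
- exact: cnt.
- by move=> i iJ _; rewrite /contacts /pre /post /= !andbF.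
Qed.

End Strategy.

(** * From a complete partial model to a minor *)

Section Walks.
Variable K : sgraph.
Implicit Types (x a b : K) (p l : seq K) (P : segment K).

Lemma walk_edgesP x p (e : {set K}) : reflect (exists2 k, k < size p &
    e = [set nth x (x :: p) k; nth x (x :: p) k.+1]) (e \in walk_edges x p).
Proof.
rewrite inE; apply: (iffP (nthP set0)) => -[k]; rewrite ?size_pairmap => kp.
  by rewrite (nth_pairmap x) // => <-; exists k.
by move=> ->; exists k; rewrite ?size_pairmap // (nth_pairmap x).
Qed.

Lemma cover_walk x p : 0 < size p -> cover (walk_edges x p) =i x :: p.
Proof.
move=> p0 y; apply/bigcupP/idP => [[e /walk_edgesP[k kp ->]]|/(nthP x)[k kp <-]].
  by rewrite !inE => /orP[]/eqP->; rewrite -in_cons mem_nth //=; lia.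
have [kp'|kp'] := ltnP k (size p).
  exists [set nth x (x :: p) k; nth x (x :: p) k.+1]; last by rewrite !inE eqxx.
  by apply/walk_edgesP; exists k.
have kE : k = (size p).-1.+1 by have {kp} : k < (size p).+1 := kp; lia.
exists [set nth x (x :: p) (size p).-1; nth x (x :: p) (size p).-1.+1]; last by rewrite kE !inE eqxx orbT.
by apply/walk_edgesP; exists (size p).-1 => //; lia.
Qed.

Lemma walk_edges_uniq x p : uniq (x :: p) -> uniq (pairmap (fun y z => [set y; z]) x p).
Proof.
elim: p x => //= y p IH x /and3P[xN yN up]; rewrite IH ?andbT ?yN //.
apply/negP => e; have : [set x; y] \in walk_edges y p by rewrite inE.
case: p {IH up} xN yN e => [|z p] // xN yN _ H.
have : x \in cover (walk_edges y (z :: p)) by apply/bigcupP; exists [set x; y] => //; rewrite !inE eqxx.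
by rewrite cover_walk // (negPf xN).
Qed.

Lemma pairmap_rcons (T S : Type) (g : T -> T -> S) (u v : T) (q : seq T) :
  pairmap g u (rcons q v) = rcons (pairmap g u q) (g (last u q) v).
Proof. by elim: q u => //= z q IH u; rewrite IH. Qed.

Lemma card_walk_edges x p : uniq (pairmap (fun y z => [set y; z]) x p) -> #|walk_edges x p| = size p.
Proof. by move=> u; rewrite cardsE (card_uniqP u) size_pairmap. Qed.

(** Paths and rooted cycles are treated alike, a rooted cycle having [a = b]. The strict inequality
    bounds the number of interior vertices by [#|edges P| - 1], the first term of [ell]. *)
Lemma segment_walk P : is_path P \/ is_rooted_cycle P ->
  exists a b l, [/\ path (@adj K) a (rcons l b), ends P = [set a; b],
    edges P = walk_edges a (rcons l b), size l < #|edges P| &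
    [/\ uniq l, interior P =i l & vertices P =i a :: rcons l b]].
Proof.
case=> [[a [p [ap up p0 eP nP]]]|[a [p [ap up p0 eP nP]]]].
  case/lastP: p ap up p0 eP nP => [//|l b] ap up _ eP nP.
  exists a, b, l; rewrite last_rcons in nP; split => //.
    by rewrite eP card_walk_edges ?size_rcons // walk_edges_uniq.
  have vP : vertices P =i a :: rcons l b by move=> x; rewrite /vertices eP cover_walk ?size_rcons.
  move: up; rewrite /= rcons_uniq mem_rcons inE negb_or => /and3P[/andP[ab al] bl ul].
  split => // x; rewrite /interior inE vP nP !inE mem_rcons inE.
  have [->|xa] := eqVneq x a; first by rewrite (negPf al).
  by have [->|xb] := eqVneq x b; rewrite ?(negPf bl).
exists a, a, p; rewrite nP setUid; split => //.
  rewrite eP card_walk_edges ?size_rcons // pairmap_rcons rcons_uniq walk_edges_uniq // andbT.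
  (* The closing edge differs from all others because the cycle has at least three vertices. *)
  case: p ap up p0 {eP} => [|y [|z p]] // _ up _ /=.
  move: up; rewrite /= !inE !negb_or => /and3P[/and3P[ay az ap] /andP[yz yp] _].
  apply/andP; split.
    apply/eqP => /setP/(_ y); rewrite !inE eqxx orbT.
    have -> : (y == last z p) = false.
      by apply/negbTE/eqP => E; have := mem_last z p; rewrite -E inE (negPf yz) (negPf yp).
    by rewrite eq_sym (negPf ay).
  suff : [set last z p; a] \notin walk_edges y (z :: p) by rewrite inE /= inE negb_or.
  apply/negP => H.
  have : a \in cover (walk_edges y (z :: p)).
    by apply/bigcupP; exists [set last z p; a] => //; rewrite !inE eqxx orbT.
  by rewrite cover_walk // !inE (negPf ay) (negPf az) (negPf ap).
have vP : vertices P =i a :: rcons p a by move=> x; rewrite /vertices eP cover_walk ?size_rcons.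
move: up => /= /andP[al ul]; split => // x.
rewrite /interior inE vP nP !inE mem_rcons inE.
by have [->|xa] := eqVneq x a; first by rewrite (negPf al).
Qed.

End Walks.

(** * Cutting a chain into connected pieces *)

Section Bags.
Variable G : sgraph.
Implicit Types (T S X : pred G).

Lemma path_crossing T X a p : path (@adj G) a p -> (forall x, x \in a :: p -> T x) ->
  X a != X (last a p) -> exists x y, [/\ T x, T y, X x, ~~ X y & adj x y].
Proof.
elim: p a => [|b p IH] a /=; first by rewrite eqxx.
move=> /andP[ab bp] aT ne.
have [E|ne'] := eqVneq (X a) (X b).
  by apply: (IH b) => //; rewrite -?E // => x xb; apply: aT; rewrite inE xb orbT.
have Ta : T a by apply: aT; rewrite mem_head.
have Tb : T b by apply: aT; rewrite !inE eqxx orbT.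
case Xa : (X a) ne' => Xb; first by exists a, b; rewrite Xa Ta Tb ab; split => //; case: (X b) Xb.
by exists b, a; rewrite Xa Ta Tb adj_sym ab; split => //; case: (X b) Xb.
Qed.

Lemma cut_connected_attach S T : cut_connected S -> (forall x, S x -> T x) ->
  (forall x, T x -> exists s p, [/\ S s, path (@adj G) s p, last s p = x & forall y, y \in s :: p -> T y]) ->
  cut_connected T.
Proof.
move=> Sc ST at_ X x y Tx Ty Xx Xy.
have [s [p [Ss sp lx pT]]] := at_ x Tx.
have [s' [p' [Ss' sp' ly pT']]] := at_ y Ty.
case Xs : (X s); last by apply: (path_crossing sp pT); rewrite lx Xs Xx.
case Xs' : (X s'); first by apply: (path_crossing sp' pT'); rewrite ly Xs' (negPf Xy).
have [|u [v [Su Sv Xu Xv e]]] := Sc X s s' Ss Ss' Xs; first by rewrite Xs'.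
by exists u, v; split => //; exact: ST.
Qed.

Lemma cut_connected_path a p : path (@adj G) a p -> cut_connected (mem (a :: p)).
Proof.
move=> ap; apply: (@cut_connected_attach (pred1 a)).
- by apply: (@cut_connected1 _ _ a) => x /eqP.
- by move=> x /eqP->; exact: mem_head.
- move=> x xp; have {xp} xp : x \in a :: p := xp.
  move: xp; rewrite inE => /predU1P[->|xp].
    exists a, [::]; split => //; first exact: eqxx.
    by move=> y; rewrite inE => /eqP->; exact: mem_head.
  have [p1 [p2 E]] := mem_split xp.
  exists a, (rcons p1 x); rewrite last_rcons; split => //; first exact: eqxx.
    by move: ap; rewrite E -cat_rcons cat_path => /andP[].
  move=> y yp; change (is_true (y \in a :: p)).
  by rewrite E -cat_rcons -cat_cons mem_cat yp.
Qed.

Lemma flatten_adj (L : seq (seq G)) k :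
  (if flatten L is x :: p then path (@adj G) x p else true) ->
  {in L, forall s, s != [::]} -> k.+1 < size L ->
  exists x y, [/\ x \in nth [::] L k, y \in nth [::] L k.+1 & adj x y].
Proof.
elim: L k => [|s L IH] k //; rewrite /= => pL Ln kL.
have sn : s != [::] by apply: Ln; rewrite mem_head.
have Ln' : {in L, forall s, s != [::]} by move=> s' sL; apply: Ln; rewrite inE sL orbT.
case: s sn pL {Ln} => // x s _ /=; rewrite cat_path => /andP[xs pL].
case: k kL => [|k] kL; last first.
  apply: IH => //; case: (flatten L) pL => //= y p; by case/andP.
case: L kL Ln' pL {IH} => // s' L _ Ln'.
have : s' != [::] by apply: Ln'; rewrite mem_head.
case: s' {Ln'} => //= y s' _ /andP[e _].
by exists (last x s), y; rewrite mem_last mem_head.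
Qed.

(** Every piece but the last stops at its first element of [B]; the last one takes all that
    remains. *)
Lemma split_pieces (B : pred G) (Q : seq G) n : 0 < n -> n <= count B Q ->
  exists ss : seq (seq G), [/\ size ss = n, flatten ss = Q & {in ss, forall s, has B s}].
Proof.
elim: Q n => [|x Q IH] [|[|n]] //= _ nQ.
  by exists [:: x :: Q]; rewrite /= cats0; split => // s; rewrite inE => /eqP->; rewrite has_count.
have [Bx|Bx] := boolP (B x).
  have [|ss [sz fl hs]] := IH n.+1 isT; first by move: nQ; rewrite Bx add1n.
  exists ([:: x] :: ss); rewrite /= sz fl; split => // s.
  by rewrite inE => /predU1P[->|/hs//]; rewrite /= Bx.
have [|[|s ss] [sz fl hs]] := IH n.+2 isT; [by move: nQ; rewrite (negPf Bx)|by []|].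
exists ((x :: s) :: ss); rewrite -fl; split => // s'.
rewrite inE => /predU1P[->|s's]; last by apply: hs; rewrite inE s's orbT.
by rewrite /= hs ?orbT // mem_head.
Qed.

Lemma find_piece (ss : seq (seq G)) t x : uniq (flatten ss) -> x \in nth [::] ss t ->
  find (fun s => x \in s) ss = t.
Proof.
elim: ss t => [|s ss IH] [|t] //= us; first by move=> ->.
move: us; rewrite cat_uniq => /and3P[_ /hasPn nd us] xt.
have xss : x \in flatten ss.
  apply/flattenP; exists (nth [::] ss t) => //; apply: mem_nth.
  by rewrite ltnNge; apply: contraTN xt => tl; rewrite nth_default.
by have /negPf-> := nd x xss; rewrite (IH t).
Qed.

Lemma path_piece (ss : seq (seq G)) t x a p : path (@adj G) x (flatten ss) ->
  nth [::] ss t = a :: p -> path (@adj G) a p.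
Proof.
elim: ss t x => [|s ss IH] [|t] x //=; rewrite cat_path => /andP[xs pss].
  by move=> sE; rewrite sE /= in xs; case/andP: xs.
exact: IH pss.
Qed.

End Bags.

(** * The model of [H] in a complete state *)

Section CompleteModel.
Variables (H G : sgraph) (h : H) (I : finType).
Notation V := (del_vertex h).
Variables (W : {set V}) (J : {set I}) (mt : rel V) (f : V -> I) (ea eb : I -> V).
Variables (inner : I -> seq V) (ell : I -> nat).
Hypothesis ends_W : {in J, forall i, ea i \in W /\ eb i \in W}.
Hypothesis inner_path : {in J, forall i, path (@adj V) (ea i) (rcons (inner i) (eb i))}.
Hypothesis inner_uniq : {in J, forall i, uniq (inner i)}.
Hypothesis inner_W : {in J, forall i, {in inner i, forall v, v \notin W}}.
Hypothesis inner_inj : {in J &, forall i j v, v \in inner i -> v \in inner j -> i = j}.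
Hypothesis vertex_cases : forall v : V, v \in W \/ exists2 i, i \in J & v \in inner i.
Hypothesis edge_cases : forall u v : V, adj u v ->
  [/\ mt u v, u \in W & v \in W] \/ exists2 i, i \in J &
    exists2 k, k <= size (inner i) &
      [set u; v] = [set nth (ea i) (ea i :: rcons (inner i) (eb i)) k;
                        nth (ea i) (ea i :: rcons (inner i) (eb i)) k.+1].
Hypothesis ell_ge : {in J, forall i,
  size (inner i) + (f (ea i) == i) + ((f (eb i) == i) && (ea i != eb i)) <= ell i}.

Variables (R : {set G}) (sg : state G V I).
Hypothesis compl : complete W J mt f ea eb ell R sg.

Let va : valid W J mt ea eb R sg. Proof. by case: compl. Qed.

(** A chain vertex is alone in its class under [same], so only the two ends of the walk have to be
    chosen inside cores. The last step is left as a [step], since it may be trivial if the chain is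
    empty and both ends share a core. *)
Lemma chain_walk i : i \in J -> exists x y,
  [/\ label sg x = Some (inl (ea i)), label sg y = Some (inl (eb i)),
      path (@step G) x (rcons (chain sg i) y) &
      path (@adj G) x (chain sg i)].
Proof.
move=> iJ; have [_ _ _ _ /(_ i iJ)[li _]] := compl.
have [_ /eqP aa /eqP ab] := v_linked va li.
have core w z z' : label sg z = Some (inl w) -> same sg z z' -> label sg z' = Some (inl w).
  by move=> zw /same_coreP[<-//|[u []]]; rewrite zw => -[->].
have lone z z' : label sg z = Some (inr i) -> same sg z z' -> z' = z.
  by move=> zi /same_coreP[->//|[u []]]; rewrite zi.
have chl z : z \in chain sg i -> label sg z = Some (inr i) by rewrite (v_chain va) => /eqP.
have uq := v_uniq va i.
move: chl uq; case: (chain sg i) => [|z Q] chl uq /=.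
  rewrite andbT => /connP[x [y [sx sy st]]]; exists x, y.
  by rewrite (core _ _ _ aa sx) (core _ _ _ ab sy) st.
case/andP=> /connP[x [z' [sx sz st]]] pQ.
have zl : label sg z = Some (inr i) by apply: chl; rewrite mem_head.
rewrite (lone z z' zl sz) in st.
have xl := core _ _ _ aa sx.
have [y [yl pst pad]] : exists y, [/\ label sg y = Some (inl (eb i)), path (@step G) z (rcons Q y) & path (@adj G) z Q].
  elim: Q z chl uq pQ zl {st sz} => [|z1 Q IH] z chl uq /=.
    rewrite andbT => /connP[u [y [su sy st]]] zl; exists y.
    by rewrite (core _ _ _ ab sy) -(lone z u zl su) st.
  move=> /andP[/connP[u [v [su sv st]]] pQ] zl.
  have z1l : label sg z1 = Some (inr i) by apply: chl; rewrite !inE eqxx orbT.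
  rewrite (lone z u zl su) (lone z1 v z1l sv) in st.
  have [||y [yl pst pad]] := IH z1 _ _ pQ z1l.
  - by move=> z2 z2Q; apply: chl; rewrite inE z2Q orbT.
  - by case/andP: uq.
  exists y; split => //=; first by rewrite st.
  rewrite pad andbT; by case/stepP: st => // E; move: uq; rewrite E cons_uniq mem_head.
exists x, y; split => //=; first by rewrite st.
by rewrite pad andbT; case/stepP: st => // E; rewrite E zl in xl.
Qed.

(** The anchors among the contacts are at most those counted in [ell_ge], so that at least one
    contact per interior vertex lies on the chain. *)
Lemma chain_pieces i : i \in J -> exists ss : seq (seq G),
  [/\ size ss = size (inner i), 0 < size (inner i) -> flatten ss = chain sg i &
      {in ss, forall s, has (fun z => z \in boundary R) s}].
Proof.
move=> iJ; have [_ _ _ _ /(_ i iJ)[li le]] := compl.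
have cnt : size (inner i) <= count (fun z => z \in boundary R) (chain sg i).
  have := leq_trans (ell_ge iJ) le; rewrite /contacts size_filter !count_cat.
  have c1 : count (fun z => z \in boundary R) (pre f ea sg i) <= (f (ea i) == i).
    by apply: leq_trans (count_size _ _) _; rewrite /pre; case: (f (ea i) == i) => //=; case: ifP.
  have c2 : count (fun z => z \in boundary R) (post f ea eb sg i) <= (f (eb i) == i) && (ea i != eb i).
    apply: leq_trans (count_size _ _) _; rewrite /post; case: (f (eb i) == i) => //=.
    by case: (ea i != eb i) => //=; case: ifP.
  by move: c1 c2; lia.
case: (inner i) cnt => [|v p] cnt; first by exists [::].
have [ss [sz fl hs]] := split_pieces (ltn0Sn (size p)) cnt.
by exists ss; split.
Qed.

Lemma complete_model : exists phi : G -> option H, model phi.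
Proof.
have [_ Rc R0 Wal Jlk] := compl.
have /choice[xs xsP] : forall i, exists x, i \in J -> exists y,
  [/\ label sg x = Some (inl (ea i)), label sg y = Some (inl (eb i)),
      path (@step G) x (rcons (chain sg i) y) & path (@adj G) x (chain sg i)].
  move=> i; have [iJ|iJ] := boolP (i \in J); last by exists (anchor sg (ea i)).
  by have [x [y xy]] := chain_walk iJ; exists x; exists y.
have /choice[ys ysP] : forall i, exists y, i \in J ->
  [/\ label sg (xs i) = Some (inl (ea i)), label sg y = Some (inl (eb i)),
      path (@step G) (xs i) (rcons (chain sg i) y) & path (@adj G) (xs i) (chain sg i)].
  move=> i; have [iJ|iJ] := boolP (i \in J); last by exists (anchor sg (ea i)).
  by have [y xy] := xsP i iJ; exists y.
have /choice[ss ssP] : forall i, exists ss : seq (seq G), i \in J ->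
  [/\ size ss = size (inner i), 0 < size (inner i) -> flatten ss = chain sg i &
      {in ss, forall s, has (fun z => z \in boundary R) s}].
  move=> i; have [iJ|iJ] := boolP (i \in J); last by exists [::].
  by have [s sP] := chain_pieces iJ; exists s.
(* Without interior vertices the whole chain joins the branch set of [ea i]; otherwise its pieces
   are the branch sets of the interior vertices, in order. *)
pose colr i x : V := if inner i is [::] then ea i else
  nth (ea i) (inner i) (find (fun s => x \in s) (ss i)).
pose phi x : option H := if x \in R then Some h else
  match label sg x with
  | Some (inl w) => Some (val w) | Some (inr i) => Some (val (colr i x)) | None => None
  end.
have phiR x : x \in R -> phi x = Some h by rewrite /phi => ->.
have NR x l : label sg x = Some l -> x \in R = false.
  by move=> xl; apply/negbTE/negP => /(v_territory va); rewrite xl.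
have phiW x w : label sg x = Some (inl w) -> phi x = Some (val w).
  by move=> xw; rewrite /phi (NR _ _ xw) xw.
have phiJ x i : label sg x = Some (inr i) -> phi x = Some (val (colr i x)).
  by move=> xi; rewrite /phi (NR _ _ xi) xi.
have inJ x i : label sg x = Some (inr i) -> i \in J.
  move=> xi; have li : linked sg i.
    apply: contraT => /(v_unlinked va) ci; have := v_chain va i x.
    by rewrite ci xi eqxx.
  by have [] := v_linked va li.
have phiRI x : phi x = Some h -> x \in R.
  rewrite /phi; case: ifP => // _; case: (label sg x) => [[w|i]|] // -[E].
    by case/eqP: (valP w).
  by case/eqP: (valP (colr i x)).
have phiI x (v : V) : phi x = Some (val v) -> label sg x = Some (inl v) \/
    exists i, [/\ i \in J, label sg x = Some (inr i) & colr i x = v].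
  rewrite /phi; case: ifP => [_ [E]|_]; first by case/eqP: (valP v).
  case E : (label sg x) => [[w|i]|] // -[/val_inj <-]; first by left.
  by right; exists i; split => //; exact: inJ E.
have flat i : i \in J -> 0 < size (inner i) -> flatten (ss i) = chain sg i.
  by move=> iJ; have [_ + _] := ssP i iJ.
have szs i : i \in J -> size (ss i) = size (inner i) by move=> iJ; have [] := ssP i iJ.
have piece i t x : i \in J -> t < size (inner i) -> x \in nth [::] (ss i) t ->
    label sg x = Some (inr i) /\ colr i x = nth (ea i) (inner i) t.
  move=> iJ tn xt; have n0 : 0 < size (inner i) by exact: leq_ltn_trans tn.
  split.
    apply/eqP; rewrite -(v_chain va) -flat //; apply/flattenP; exists (nth [::] (ss i) t) => //.
    by apply: mem_nth; rewrite szs.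
  have ft : find (fun s => x \in s) (ss i) = t.
    by apply: find_piece => //; rewrite flat // (v_uniq va).
  by rewrite /colr ft; case: (inner i) n0.
have pieceI i x : label sg x = Some (inr i) -> 0 < size (inner i) ->
    exists t, [/\ t < size (inner i), x \in nth [::] (ss i) t & colr i x = nth (ea i) (inner i) t].
  move=> xi n0; have iJ := inJ _ _ xi.
  have hx : has (fun s => x \in s) (ss i).
    have : x \in flatten (ss i) by rewrite flat // (v_chain va) xi.
    by move=> /flattenP[s sS xsx]; apply/hasP; exists s.
  exists (find (fun s => x \in s) (ss i)); split.
  - by rewrite -szs // -has_find.
  - exact: (nth_find [::] hx).
  - by rewrite /colr; case: (inner i) n0.
(* Every branch set touches [R], whichever vertices are adjacent to [h]. *)
have bdry (v : V) : exists2 x, phi x = Some (val v) & x \in boundary R.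
  case: (vertex_cases v) => [vW|[i iJ vi]].
    have [/eqP al an] := Wal v vW; by exists (anchor sg v) => //; exact: phiW.
  have ti : index v (inner i) < size (inner i) by rewrite index_mem.
  have [_ _ hs] := ssP i iJ.
  have /hasP[x xt xb] : has (fun z => z \in boundary R) (nth [::] (ss i) (index v (inner i))).
    by apply: hs; apply: mem_nth; rewrite szs.
  have [xi xc] := piece _ _ _ iJ ti xt.
  by exists x => //; rewrite (phiJ _ _ xi) xc nth_index.
have cases (g : H) : g = h \/ exists v : V, g = val v.
  by have [->|gh] := eqVneq g h; [left|right; exists (Sub g gh); rewrite SubK].
exists phi; split.
- move=> g; case: (cases g) => [->|[v ->]]; last by have [x xv _] := bdry v; exists x.
  by have /set0Pn[x xR] := R0; exists x; exact: phiR.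
- move=> g; case: (cases g) => [->|[v ->]].
    apply: (cut_connected_eq _ Rc) => x; apply/idP/eqP; first exact: phiR.
    exact: phiRI.
  case: (vertex_cases v) => [vW|[i iJ vi]].
    have cv : cut_connected (fun x => label sg x == Some (inl v)) by apply: (v_core va).
    apply: (cut_connected_attach cv).
      by move=> x /eqP/phiW/eqP.
    move=> x /eqP/phiI[xv|[i [iJ xi xc]]].
      exists x, [::]; rewrite /= xv eqxx; split => // y; rewrite inE => /eqP->.
      by rewrite (phiW _ _ xv).
    have n0 : inner i = [::].
      case E : (inner i) => [//|v0 p]; have [|t [tn _ ct]] := pieceI i x xi; first by rewrite E.
      by have := inner_W iJ (mem_nth (ea i) tn); rewrite -ct xc vW.
    have colE z : label sg z = Some (inr i) -> phi z = Some (val v).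
      by move=> zi; rewrite (phiJ _ _ zi) -xc /colr n0.
    have eav : ea i = v by rewrite -xc /colr n0.
    have [xl _ _ pad] := ysP i iJ.
    have /mem_split[q1 [q2 cE]] : x \in chain sg i by rewrite (v_chain va) xi.
    exists (xs i), (rcons q1 x); rewrite last_rcons xl eav eqxx; split => //.
      by move: pad; rewrite cE -cat_rcons cat_path => /andP[].
    move=> y; rewrite inE => /predU1P[->|yq]; first by rewrite (phiW _ _ xl) eav.
    rewrite (colE y) //; apply/eqP; rewrite -(v_chain va) cE -cat_rcons mem_cat.
    by rewrite yq.
  have tn : index v (inner i) < size (inner i) by rewrite index_mem.
  have n0 : 0 < size (inner i) by exact: leq_ltn_trans tn.
  set t := index v (inner i) in tn.
  have [_ _ _ pad] := ysP i iJ; rewrite -flat // in pad.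
  have TE x : (phi x == Some (val v)) = (x \in nth [::] (ss i) t).
    apply/eqP/idP => [/phiI[xv|[j [jJ xj xc]]]|xt].
    - have [_ vW] := v_alive va xv; by have := inner_W iJ vi; rewrite vW.
    - case E : (inner j) => [|v0 p].
        have [eW _] := ends_W jJ; have := inner_W iJ vi; rewrite -xc /colr E eW //.
      have [|t' [tn' xt' ct']] := pieceI j x xj; first by rewrite E.
      have vj : v \in inner j by rewrite -xc ct' mem_nth.
      have ji := inner_inj jJ iJ vj vi; rewrite ji in tn' xt' ct'.
      suff -> : t = t' by [].
      by rewrite /t -xc ji ct' index_uniq // inner_uniq.
    - by have [xi xc] := piece _ _ _ iJ tn xt; rewrite (phiJ _ _ xi) xc nth_index.
  case E : (nth [::] (ss i) t) => [|a p].
    by move=> X x y; rewrite TE E.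
  apply: (cut_connected_eq _ (cut_connected_path (path_piece pad E))) => x.
  by rewrite TE E.
- have adjR (v : V) : exists x y, [/\ phi x = Some h, phi y = Some (val v) & adj x y].
    have [y yv /boundaryP[_ [x xR xy]]] := bdry v; by exists x, y; rewrite phiR.
  have sym g g' : (exists x y, [/\ phi x = Some g, phi y = Some g' & adj x y]) ->
      exists x y, [/\ phi x = Some g', phi y = Some g & adj x y].
    by move=> [x [y [? ? ?]]]; exists y, x; rewrite adj_sym.
  move=> g g'; case: (cases g) => [->|[u ->]]; case: (cases g') => [->|[v ->]].
  + by rewrite adj_irr.
  + by move=> _; exact: adjR.
  + by move=> _; exact: sym.
  move=> uv; case: (edge_cases (uv : adj u v)) => [[muv uW vW]|[i iJ [k kn E]]].
    have [x [y [xu yv e]]] := v_mates va muv (Wal u uW).1 (Wal v vW).1.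
    by exists x, y; rewrite (phiW _ _ xu) (phiW _ _ yv).
  have [xl yl pst pad] := ysP i iJ.
  set C := ea i :: rcons (inner i) (eb i) in E.
  suff [x [y [xk yk e]]] : exists x y, [/\ phi x = Some (val (nth (ea i) C k)),
      phi y = Some (val (nth (ea i) C k.+1)) & adj x y].
    have ne : u != v by apply/eqP => uv'; rewrite uv' adj_irr in uv.
    have /set2P[Eu|Eu] : u \in [set nth (ea i) C k; nth (ea i) C k.+1] by rewrite -E !inE eqxx.
      have /set2P[Ev|Ev] : v \in [set nth (ea i) C k; nth (ea i) C k.+1] by rewrite -E !inE eqxx orbT.
        by rewrite Eu Ev eqxx in ne.
      by exists x, y; rewrite Eu Ev.
    have /set2P[Ev|Ev] : v \in [set nth (ea i) C k; nth (ea i) C k.+1] by rewrite -E !inE eqxx orbT.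
      by apply: sym; exists x, y; rewrite Eu Ev.
    by rewrite Eu Ev eqxx in ne.
  (* Equality is excluded by the labels, except for an empty chain with both ends in one core; there
     [inner_path] makes [ea i] and [eb i] adjacent, hence distinct. *)
  have lastE : inner i = [::] \/ chain sg i != [::] -> adj (last (xs i) (chain sg i)) (ys i).
    move=> cn; move: pst; rewrite rcons_path => /andP[_ /stepP[lE|//]]; exfalso.
    have [c0|cN] := eqVneq (chain sg i) [::].
      case: cn => [n0|]; last by rewrite c0.
      have := inner_path iJ; rewrite n0 => /andP[eab _].
      move: lE yl; rewrite c0 /= => <-; rewrite xl => -[eE].
      by have := adj_irr (eb i); rewrite -{1}eE => /negP; apply; exact: eab.
    have : last (xs i) (chain sg i) \in chain sg i.
      by case: (chain sg i) cN => //= z l _; exact: mem_last.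
    by rewrite lE (v_chain va) yl.
  case n0 : (inner i) => [|v0 p].
    have -> : k = 0 by move: kn; rewrite n0 leqn0 => /eqP.
    exists (last (xs i) (chain sg i)), (ys i); rewrite /C n0 /= (phiW _ _ yl); split => //.
      case cE : (chain sg i) => [|z l] /=; first exact: phiW.
      have zi : label sg (last z l) = Some (inr i).
        by apply/eqP; rewrite -(v_chain va) cE; exact: mem_last.
      by rewrite (phiJ _ _ zi) /colr n0.
    by apply: lastE; left.
  have np : 0 < size (inner i) by rewrite n0.
  have cN : chain sg i != [::].
    have [_ _ hs] := ssP i iJ; rewrite -flat //.
    have : nth [::] (ss i) 0 \in ss i by apply: mem_nth; rewrite szs.
    case: (ss i) hs => //= s l hs _; have : has (fun z => z \in boundary R) s by apply: hs; rewrite mem_head.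
    by case: s {hs}.
  (* Framed by one vertex of each end core, the pieces are indexed exactly as the vertices of the
     walk [C]. *)
  pose L := [:: xs i] :: rcons (ss i) [:: ys i].
  have flL : flatten L = xs i :: rcons (chain sg i) (ys i).
    by rewrite /L /= flatten_rcons flat // cats1.
  have [|||x [y [xk yk e]]] := @flatten_adj _ L k.
  - by rewrite flL rcons_path pad lastE //; right.
  - have [_ _ hs] := ssP i iJ.
    by move=> s; rewrite /L inE mem_rcons inE => /or3P[/eqP->|/eqP->|/hs] //; case: s.
  - by rewrite /L /= size_rcons szs.
  have nthL t z : t <= (size (inner i)).+1 -> z \in nth [::] L t -> phi z = Some (val (nth (ea i) C t)).
    case: t => [_|t]; first by rewrite inE => /eqP->; exact: phiW.
    rewrite ltnS /L /C /= !nth_rcons szs // => tn.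
    case: ltnP => [tn'|tn'] zt.
      by have [zi zc] := piece _ _ _ iJ tn' zt; rewrite (phiJ _ _ zi) zc.
    have tE : t = size (inner i) by apply/eqP; rewrite eqn_leq tn tn'.
    by move: zt; rewrite tE eqxx inE => /eqP->; exact: phiW.
  by exists x, y; split => //; [exact: (nthL _ _ (leqW kn) xk)|by apply: (nthL _ _ _ yk); rewrite ltnS].
Qed.

End CompleteModel.

Theorem theorem4p3 (H : sgraph) (D : decomposition H) (G : sgraph)
    (G_connected : connected G) (G_minor_free : minor_free H G) :
  cop_number G <=
    ell_indicator D + \sum_(P in dec_P D) ceil_div (ell P) 3.
Proof.
rewrite /cop_number; case: ex_minnP => n _ nmin; apply: nmin; apply/asboolP => {n}.
set V := del_vertex (dec_h D).
have [w0 w0W] : exists w, w \in dec_W D by apply/set0Pn; exact: dec_W_neq0.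
have /choice[wk wkP] : forall P : segment V, exists t : V * V * seq V, P \in dec_P D ->
    [/\ path (@adj V) t.1.1 (rcons t.2 t.1.2), ends P = [set t.1.1; t.1.2],
      edges P = walk_edges t.1.1 (rcons t.2 t.1.2), size t.2 < #|edges P| &
      [/\ uniq t.2, interior P =i t.2 & vertices P =i t.1.1 :: rcons t.2 t.1.2]].
  move=> P; have [PD|_] := boolP (P \in dec_P D); last by exists (w0, w0, [::]).
  by have [a [b [l abl]]] := segment_walk (dec_P_segment PD); exists (a, b, l).
pose ea P := (wk P).1.1; pose eb P := (wk P).1.2; pose inner P := (wk P).2.
pose J := dec_P D :\: dec_M D.
have JP P : P \in J -> P \in dec_P D by rewrite inE => /andP[].
have MP P : P \in dec_M D -> P \in dec_P D by exact: (subsetP (dec_M_sub D)).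
pose mt : rel V := fun u v => (u != v) && [exists P in dec_M D, ends P == [set u; v]].
have endsP P v : P \in dec_P D -> v \in ends P -> v \in vertices P.
  move=> /wkP[_ -> _ _ [_ _ vP]]; rewrite vP !inE mem_rcons inE => /orP[]->; by rewrite ?orbT.
have endsW P v : P \in dec_P D -> v \in ends P -> v \in dec_W D.
  by move=> /dec_P_ends/subsetP; exact.
have edgeM P u v : P \in dec_M D -> [set u; v] \in edges P -> [set u; v] = ends P.
  move=> PM; have [_ -> eP lt _] := wkP P (MP P PM).
  have [_ E1] := dec_M_path PM; rewrite E1 ltnS leqn0 size_eq0 in lt.
  by rewrite eP (eqP lt) inE /= inE => /eqP.
have edgeV P u v : P \in dec_P D -> [set u; v] \in edges P -> u \in vertices P.
  by move=> PD e; apply/bigcupP; exists [set u; v]; rewrite // !inE eqxx.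
have mt_sym : symmetric mt.
  by move=> u v; rewrite /mt eq_sym setUC.
have mt_irr : irreflexive mt by move=> u; rewrite /mt eqxx.
have mt_uniq u v v' : mt u v -> mt u v' -> v = v'.
  move=> /andP[uv /exists_inP[P PM /eqP PE]] /andP[uv' /exists_inP[P' PM' /eqP PE']].
  have uP : u \in vertices P by apply: endsP; rewrite ?MP // PE !inE eqxx.
  have uP' : u \in vertices P' by apply: endsP; rewrite ?MP // PE' !inE eqxx.
  have PP : P = P'.
    apply/eqP; apply: contraT => ne; have := dec_M_matching PM PM' ne.
    by move=> /disjointFr/(_ uP); rewrite uP'.
  have : v \in [set u; v'] by rewrite -PE' -PP PE !inE eqxx orbT.
  by rewrite !inE eq_sym (negPf uv) => /eqP.
have f_J : {in dec_W D, forall w, dec_f w \in J} by move=> w wW; exact: dec_f_in.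
have f_end : {in dec_W D, forall w, w = ea (dec_f w) \/ w = eb (dec_f w)}.
  move=> w wW; have := dec_f_end wW; have [_ -> _ _ _] := wkP _ (JP _ (f_J w wW)).
  by rewrite !inE => /orP[]/eqP; [left|right].
have ends_W : {in J, forall P, ea P \in dec_W D /\ eb P \in dec_W D}.
  move=> P PJ; have [_ E _ _ _] := wkP _ (JP _ PJ).
  by split; apply: (endsW P _ (JP _ PJ)); rewrite E !inE eqxx ?orbT.
have ell_gt0 : {in J, forall P, 0 < ell P}.
  by move=> P; rewrite inE => /andP[/negPf nM _]; rewrite /ell nM leq_max orbT.
have sumE : \sum_(P in dec_P D) ceil_div (ell P) 3 = \sum_(P in J) ceil_div (ell P) 3.
  rewrite (bigID (mem (dec_M D))) /= big1 ?add0n.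
    by apply: eq_bigl => P; rewrite inE andbC.
  by move=> P /andP[_ PM]; rewrite /ell PM.
rewrite sumE.
have inner_W : {in J, forall P, {in inner P, forall v, v \notin dec_W D}}.
  move=> P PJ v vP; apply/negP => vW.
  have [_ _ _ _ [_ iP _]] := wkP _ (JP _ PJ); rewrite -iP in vP.
  have fJ := f_J v vW; have fe := dec_f_end vW.
  have [E|ne] := eqVneq P (dec_f v).
    by move: vP; rewrite inE E fe.
  have := dec_P_disjoint (JP _ PJ) (JP _ fJ) ne.
  by move=> /disjointFr/(_ vP); rewrite endsP // JP.
apply: (@incomplete_cops_win G V _ (dec_W D) J mt (@dec_f _ D) ea eb (@ell _ D) _) => //.
- exact: leq_addl.
(* If the indicator is 1, one cop is spare. If it is 0, the value 0 is impossible on [J], so only 1,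
   2 and 4 remain. *)
- have [ind|ind] := boolP (ell_indicator D); [by left; rewrite -addn1 addnC|right].
  move=> P PJ; move: ind; rewrite negb_exists_in => /forall_inP/(_ P (JP _ PJ)).
  by rewrite negbK inE => /predU1P[E|//]; have := ell_gt0 P PJ; rewrite E.
(* A complete state would turn [H] into a minor of [G]. *)
move=> R sg compl; apply: G_minor_free.
suff [phi] : exists phi : G -> option H, model phi by exact: model_minor.
apply: (@complete_model _ _ _ _ _ _ mt (@dec_f _ D) ea eb inner (@ell _ D) _ _ _ _ _ _ _ _ R sg compl) => //.
- by move=> P PJ; have [] := wkP _ (JP _ PJ).
- by move=> P PJ; have [_ _ _ _ []] := wkP _ (JP _ PJ).
- move=> P Q PJ QJ v vP vQ; apply/eqP; apply: contraT => ne.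
  have [_ _ _ _ [_ iP _]] := wkP _ (JP _ PJ); rewrite -iP in vP.
  have [_ _ _ _ [_ iQ _]] := wkP _ (JP _ QJ); rewrite -iQ in vQ.
  have := dec_P_disjoint (JP _ PJ) (JP _ QJ) ne => /disjointFr/(_ vP).
  by move: vQ; rewrite inE => /andP[_ ->].
- move=> v; have [y vy] := dec_no_isolated v.
  have [P PD e] := dec_P_cover vy.
  have [PM|PM] := boolP (P \in dec_M D).
    by left; apply: (endsW P _ PD); rewrite -(edgeM P v y PM e) !inE eqxx.
  have PJ : P \in J by rewrite inE PM.
  have := edgeV P v y PD e; have [_ E _ _ [_ _ vP]] := wkP _ PD; rewrite vP inE mem_rcons inE.
  case/or3P => [/eqP->|/eqP->|vi]; [left|left|right; by exists P]; by have [] := ends_W P PJ.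
- move=> u v uv; have [P PD e] := dec_P_cover uv.
  have [PM|PM] := boolP (P \in dec_M D).
    left; have E := edgeM P u v PM e; split.
    + apply/andP; split; first by apply/eqP => uv'; rewrite uv' adj_irr in uv.
      by apply/exists_inP; exists P; rewrite // E.
    + by apply: (endsW P _ PD); rewrite -E !inE eqxx.
    + by apply: (endsW P _ PD); rewrite -E !inE eqxx orbT.
  have PJ : P \in J by rewrite inE PM.
  right; exists P => //; have [_ _ E _ _] := wkP _ PD.
  by move: e; rewrite E => /walk_edgesP[k]; rewrite size_rcons ltnS => kl ->; exists k.
- move=> P PJ; have [_ _ _ lt _] := wkP _ (JP _ PJ); have [eaW ebW] := ends_W P PJ.
  have nM : P \in dec_M D = false by apply/negbTE; move: PJ; rewrite inE => /andP[].
  rewrite /ell nM leq_max; apply/orP; left.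
  (* The ends of a rooted cycle are a single vertex, which the fiber counts once; this matches the
     condition [ea P != eb P]. *)
  have fib : (dec_f (ea P) == P) + ((dec_f (eb P) == P) && (ea P != eb P)) <= #|dec_fiber P|.
    case fa : (dec_f (ea P) == P); case fb : (dec_f (eb P) == P) => //=.
    - have [E|ne] := eqVneq (ea P) (eb P); last first.
        rewrite -[1 + 1]/2; have <- : #|[set ea P; eb P]| = 2 by rewrite cards2 ne.
        by apply: subset_leq_card; apply/subsetP => x; rewrite !inE => /orP[]/eqP->; rewrite ?eaW ?ebW ?fa ?fb.
      by rewrite card_gt0; apply/set0Pn; exists (ea P); rewrite inE eaW fa.
    - by rewrite card_gt0; apply/set0Pn; exists (ea P); rewrite inE eaW fa.
    - case: (_ != _) => //; rewrite card_gt0; apply/set0Pn; exists (eb P); by rewrite inE ebW fb.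
  by rewrite -addnA leq_add // subn1 -ltnS (ltn_predK lt).
Qed.
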